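(* Let $\nu,\mu$ be normal weights on $\mathbb D$, let $\alpha>-1$ and let $\omega$ be a weight function such that $\{\nu,\omega\}$ is a normal pair with $\nu(r)\omega(r)=(1-r^2)^\alpha$ for $0\le r<1$. Let $g\in H(\mathbb D)$ and let $\phi$ be an analytic self-map of $\mathbb D$ such that $T_g^\phi:\mathcal H^\infty_\nu\to\mathcal H^\infty_\mu$ is bounded. Then the following statements are equivalent. (a) $T_g^\phi:\mathcal H^0_\nu\to\mathcal H^\infty_\mu$ is nuclear. (b) $T_g^\phi:\mathcal H^\infty_\nu\to\mathcal H^\infty_\mu$ is nuclear. (c) $$\int_{\mathbb D}\left[\sup_{z\in\mathbb D}\frac{(1-|z|^2)\mu(z)|g'(z)|}{|1-\bar\zeta\phi(z)|^{\alpha+2}}\right]\frac{(1-|\zeta|^2)^\alpha}{\nu(\zeta)}\,dA(\zeta)<\infty.$$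
   Context: $\mathbb D$ is the open unit disk in $\mathbb C$, $H(\mathbb D)$ the space of analytic functions on $\mathbb D$, and $dA$ normalized Lebesgue measure on $\mathbb D$. For $g\in H(\mathbb D)$ and an analytic map $\phi:\mathbb D\to\mathbb D$, $(T_g^\phi f)(z)=\int_0^z f(\phi(\zeta))g'(\zeta)\,d\zeta$ for $f\in H(\mathbb D)$, $z\in\mathbb D$. A radial weight is a continuous positive function $\nu$ on $\mathbb D$ with $\nu(z)=\nu(|z|)$, non-increasing in $|z|$. It is normal if: (I) there is $\beta>0$ such that $r\mapsto\nu(r)/(1-r^2)^\beta$ is almost increasing on $[0,1)$; and (II) there is $\gamma>0$ such that $r\mapsto\nu(r)/(1-r^2)^\gamma$ is almost decreasing on $[0,1)$. (A function $h$ is almost increasing if there is $C>0$ with $h(r)\le C h(s)$ for all $r\le s$; almost decreasing if $h(s)\le C h(r)$ for all $r\le s$.) $\{\nu,\omega\}$ is a normal pair if $\nu$ is normal, $\omega$ is radial, positive and continuous with $\int_0^1\omega(r)\,dr<\infty$, and $\nu(r)\omega(r)=(1-r^2)^\alpha$, $0\le r<1$, for some $\alpha>\beta-1$, where $\beta>0$ is an exponent as in (I) for $\nu$. $\mathcal H^\infty_\nu=\{f\in H(\mathbb D):\|f\|_{\mathcal H^\infty_\nu}=\sup_{z\in\mathbb D}\nu(z)|f(z)|<\infty\}$ and $\mathcal H^0_\nu=\{f\in H(\mathbb D):\lim_{|z|\to1^-}\nu(z)|f(z)|=0\}$, with the norm of $\mathcal H^\infty_\nu$. A linear operator $T:X\to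 Y$ between Banach spaces is nuclear if there are sequences $(x_k')\subset X'$ (the dual of $X$) and $(y_k)\subset Y$ with $\sum_k\|x_k'\|\|y_k\|<\infty$ and $Tx=\sum_k x_k'(x)y_k$ for all $x\in X$. *)

(* Defs.v *)
From HB Require Import structures.
From mathcomp Require Import all_boot all_order all_algebra.
From mathcomp Require Export complex.
From mathcomp Require Import all_classical all_reals all_analysis.

Set Implicit Arguments.
Unset Strict Implicit.
Unset Printing Implicit Defensive.

Import Order.TTheory GRing.Theory Num.Theory.
Import numFieldNormedType.Exports.
Export ComplexField.

Local Open Scope classical_set_scope.
Local Open Scope ring_scope.
Local Open Scope complex_scope.

HB.instance Definition _ (R : realType) := NormedModule.copy R[i] R[i]^o.

(* The modulus as an element of R; `|z| = (normc z)%:C. *)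
Notation normc := Normc.normc.

Section Disk.
Variable R : realType.
Implicit Types (f g phi : R[i] -> R[i]) (z : R[i]).

Definition disk : set R[i] := [set z | normc z < 1].

(* [derivable f z 1] is complex differentiability: the difference quotient is
   taken over increments in the field R[i]. Values of f off the disk play no
   role. *)
Definition analytic f : Prop := forall z, disk z -> derivable f z 1.

Definition self_map phi : Prop := forall z, disk z -> disk (phi z).

Definition complex_integral01 (F : R -> R[i]) : R[i] :=
  (\int[lebesgue_measure]_(t in `[0, 1]) complex.Re (F t)) +i*
  (\int[lebesgue_measure]_(t in `[0, 1]) complex.Im (F t)).

(* The line integral from 0 to z of f(phi(zeta)) g'(zeta) dzeta, along the
   segment zeta = t z, 0 <= t <= 1. *)
Definition int_op g phi f z : R[i] :=
  z * complex_integral01 (fun t => f (phi (t%:C * z)) * derive1 g (t%:C * z)).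

(* Integration against normalized Lebesgue measure dA = pi^-1 dx dy. *)
Definition area_integral (F : R[i] -> \bar R) : \bar R :=
  ((pi^-1)%:E * \int[lebesgue_measure \x lebesgue_measure]_(p in
     [set p : R * R | disk (p.1 +i* p.2)]) F (p.1 +i* p.2))%E.

End Disk.

Section Weights.
Variable R : realType.

Record radial_weight := RadialWeight {
  weight_fun :> R[i] -> R;
  weight_cont : {within @disk R, continuous weight_fun};
  weight_gt0 : forall z, disk z -> 0 < weight_fun z;
  weight_radial : forall z, disk z -> weight_fun z = weight_fun (normc z)%:C;
  weight_noninc : forall z w, disk w -> normc z <= normc w ->
    weight_fun w <= weight_fun z }.

Implicit Types (nu : radial_weight) (om : R[i] -> R) (h : R -> R).

Definition almost_increasing h : Prop := exists2 C : R, 0 < C &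
  forall r s : R, 0 <= r -> r <= s -> s < 1 -> h r <= C * h s.

Definition almost_decreasing h : Prop := exists2 C : R, 0 < C &
  forall r s : R, 0 <= r -> r <= s -> s < 1 -> h s <= C * h r.

Definition normal_exponent_I nu (beta : R) : Prop :=
  0 < beta /\ almost_increasing (fun r => nu r%:C / (1 - r ^+ 2) `^ beta).

Definition normal_exponent_II nu (gamma : R) : Prop :=
  0 < gamma /\ almost_decreasing (fun r => nu r%:C / (1 - r ^+ 2) `^ gamma).

Definition normal nu : Prop :=
  (exists beta, normal_exponent_I nu beta) /\
  (exists gamma, normal_exponent_II nu gamma).

(* {nu, om} is a normal pair, alpha being the exponent of the product. *)
Definition normal_pair nu om (alpha : R) : Prop :=
  [/\ normal nu,
      [/\ {within @disk R, continuous om},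
          (forall z, disk z -> 0 < om z) &
          (forall z, disk z -> om z = om (normc z)%:C)],
      (\int[lebesgue_measure]_(r in `[0%R, 1%R[) (om r%:C)%:E < +oo)%E,
      (exists2 beta, normal_exponent_I nu beta & beta - 1 < alpha) &
      (forall r : R, 0 <= r -> r < 1 ->
         nu r%:C * om r%:C = (1 - r ^+ 2) `^ alpha)].

End Weights.

Section Operators.
Variable R : realType.
Implicit Types X Y : normedModType R[i].

Definition bounded_operator X Y (T : {linear X -> Y}) : Prop :=
  exists M : R, forall x, `|T x| <= M%:C * `|x|.

(* A supremum of reals, meaningful only for bounded l. *)
Definition dual_norm X (l : {linear X -> R[i]}) : R :=
  sup [set normc (l x) | x in [set x : X | `|x| <= 1]].

(* The norms of X and Y take values in R[i]; the real part only changes the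
   type. *)
Definition nuclear X Y (T : {linear X -> Y}) : Prop :=
  exists (xs : nat -> {linear X -> R[i]}) (ys : nat -> Y),
  [/\ (forall k, bounded_operator (xs k)),
      (\sum_(0 <= k <oo) (dual_norm (xs k) * complex.Re `|ys k|)%:E < +oo)%E &
      (forall x, series (fun k => xs k x *: ys k) @ \oo --> T x)].

End Operators.

Section HinfPred.
Variable R : realType.
Variable nu : radial_weight R.
Implicit Types f : R[i] -> R[i].

Definition wvalues f : set R := [set nu z * normc (f z) | z in @disk R].

(* A function on the disk is represented by its extension by 0. *)
Definition Hinf_set : set (R[i] -> R[i]) :=
  [set f | [/\ analytic f, (forall z, ~ disk z -> f z = 0) &
              has_ubound (wvalues f)]].

Definition Hinf_pred : {pred R[i] -> R[i]} := mem Hinf_set.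

Lemma Hinf_predP f : reflect (Hinf_set f) (f \in Hinf_pred).
Proof. by apply: (iffP idP) => [/set_mem|/mem_set]. Qed.

Lemma normc_ge0 (z : R[i]) : 0 <= normc z.
Proof. by case: z => a b; exact: sqrtr_ge0. Qed.

Lemma normcNE (z : R[i]) : `|z| = (normc z)%:C.
Proof. by []. Qed.

Lemma normc_triangle (z w : R[i]) : normc (z + w) <= normc z + normc w.
Proof. exact: le_normcD. Qed.

Lemma Hinf_linear a f h : Hinf_set f -> Hinf_set h -> Hinf_set (a *: f + h).
Proof.
move=> [fa f0 [M fM]] [ha h0 [N hN]]; split.
- move=> z Dz; apply: derivableD; last exact: ha.
  by apply: derivableZ; exact: fa.
- by move=> z Dz; rewrite /= !fctE f0// h0// addr0 scaler0.
- exists (normc a * M + N) => _ [z Dz <-].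
  have nz := weight_gt0 nu Dz.
  have := fM _ (ex_intro2 _ _ z Dz erefl).
  have := hN _ (ex_intro2 _ _ z Dz erefl) => lN lM.
  apply: (@le_trans _ _ (nu z * (normc a * normc (f z) + normc (h z)))).
    by rewrite ler_pM2l// -Normc.normcM; exact: normc_triangle.
  by rewrite mulrDr lerD// mulrCA ler_wpM2l// normc_ge0.
Qed.

Lemma Hinf_pred_submod : submod_closed Hinf_pred.
Proof.
split; last by move=> a f h /Hinf_predP Hf /Hinf_predP Hh;
  apply/Hinf_predP; exact: Hinf_linear.
apply/Hinf_predP; split=> [z _|//|].
- exact: derivable_cst.
- exists 0 => _ [z _ <-]; rewrite (_ : normc _ = 0) ?mulr0//.
  exact: Normc.normc0.
Qed.

HB.instance Definition _ := GRing.isSubmodClosed.Build _ _ Hinf_pred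
  Hinf_pred_submod.

Record Hinf := MkHinf { hinf_fun :> R[i] -> R[i]; _ : hinf_fun \in Hinf_pred }.

HB.instance Definition _ := [isSub for hinf_fun].
HB.instance Definition _ := [Choice of Hinf by <:].
HB.instance Definition _ := [SubChoice_isSubLmodule of Hinf by <:].

End HinfPred.

Section HinfNorm.
Variables (R : realType) (nu : radial_weight R).
Implicit Types f h : Hinf nu.

Lemma disk0 : @disk R 0.
Proof. by rewrite /disk /mkset (_ : normc _ = 0) ?ltr01//; exact: Normc.normc0. Qed.

Lemma HinfP f : Hinf_set nu f.
Proof. exact/Hinf_predP/(valP f). Qed.

Definition wnorm (f : R[i] -> R[i]) : R := sup (wvalues nu f).

Lemma wnorm_ub f z : disk z -> nu z * normc (f z) <= wnorm f.
Proof.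
move=> Dz; have [_ _ ubf] := HinfP f.
by apply: ub_le_sup => //; exists z.
Qed.

Lemma wnorm_le (f : R[i] -> R[i]) M :
  (forall z, disk z -> nu z * normc (f z) <= M) -> wnorm f <= M.
Proof.
move=> H; apply: ge_sup; first by exists (nu 0 * normc (f 0)), 0 => //; exact: disk0.
by move=> _ [z Dz <-]; exact: H.
Qed.

Lemma wnorm_ge0 f : 0 <= wnorm f.
Proof.
apply: le_trans (wnorm_ub f disk0).
by rewrite mulr_ge0 ?normc_ge0// ltW// weight_gt0//; exact: disk0.
Qed.

Lemma wnormD f h : (wnorm (f + h : Hinf nu))%:C <= (wnorm f)%:C + (wnorm h)%:C :> R[i].
Proof.
rewrite -rmorphD lecR; apply: wnorm_le => z Dz.
apply: le_trans (lerD (wnorm_ub f Dz) (wnorm_ub h Dz)).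
rewrite -mulrDr ler_pM2l ?weight_gt0//; exact: normc_triangle.
Qed.

Lemma wnormZ_le (l : R[i]) f : wnorm (l *: f : Hinf nu) <= normc l * wnorm f.
Proof.
apply: wnorm_le => z Dz.
rewrite [X in _ * X](_ : _ = normc l * normc (f z)); last exact: Normc.normcM.
by rewrite mulrCA ler_wpM2l ?normc_ge0// wnorm_ub.
Qed.

Lemma wnormZ (l : R[i]) f : (wnorm (l *: f : Hinf nu))%:C = `|l| * (wnorm f)%:C.
Proof.
rewrite normcNE -rmorphM; congr (_ %:C); apply/eqP.
rewrite eq_le wnormZ_le andTb.
have [->|l0] := eqVneq l 0.
  rewrite (_ : normc 0 = 0); last exact: Normc.normc0.
  rewrite mul0r. exact: wnorm_ge0.
have nl : 0 < normc l.
  rewrite lt_neqAle normc_ge0 andbT eq_sym; apply: contra_neq l0.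
  exact: Normc.eq0_normc.
rewrite -ler_pdivlMl// -Normc.normcV.
by rewrite -{1}[f](scalerK l0) wnormZ_le.
Qed.

Lemma wnorm0_eq0 f : (wnorm f)%:C = 0 :> R[i] -> f = 0.
Proof.
move=> [f0]; apply/val_inj/funext => z /=.
have [_ foff _] := HinfP f.
have [Dz|Dz] := pselect (disk z); last exact: foff.
apply: Normc.eq0_normc; apply/eqP; rewrite eq_le normc_ge0 andbT.
have := wnorm_ub f Dz; rewrite f0.
by rewrite pmulr_rle0 ?weight_gt0.
Qed.

HB.instance Definition _ := Lmodule_isNormed.Build R[i] (Hinf nu)
  wnormD wnormZ wnorm0_eq0.

End HinfNorm.

Section DiskCompact.
Variable R : realType.

Let toC (p : R * R) : R[i] := p.1 +i* p.2.

Lemma Re_le_normc (z : R[i]) : `|complex.Re z| <= normc z.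
Proof. by rewrite -lecR -normcNE; exact: normc_ge_Re. Qed.

Lemma Im_le_normc (z : R[i]) : `|complex.Im z| <= normc z.
Proof.
case: z => a b /=; rewrite -sqrtr_sqr ler_wsqrtr// lerDr; exact: sqr_ge0.
Qed.

Lemma normc_le_sum (a b : R) : normc (a +i* b) <= `|a| + `|b|.
Proof.
rewrite /Normc.normc -(ler_pXn2r (_ : 0 < 2)%N)// ?nnegrE ?sqrtr_ge0 ?addr_ge0//.
rewrite sqr_sqrtr ?addr_ge0 ?sqr_ge0// sqrrD !real_normK ?num_real//.
by rewrite lerD2r lerDl mulrn_wge0// mulr_ge0.
Qed.

Lemma toC_continuous : continuous toC.
Proof.
move=> p; apply/cvgrPdist_lt => /= e e0.
have re : e = (complex.Re e)%:C by rewrite RRe_real// gtr0_real.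
have e0' : 0 < complex.Re e by rewrite -ltcR -re.
have d0 : 0 < complex.Re e / 2 by rewrite divr_gt0.
rewrite re; exists (ball p.1 (complex.Re e / 2), ball p.2 (complex.Re e / 2)).
  by split; exact: nbhsx_ballx.
move=> q [q1 q2]; rewrite /= normcNE ltcR.
apply: le_lt_trans (normc_le_sum (p.1 - q.1) (p.2 - q.2)) _.
by rewrite (splitr (complex.Re e)) ltrD.
Qed.

Lemma normc_continuous : continuous (@Normc.normc R).
Proof.
move=> z; have FF := nbhs_filter z.
apply/(@cvgrPdist_lt _ _ _ _ FF) => e e0.
exists e%:C; first by rewrite /= ltcR.
move=> w; rewrite /ball_ /= normcNE ltcR; apply: le_lt_trans.
rewrite ler_norml lerNl opprB !lerBlDr; apply/andP; split.
  rewrite -(_ : normc (w - z) = normc (z - w)).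
    by rewrite -{1}(subrK z w); exact: normc_triangle.
  by rewrite -opprB; exact: normcN.
by rewrite -{1}(subrK w z); exact: normc_triangle.
Qed.

Lemma analytic_bounded (f : R[i] -> R[i]) (r : R) : analytic f -> r < 1 ->
  exists M : R, forall z, normc z <= r -> normc (f z) <= M.
Proof.
move=> af r1.
pose K : set (R * R) := (@Normc.normc R \o toC) @^-1` [set x | x <= r].
have cnt : continuous (@Normc.normc R \o toC).
  by move=> p; apply: continuous_comp; [exact: toC_continuous|exact: normc_continuous].
have cK : compact K.
  apply: (@subclosed_compact _ K (`[-1, 1] `*` `[-1, 1])).
  - by apply: preimage_closed => //; exact: closed_le.
  - by apply: compact_setX; exact: segment_compact.
  - move=> [a b] /= Kab; have ab : normc (a +i* b) <= 1 by exact/ltW/(le_lt_trans Kab).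
    by split; rewrite /= in_itv/= -ler_norml;
      [exact: le_trans (Re_le_normc (a +i* b)) _|exact: le_trans (Im_le_normc (a +i* b)) _].
have cf : {within K, continuous (@Normc.normc R \o f \o toC)}.
  apply: continuous_in_subspaceT => p; rewrite inE => Kp.
  apply: continuous_comp; first exact: toC_continuous.
  apply: continuous_comp; last exact: normc_continuous.
  apply: differentiable_continuous; apply/derivable1_diffP; apply: af.
  exact: le_lt_trans Kp r1.
have [M [_ HM]] := compact_bounded (continuous_compact cf cK).
exists (M + 1) => z zr; apply: le_trans (ler_norm _) _.
apply: HM; first by rewrite ltrDl.
by exists (complex.Re z, complex.Im z) => //; case: z zr.
Qed.

End DiskCompact.

Section HzeroPred.
Variables (R : realType) (nu : radial_weight R).
Implicit Types f : R[i] -> R[i].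

Definition vanishing f : Prop := forall e : R, 0 < e ->
  exists2 r : R, r < 1 & forall z, disk z -> r < normc z ->
    nu z * normc (f z) < e.

Definition Hzero_set : set (R[i] -> R[i]) :=
  [set f | [/\ analytic f, (forall z, ~ disk z -> f z = 0) & vanishing f]].

Definition Hzero_pred : {pred R[i] -> R[i]} := mem Hzero_set.

Lemma Hzero_predP f : reflect (Hzero_set f) (f \in Hzero_pred).
Proof. by apply: (iffP idP) => [/set_mem|/mem_set]. Qed.

Lemma Hzero_sub_Hinf f : Hzero_set f -> Hinf_set nu f.
Proof.
move=> [af f0 vf]; split=> //.
have [r r1 Hr] := vf 1 ltr01.
have [M HM] := analytic_bounded af r1.
exists (Num.max 1 (nu 0 * M)) => _ [z Dz <-]; rewrite le_max.
have [zr|zr] := leP (normc z) r; last by rewrite ltW// Hr.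
apply/orP; right; apply: ler_pM; rewrite ?normc_ge0 ?HM//.
  exact/ltW/weight_gt0.
apply: weight_noninc => //.
by rewrite (_ : normc 0 = 0) ?normc_ge0//; exact: Normc.normc0.
Qed.

Lemma Hzero_linear a f h : Hzero_set f -> Hzero_set h -> Hzero_set (a *: f + h).
Proof.
move=> Hf Hh; have [af f0 _] := Hinf_linear a (Hzero_sub_Hinf Hf) (Hzero_sub_Hinf Hh).
split=> // e e0; have [_ _ vf] := Hf; have [_ _ vh] := Hh.
have c0 : 0 < normc a + 1 by rewrite ltr_wpDl ?normc_ge0.
have e2 : 0 < e / 2 by rewrite divr_gt0.
have [r r1 Hr] := vf (e / 2 / (normc a + 1)) (divr_gt0 e2 c0).
have [s s1 Hs] := vh (e / 2) e2.
exists (Num.max r s); first by rewrite gt_max r1.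
move=> z Dz; rewrite gt_max => /andP[rz sz].
have nz := weight_gt0 nu Dz.
apply: (@le_lt_trans _ _ (nu z * (normc a * normc (f z) + normc (h z)))).
  by rewrite ler_pM2l// -Normc.normcM; exact: normc_triangle.
rewrite mulrDr (splitr e) ltr_leD ?ltW ?Hs// mulrCA.
apply: (@le_lt_trans _ _ ((normc a + 1) * (nu z * normc (f z)))).
  by rewrite ler_wpM2r ?lerDl// mulr_ge0 ?normc_ge0// ltW.
by rewrite mulrC -ltr_pdivlMr// Hr.
Qed.

Lemma Hzero_pred_submod : submod_closed Hzero_pred.
Proof.
split; last by move=> a f h /Hzero_predP Hf /Hzero_predP Hh;
  apply/Hzero_predP; exact: Hzero_linear.
apply/Hzero_predP; split=> [z _|//|e e0].
- exact: derivable_cst.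
- exists 0 => // z _ _; rewrite (_ : normc _ = 0) ?mulr0//.
  exact: Normc.normc0.
Qed.

HB.instance Definition _ := GRing.isSubmodClosed.Build _ _ Hzero_pred
  Hzero_pred_submod.

Record Hzero :=
  MkHzero { hzero_fun :> R[i] -> R[i]; _ : hzero_fun \in Hzero_pred }.

HB.instance Definition _ := [isSub for hzero_fun].
HB.instance Definition _ := [Choice of Hzero by <:].
HB.instance Definition _ := [SubChoice_isSubLmodule of Hzero by <:].

Lemma HzeroP (f : Hzero) : Hzero_set f.
Proof. exact/Hzero_predP/(valP f). Qed.

Definition Hzero_incl (f : Hzero) : Hinf nu :=
  MkHinf (introT (Hinf_predP nu f) (Hzero_sub_Hinf (HzeroP f))).

Lemma Hzero_incl_linear : linear Hzero_incl.
Proof. by move=> a f h; exact: val_inj. Qed.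

HB.instance Definition _ := GRing.isLinear.Build R[i] Hzero (Hinf nu) _
  Hzero_incl Hzero_incl_linear.

Definition Hzero_norm (f : Hzero) : R[i] := `|Hzero_incl f|.

Lemma Hzero_normD (f h : Hzero) : Hzero_norm (f + h) <= Hzero_norm f + Hzero_norm h.
Proof. by rewrite /Hzero_norm linearD; exact: ler_normD. Qed.

Lemma Hzero_normZ (l : R[i]) (f : Hzero) : Hzero_norm (l *: f) = `|l| * Hzero_norm f.
Proof. by rewrite /Hzero_norm linearZ; exact: normrZ. Qed.

Lemma Hzero_norm0_eq0 (f : Hzero) : Hzero_norm f = 0 -> f = 0.
Proof.
move=> /normr0_eq0 f0; apply: val_inj => /=.
by have := congr1 val f0.
Qed.

HB.instance Definition _ := Lmodule_isNormed.Build R[i] Hzero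
  Hzero_normD Hzero_normZ Hzero_norm0_eq0.

End HzeroPred.

(* Main.v *)
(** The weighted kernels attached to nodes c_(n,k), the [2^(n+6)]-th roots of unity
scaled to the circle of radius [1 - 2^-n/4], mediate between both conditions.

(a) => (c). The functions h_c(w) = (1 - c^* w)^-(M+2) are tested in the nuclear
representation. A discrete Forelli-Rudin estimate bounds the norm of all unimodular
combinations of suitably weighted h_c, hence the weighted sum of the norms of T h_c
is bounded by the sum of the |x_k'| |y_k|. The norm of T h_c dominates the supremum
over z of (1-|z|^2) mu(z) |g'(z)| |h_c(phi(z))|. For zeta in the polar cell of
c_(n,k) the integrand is dominated by the sum of these suprema over the ancestors
of that cell, with geometric weights because the exponent of nu is below alpha + 1.

(c) => (b). Let P_r be a regularised Cauchy kernel; the differences kap_n of P_r for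
consecutive dyadic radii decay like 2^-n(M+1) / |1 - u|^(M+2), and f is the sum of
the convolutions f * kap_n. Each convolution is the limit of means over roots of
unity; telescoping along the halvings of the mesh writes f as a series of point
evaluations (or differences of two) times kernels, the l-th halving gaining a
factor 2^-l. Disjoint boxes around the nodes compare the resulting sum of norms
with the integral. *)

From HB Require Import structures.
Require Import Defs.
From mathcomp Require Import all_boot all_order all_algebra.
From mathcomp Require Import all_classical all_reals all_analysis.
From mathcomp Require Import measurable_realfun.
From mathcomp Require Import ring lra zify.

Set Implicit Arguments.
Unset Strict Implicit.
Unset Printing Implicit Defensive.

Import Order.TTheory GRing.Theory Num.Theory.
Import numFieldNormedType.Exports.

Local Open Scope classical_set_scope.
Local Open Scope ring_scope.
Local Open Scope complex_scope.

Arguments Normc.normc : simpl never.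

(** The exponent [alpha + 2] is real, and complex powers would require a branch of the logarithm.
    The kernels carry an integer exponent [M + 2] instead, with [beta < M + 1], which makes sums
    over circles geometric, and [alpha + 2 <= M + 2], which lets the integer power be traded for the
    real one, as [2^-n / |1 - c^* w| <= 4] at a node c of level n.

    A mean over N roots of unity never reproduces f exactly: coefficients of index N and beyond are
    aliased. Refining the mesh removes the error, but each halving doubles the number of points. The
    normalisation of the mean repays the doubling; the further gain [2^-l] is a Lipschitz bound at
    scale [2^-n], for f or for the kernel, according to the term of the Leibniz rule. The resulting
    atoms are absolutely summable at each point and are enumerated through a countable type of
    cells. This pointwise expansion suffices: the norm of T f is controlled by the values of f at
    the points phi(z), so applying T yields convergence in norm.

    The supremum under the integral is not shown to be measurable; it is only compared with step
    functions on squares, using monotonicity of the integral. *)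

Section ComplexModulus.
Variable R : realType.
Implicit Types (z w : R[i]) (r : R).
Local Notation C := R[i].

Lemma nc0 : normc (0 : C) = 0. Proof. exact: Normc.normc0. Qed.
Lemma nc1 : normc (1 : C) = 1. Proof. exact: Normc.normc1. Qed.
Lemma ncM z w : normc (z * w) = normc z * normc w.
Proof. exact: Normc.normcM. Qed.
Lemma ncV z : normc z^-1 = (normc z)^-1. Proof. exact: Normc.normcV. Qed.
Lemma ncN z : normc (- z) = normc z. Proof. exact: normcN. Qed.
Lemma ncB z w : normc (z - w) = normc (w - z). Proof. by rewrite -ncN opprB. Qed.
Lemma ncX z n : normc (z ^+ n) = normc z ^+ n.
Proof. by elim: n => [|n IH]; rewrite ?expr0 ?nc1// !exprS ncM IH. Qed.
Lemma nc_eq0 z : (normc z == 0) = (z == 0).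
Proof. by apply/eqP/eqP => [/Normc.eq0_normc//|->]; rewrite nc0. Qed.
Lemma nc_gt0 z : (0 < normc z) = (z != 0).
Proof. by rewrite lt_neqAle normc_ge0 andbT eq_sym nc_eq0. Qed.
Lemma nc_real r : normc (r%:C : C) = `|r|.
Proof. by rewrite /Normc.normc/= expr0n addr0 sqrtr_sqr. Qed.
Lemma nc_sub z w : normc (z - w) <= normc z + normc w.
Proof. by rewrite -(ncN w); exact: normc_triangle. Qed.
Lemma nc_dist z w u : normc (z - w) <= normc (z - u) + normc (u - w).
Proof. by rewrite -{1}(subrK u z) -addrA; exact: normc_triangle. Qed.
Lemma nc_ge z w : normc z - normc w <= normc (z - w).
Proof. by rewrite lerBlDr -{1}(subrK w z); exact: normc_triangle. Qed.
Lemma nc_sum (I : Type) (s : seq I) (P : pred I) (F : I -> C) :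
  normc (\sum_(i <- s | P i) F i) <= \sum_(i <- s | P i) normc (F i).
Proof.
elim/big_rec2: _ => [|i x y _ h]; first by rewrite nc0.
by apply: le_trans (normc_triangle _ _) _; rewrite lerD2l.
Qed.
Lemma nc_conj z : normc z^* = normc z.
Proof. by case: z => a b; rewrite /Normc.normc/= sqrrN. Qed.
Lemma nc_natr n : normc (n%:R : C) = n%:R.
Proof. by rewrite -(rmorph_nat (@real_complex R)) nc_real ger0_norm. Qed.
Lemma nc_sq z : normc z ^+ 2 = complex.Re z ^+ 2 + complex.Im z ^+ 2.
Proof. by case: z => a b; rewrite /Normc.normc/= sqr_sqrtr// addr_ge0 ?sqr_ge0. Qed.
Lemma mulcC_conj z : z * z^* = (normc z ^+ 2)%:C.
Proof.
rewrite nc_sq; case: z => a b /=; rewrite /GRing.mul/= ; congr (_ +i* _); ring.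
Qed.
Lemma ReM z w : complex.Re (z * w) =
  complex.Re z * complex.Re w - complex.Im z * complex.Im w.
Proof. by case: z w => a b [c d]. Qed.
Lemma ImM z w : complex.Im (z * w) =
  complex.Re z * complex.Im w + complex.Im z * complex.Re w.
Proof. by case: z w => a b [c d]. Qed.
Lemma ReD z w : complex.Re (z + w) = complex.Re z + complex.Re w.
Proof. by case: z w => a b [c d]. Qed.
Lemma ImD z w : complex.Im (z + w) = complex.Im z + complex.Im w.
Proof. by case: z w => a b [c d]. Qed.
Lemma ReB z w : complex.Re (z - w) = complex.Re z - complex.Re w.
Proof. by case: z w => a b [c d]. Qed.
Lemma ImB z w : complex.Im (z - w) = complex.Im z - complex.Im w.
Proof. by case: z w => a b [c d]. Qed.
Lemma Re_le z : complex.Re z <= normc z.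
Proof. exact: le_trans (ler_norm _) (Re_le_normc _). Qed.
Lemma nc_ReIm z : normc z <= `|complex.Re z| + `|complex.Im z|.
Proof. by case: z => a b; exact: normc_le_sum. Qed.
End ComplexModulus.

(** * Complex derivatives and the Cauchy theory *)

Section ComplexDerivative.
Variable R : realType.
Local Notation C := R[i].
Implicit Types (f g : C -> C) (z w A B : C).

(** The increment form of complex differentiability, with tolerances in [R] instead of [R[i]]:
    without a division by [w - z], remainders can be added and composed directly. *)
Definition cdiff f z A := forall e : R, 0 < e -> exists2 d : R, 0 < d &
  forall w, normc (w - z) < d -> normc (f w - f z - A * (w - z)) <= e * normc (w - z).

Lemma nbhs_normc z (P : set C) :
  nbhs z P <-> exists2 d : R, 0 < d & forall w, normc (w - z) < d -> P w.
Proof.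
split.
  (* A positive element of [R[i]] is real, so a ball of complex radius is one of real radius. *)
  move=> [e e0 H]; have er : e = (complex.Re e)%:C by rewrite RRe_real// gtr0_real.
  exists (complex.Re e); first by rewrite -ltcR -er.
  by move=> w wz; apply: H; rewrite /ball_/= er normcNE ltcR ncB.
move=> [d d0 H]; exists d%:C; first by rewrite /= ltcR.
by move=> w; rewrite /ball_/= normcNE ltcR ncB; exact: H.
Qed.

Lemma cdiff_is_derive f z A : cdiff f z A -> is_derive z 1 f A.
Proof.
move=> H.
have c : (fun h : C => h^-1 *: (f (h *: 1 + z) - f z)) @ 0^' --> A.
  apply/cvgrPdist_le => e e0.
  have er : e = (complex.Re e)%:C by rewrite RRe_real// gtr0_real.
  have e0' : 0 < complex.Re e by rewrite -ltcR -er.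
  have [d d0 Hd] := H _ e0'.
  rewrite near_withinE; apply/nbhs_normc; exists d => // h hd h0.
  have := Hd (h *: 1 + z); rewrite addrK /GRing.scale/= mulr1 => /(_ _)/=.
  rewrite subr0 in hd; move=> /(_ hd) {}Hd.
  rewrite er normcNE lecR.
  have h0' : 0 < normc h by rewrite nc_gt0.
  rewrite -(ler_pM2r h0'); apply: le_trans Hd.
  rewrite -ncM ncB le_eqVlt; apply/orP; left; apply/eqP; congr normc.
  by rewrite mulrBl mulrAC mulVf// mul1r.
apply: DeriveDef; first by apply/cvg_ex; exists A.
by apply: cvg_lim.
Qed.

Lemma is_derive_cdiff f z A : is_derive z 1 f A -> cdiff f z A.
Proof.
move=> [df dA] e e0.
have c : (fun h : C => h^-1 *: (f (h *: 1 + z) - f z)) @ 0^' --> A.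
  by rewrite -dA; exact: df.
move/cvgrPdist_le : c => /(_ e%:C); rewrite ltcR => /(_ e0).
rewrite near_withinE => /nbhs_normc [d d0 H]; exists d => // w wd.
have [->|wz] := eqVneq w z; first by rewrite !subrr mulr0 subr0 nc0 mulr0.
have h0 : w - z != 0 by rewrite subr_eq0.
have := H (w - z); rewrite subr0 => /(_ wd h0).
rewrite normcNE lecR /GRing.scale/= mulr1 subrK => {}H.
have h0' : 0 < normc (w - z) by rewrite nc_gt0.
rewrite -(ler_pM2r h0') in H; apply: le_trans H.
rewrite -ncM ncB le_eqVlt; apply/orP; left; apply/eqP; congr normc.
by rewrite mulrBl [in RHS]mulrAC mulVf// mul1r.
Qed.

Lemma cdiff_derive1 f z : derivable f z 1 -> cdiff f z (derive1 f z).
Proof.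
by move=> df; apply: is_derive_cdiff; rewrite derive1E; exact/derivableP.
Qed.

Lemma cdiff_derivable f z A : cdiff f z A -> derivable f z 1 /\ derive1 f z = A.
Proof. by move=> /cdiff_is_derive [? <-]; rewrite derive1E. Qed.

Lemma cdiff_near f g z A (r : R) : 0 < r ->
  (forall w, normc (w - z) < r -> f w = g w) -> cdiff f z A -> cdiff g z A.
Proof.
move=> r0 fg H e e0; have [d d0 Hd] := H e e0.
exists (Num.min d r); first by rewrite lt_min d0.
move=> w; rewrite lt_min => /andP[wd wr]; rewrite -!fg ?subrr ?nc0//; exact: Hd.
Qed.

Lemma cdiff_cst (c : C) z : cdiff (fun _ => c) z 0.
Proof. apply: is_derive_cdiff; exact: is_derive_cst. Qed.
Lemma cdiff_id z : cdiff (fun w => w) z 1.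
Proof. apply: is_derive_cdiff; exact: is_derive_id. Qed.
Lemma cdiffD f g z A B : cdiff f z A -> cdiff g z B -> cdiff (fun w => f w + g w) z (A + B).
Proof.
move=> /cdiff_is_derive ? /cdiff_is_derive ?.
by apply: is_derive_cdiff; exact: is_deriveD.
Qed.
Lemma cdiffB f g z A B : cdiff f z A -> cdiff g z B -> cdiff (fun w => f w - g w) z (A - B).
Proof.
move=> /cdiff_is_derive ? /cdiff_is_derive ?.
by apply: is_derive_cdiff; exact: is_deriveB.
Qed.
Lemma cdiffM f g z A B : cdiff f z A -> cdiff g z B ->
  cdiff (fun w => f w * g w) z (A * g z + f z * B).
Proof.
move=> /cdiff_is_derive Hf /cdiff_is_derive Hg.
have := is_derive_cdiff (is_deriveM Hf Hg).
by rewrite /GRing.scale/= addrC (mulrC A).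
Qed.
Lemma cdiff_cont f z A : cdiff f z A -> forall e : R, 0 < e -> exists2 d : R, 0 < d &
  forall w, normc (w - z) < d -> normc (f w - f z) <= e.
Proof.
move=> H e e0; have [d d0 Hd] := H 1 ltr01.
have a0 : 0 < normc A + 1 by rewrite ltr_wpDl ?normc_ge0.
exists (Num.min d (e / (normc A + 1))); first by rewrite lt_min d0 divr_gt0.
move=> w; rewrite lt_min => /andP[wd]; rewrite ltr_pdivlMr// => we.
have := Hd w wd; rewrite mul1r => {}Hd.
rewrite -(subrK (A * (w - z)) (f w - f z)).
apply: le_trans (normc_triangle _ _) _; apply: le_trans (ltW we).
by rewrite [leRHS]mulrDr mulr1 addrC lerD// ncM mulrC.
Qed.
Lemma cdiff_comp f g z A B : cdiff g z A -> cdiff f (g z) B ->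
  cdiff (fun w => f (g w)) z (B * A).
Proof.
move=> Hg Hf e e0.
have a0 : 0 < normc A + 1 by rewrite ltr_wpDl ?normc_ge0.
have b0 : 0 < normc B + 1 by rewrite ltr_wpDl ?normc_ge0.
have e2 : 0 < e / 2 by rewrite divr_gt0.
have [d1 d10 H1] := Hf (e / 2 / (normc A + 1)) (divr_gt0 e2 a0).
have [d2 d20 H2] := cdiff_cont Hg (divr_gt0 d10 (@ltr0n R 2)).
(* The entry 1 makes [g] Lipschitz near [z] with constant [normc A + 1]; the other entry absorbs the
   factor [B] in front of the remainder of [g]. *)
have m0 : 0 < Num.min 1 (e / 2 / (normc B + 1)) by rewrite lt_min ltr01 divr_gt0.
have [d3 d30 H3] := Hg _ m0.
exists (Num.min d2 d3); first by rewrite lt_min d20.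
move=> w; rewrite lt_min => /andP[w2 w3].
have {H3} := H3 w w3; have {H2} H2 := H2 w w2.
have {H1} H1 : normc (f (g w) - f (g z) - B * (g w - g z)) <=
    e / 2 / (normc A + 1) * normc (g w - g z).
  by apply: H1; apply: le_lt_trans H2 _; rewrite ltr_pdivrMr// mulr_natr mulr2n ltrDl.
move=> H3.
have N := normc_ge0 (w - z).
have gl : normc (g w - g z) <= (normc A + 1) * normc (w - z).
  rewrite -(subrK (A * (w - z)) (g w - g z)).
  apply: le_trans (normc_triangle _ _) _.
  rewrite mulrDl addrC ncM lerD2l mul1r; apply: le_trans H3 _.
  by rewrite ler_piMl// ge_min lexx.
have -> : f (g w) - f (g z) - B * A * (w - z) =
  (f (g w) - f (g z) - B * (g w - g z)) + B * (g w - g z - A * (w - z)) by ring.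
apply: le_trans (normc_triangle _ _) _; rewrite (splitr e) mulrDl lerD//.
  apply: le_trans H1 _; rewrite mulrAC ler_pdivrMr// -[leRHS]mulrA ler_wpM2l ?(ltW e2)//.
  by rewrite [leRHS]mulrC.
rewrite ncM; apply: (@le_trans _ _ ((normc B + 1) * (e / 2 / (normc B + 1) * normc (w - z)))).
  apply: ler_pM; rewrite ?normc_ge0 ?lerDl//; apply: le_trans H3 _.
  by rewrite ler_wpM2r// ge_min lexx orbT.
by rewrite mulrA [_ * (_ / _)]mulrC divfK// gt_eqF.
Qed.

(** The remainder is exactly [(w - z)^2 / (w z^2)], and staying within [normc z / 2] of [z] keeps
    [w] away from 0. *)
Lemma cdiff_inv z : z != 0 -> cdiff (fun w => w^-1) z (- (z ^+ 2)^-1).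
Proof.
move=> z0 e e0; have z0' : 0 < normc z by rewrite nc_gt0.
have z3 : 0 < normc z ^+ 3 by rewrite exprn_gt0.
exists (Num.min (normc z / 2) (e * normc z ^+ 3 / 2)).
  by rewrite lt_min divr_gt0//= divr_gt0// mulr_gt0.
move=> w; rewrite lt_min => /andP[w2 w3].
have wz : normc z / 2 < normc w.
  have := nc_ge z (z - w); rewrite opprB addrCA subrr addr0 ncB => h.
  have : normc z - normc z / 2 = normc z / 2 by field.
  by move: h w2; rewrite -[normc (w - z)]ncB; lra.
have w0 : w != 0 by rewrite -nc_gt0; apply: lt_trans wz; rewrite divr_gt0.
have -> : w^-1 - z^-1 - - (z ^+ 2)^-1 * (w - z) = (w - z) * ((w - z) * (w^-1 * (z ^+ 2)^-1)).
  by field; rewrite z0 w0.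
rewrite ncM mulrC ler_wpM2r ?normc_ge0// !ncM !ncV ncX mulrA.
rewrite ler_pdivrMr ?exprn_gt0// ler_pdivrMr ?nc_gt0//.
apply: le_trans (ltW w3) _.
have -> : e * normc z ^+ 3 / 2 = e * normc z ^+ 2 * (normc z / 2) by field.
by rewrite ler_wpM2l// ?ltW// mulr_gt0// exprn_gt0.
Qed.
Lemma cdiffV f z A : f z != 0 -> cdiff f z A -> cdiff (fun w => (f w)^-1) z (- (f z ^+ 2)^-1 * A).
Proof. by move=> f0 H; apply: (cdiff_comp H); exact: cdiff_inv. Qed.
End ComplexDerivative.

(** * Integrals of complex functions over an interval *)

Section ComplexIntegral.
Variable R : realType.
Local Notation C := R[i].
Local Notation mu := (@lebesgue_measure R).
Implicit Types (F G : R -> C) (a b t : R).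

Definition ccont_at F t := forall e : R, 0 < e -> exists2 d : R, 0 < d &
  forall s, `|s - t| < d -> normc (F s - F t) <= e.

(** Continuity is two-sided at the ends too, so subintervals and the end conditions of the
    fundamental theorem need no separate treatment. *)
Definition ccont_on F a b := forall t, a <= t -> t <= b -> ccont_at F t.

Definition rdiff F t A := forall e : R, 0 < e -> exists2 d : R, 0 < d &
  forall s, `|s - t| < d -> normc (F s - F t - (s - t)%:C * A) <= e * `|s - t|.

Definition cint F a b : C :=
  (\int[mu]_(t in `[a, b]) complex.Re (F t)) +i*
  (\int[mu]_(t in `[a, b]) complex.Im (F t)).

Lemma ccont_part (p : C -> R) F t :
  (forall z w, `|p z - p w| <= normc (z - w)) ->
  ccont_at F t -> {for t, continuous (p \o F)}.
Proof.
move=> pl H; apply/cvgrPdist_le => e e0; have [d d0 Hd] := H e e0.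
exists d => // s /=; rewrite distrC => st; rewrite distrC.
by apply: le_trans (pl _ _) _; exact: Hd.
Qed.

Lemma Re_lip (z w : C) : `|complex.Re z - complex.Re w| <= normc (z - w).
Proof. by rewrite -ReB; exact: Re_le_normc. Qed.
Lemma Im_lip (z w : C) : `|complex.Im z - complex.Im w| <= normc (z - w).
Proof. by rewrite -ImB; exact: Im_le_normc. Qed.

Lemma ccont_within (p : C -> R) F a b :
  (forall z w, `|p z - p w| <= normc (z - w)) ->
  ccont_on F a b -> {within `[a, b], continuous (p \o F)}.
Proof.
move=> pl H; apply: continuous_in_subspaceT => t.
by rewrite inE/= in_itv/= => /andP[? ?]; apply: ccont_part => //; exact: H.
Qed.

Lemma ccont_integrable (p : C -> R) F a b :
  (forall z w, `|p z - p w| <= normc (z - w)) ->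
  ccont_on F a b -> mu.-integrable `[a, b] (EFin \o (p \o F)).
Proof.
move=> pl H; apply: continuous_compact_integrable; first exact: segment_compact.
exact: ccont_within.
Qed.

Lemma Rint_cat (u : R -> R) a m b : a <= m -> m <= b ->
  mu.-integrable `[a, b] (EFin \o u) ->
  \int[mu]_(t in `[a, b]) u t = \int[mu]_(t in `[a, m]) u t + \int[mu]_(t in `[m, b]) u t.
Proof.
move=> am mb iu; apply/eqP; rewrite addrC -subr_eq; apply/eqP.
rewrite Rintegral_itvB//.
apply: Rintegral_itv_obnd_cbnd.
apply: integrableS iu => //; apply: subset_itv; by rewrite bnd_simp.
Qed.

Lemma cint_cat F a m b : a <= m -> m <= b -> ccont_on F a b ->
  cint F a b = cint F a m + cint F m b.
Proof.
move=> am mb cF; rewrite /cint.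
rewrite (Rint_cat am mb (ccont_integrable Re_lip cF)).
by rewrite (Rint_cat am mb (ccont_integrable Im_lip cF)).
Qed.

(** The factor 2 comes from bounding real and imaginary parts separately; later only the order of
    magnitude matters. *)
Lemma cint_bound F a b (B : R) : a <= b -> ccont_on F a b ->
  (forall t, a <= t -> t <= b -> normc (F t) <= B) ->
  normc (cint F a b) <= 2 * B * (b - a).
Proof.
move=> ab cF FB.
have H (p : C -> R) : (forall z w, `|p z - p w| <= normc (z - w)) -> p 0 = 0 ->
  `|\int[mu]_(t in `[a, b]) p (F t)| <= B * (b - a).
  move=> pl p0; have iF := ccont_integrable pl cF.
  apply: le_trans (le_normr_Rintegral _ iF) _ => //=.
  have -> : B * (b - a) = \int[mu]_(t in `[a, b]) B.
    rewrite Rintegral_cst//= lebesgue_measure_itv/= lte_fin.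
    by move: ab; rewrite le_eqVlt => /predU1P[->|->//]; rewrite ltxx subrr.
  apply: le_Rintegral => //.
  - exact: integrable_norm.
  - apply: continuous_compact_integrable; first exact: segment_compact.
    by apply: continuous_subspaceT => ?; exact: cvg_cst.
  - move=> t /=; rewrite in_itv/= => /andP[ta tb].
    by apply: le_trans (FB t ta tb); have := pl (F t) 0; rewrite p0 !subr0.
apply: le_trans (nc_ReIm _) _; rewrite /= -mulrA mulr_natl mulr2n lerD//.
  exact: (H _ Re_lip).
exact: (H _ Im_lip).
Qed.

Lemma cintD F G a b : ccont_on F a b -> ccont_on G a b ->
  cint (fun t => F t + G t) a b = cint F a b + cint G a b.
Proof.
move=> cF cG; rewrite /cint.
under eq_Rintegral do rewrite ReD.
under [X in _ +i* X]eq_Rintegral do rewrite ImD.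
rewrite !RintegralD//.
- exact: (ccont_integrable Im_lip cF).
- exact: (ccont_integrable Im_lip cG).
- exact: (ccont_integrable Re_lip cF).
- exact: (ccont_integrable Re_lip cG).
Qed.

Lemma cintZ F a b (c : C) : ccont_on F a b ->
  cint (fun t => c * F t) a b = c * cint F a b.
Proof.
move=> cF; rewrite /cint.
have i1 := ccont_integrable Re_lip cF.
have i2 := ccont_integrable Im_lip cF.
have j (k : R) (u : R -> R) : mu.-integrable `[a, b] (EFin \o u) ->
    mu.-integrable `[a, b] (EFin \o (fun t => k * u t)).
  by move=> iu; have := @integrableZl _ _ _ mu `[a, b]%classic (measurable_itv `[a, b]) k _ iu.
under eq_Rintegral do rewrite ReM.
under [X in _ +i* X]eq_Rintegral do rewrite ImM.
rewrite RintegralB//; [|exact: j|exact: j].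
rewrite RintegralD//; [|exact: j|exact: j].
rewrite !RintegralZl//.
by case: c => c d.
Qed.

Lemma cint_eq F G a b : (forall t, a <= t -> t <= b -> F t = G t) ->
  cint F a b = cint G a b.
Proof.
move=> FG; rewrite /cint; congr (_ +i* _); apply: eq_Rintegral => t;
  by rewrite inE/= in_itv/= => /andP[ta tb]; rewrite FG.
Qed.

Lemma rdiff_part (p : C -> R) F t A :
  (forall z w, p (z - w) = p z - p w) -> (forall z, `|p z| <= normc z) ->
  (forall (r : R) z, p (r%:C * z) = r * p z) ->
  rdiff F t A -> is_derive t 1 (p \o F) (p A).
Proof.
move=> pB pl pZ H.
have c : (fun h : R => h^-1 *: ((p \o F) (h *: 1 + t) - (p \o F) t)) @ 0^' --> p A.
  apply/cvgrPdist_le => e e0; have [d d0 Hd] := H e e0.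
  rewrite near_withinE; exists d => // h hd0 h0.
  have hd : `|h| < d by move: hd0; rewrite /= sub0r normrN.
  have := Hd (h *: 1 + t); rewrite addrK /GRing.scale/= mulr1 => /(_ hd) {}Hd.
  have hp : 0 < `|h| by rewrite normr_gt0.
  rewrite -(ler_pM2r hp) -normrM mulrBl [X in _ - X]mulrAC mulVf// mul1r.
  apply: le_trans Hd; rewrite distrC [p A * h]mulrC -pZ /= -!pB.
  exact: pl.
apply: DeriveDef; first by apply/cvg_ex; exists (p A).
by apply: cvg_lim.
Qed.

Lemma rdiff_cont F t A : rdiff F t A -> ccont_at F t.
Proof.
move=> H e e0; have [d d0 Hd] := H 1 ltr01.
have a0 : 0 < normc A + 1 by rewrite ltr_wpDl ?normc_ge0.
exists (Num.min d (e / (normc A + 1))); first by rewrite lt_min d0 divr_gt0.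
move=> s; rewrite lt_min => /andP[sd]; rewrite ltr_pdivlMr// => se.
have := Hd s sd; rewrite mul1r => {}Hd.
rewrite -(subrK ((s - t)%:C * A) (F s - F t)).
apply: le_trans (normc_triangle _ _) _; apply: le_trans (ltW se).
by rewrite [leRHS]mulrDr mulr1 addrC lerD// ncM nc_real.
Qed.

(** [p] stands for the real or the imaginary part; the argument uses only that it is real-linear and
    does not exceed the modulus. *)
Lemma FTC_part (p : C -> R) F G a b : a <= b ->
  (forall z w, p (z - w) = p z - p w) -> (forall z, `|p z| <= normc z) ->
  (forall (r : R) z, p (r%:C * z) = r * p z) ->
  (forall t, a <= t -> t <= b -> rdiff F t (G t)) -> ccont_on G a b ->
  \int[mu]_(t in `[a, b]) p (G t) = p (F b) - p (F a).
Proof.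
move=> ab pB pl pZ dF cG.
move: ab; rewrite le_eqVlt => /predU1P[->|ab].
  by rewrite subrr set_itv1 Rintegral_set1.
have D t : a <= t -> t <= b -> is_derive t 1 (p \o F) (p (G t)).
  by move=> ta tb; apply: rdiff_part => //; exact: dF.
have cF t : a <= t -> t <= b -> {for t, continuous (p \o F)}.
  move=> ta tb; apply: ccont_part; last exact: rdiff_cont (dF t ta tb).
  by move=> z w; rewrite -pB.
have cG' : {within `[a, b], continuous (p \o G)}.
  by apply: ccont_within => // z w; rewrite -pB.
rewrite /Rintegral (continuous_FTC2 (F := p \o F) ab cG')//.
  split.
  - move=> t; rewrite in_itv/= => /andP[/ltW ta /ltW tb].
    by have [] := D t ta tb.
  - by apply: cvg_at_right_filter; exact: cF (lexx _) (ltW ab).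
  - by apply: cvg_at_left_filter; exact: cF (ltW ab) (lexx _).
move=> t; rewrite in_itv/= => /andP[/ltW ta /ltW tb].
by rewrite derive1E; have [_ ->] := D t ta tb.
Qed.

Lemma cint_FTC F G a b : a <= b ->
  (forall t, a <= t -> t <= b -> rdiff F t (G t)) -> ccont_on G a b ->
  cint G a b = F b - F a.
Proof.
move=> ab dF cG; rewrite /cint.
rewrite (FTC_part ab (@ReB R) (@Re_le_normc R) _ dF cG); last first.
  by move=> r [c d] /=; rewrite mul0r subr0.
rewrite (FTC_part ab (@ImB R) (@Im_le_normc R) _ dF cG); last first.
  by move=> r [c d] /=; rewrite mul0r addr0.
by case: (F b) (F a) => c d [c' d'].
Qed.
End ComplexIntegral.

(** * Goursat's theorem on rectangles *)

Section Goursat.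
Variable R : realType.
Local Notation C := R[i].
Implicit Types (F G : C -> C) (a b c d x y : R).

(** The contour integral over the positively oriented boundary of the rectangle; on the vertical
    sides [dw = 'i dy]. *)
Definition bdry_int F a b c d : C :=
  cint (fun x => F (x +i* c)) a b + 'i * cint (fun y => F (b +i* y)) c d
  - cint (fun x => F (x +i* d)) a b - 'i * cint (fun y => F (a +i* y)) c d.

Definition cdiff_rect F a b c d := forall x y, a <= x -> x <= b -> c <= y -> y <= d ->
  exists A, cdiff F (x +i* y) A.

Lemma nc_horiz x x' y : normc (x' +i* y - (x +i* y)) = `|x' - x|.
Proof. by rewrite /Normc.normc/= subrr expr0n addr0 sqrtr_sqr. Qed.
Lemma nc_vert x y y' : normc (x +i* y' - (x +i* y)) = `|y' - y|.
Proof. by rewrite /Normc.normc/= subrr expr0n add0r sqrtr_sqr. Qed.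

Lemma cdiff_horiz F x y A : cdiff F (x +i* y) A -> rdiff (fun x => F (x +i* y)) x A.
Proof.
move=> H e e0; have [d d0 Hd] := H e e0; exists d => // s sd.
have -> : (s - x)%:C * A = A * (s +i* y - (x +i* y)).
  by rewrite mulrC; congr (_ * _); rewrite /real_complex_def; congr (_ +i* _) => /=; rewrite subrr.
by have := Hd (s +i* y); rewrite nc_horiz; apply.
Qed.
Lemma cdiff_vert F x y A : cdiff F (x +i* y) A -> rdiff (fun y => F (x +i* y)) y ('i * A).
Proof.
move=> H e e0; have [d d0 Hd] := H e e0; exists d => // s sd.
have -> : (s - y)%:C * ('i * A) = A * (x +i* s - (x +i* y)).
  rewrite mulrA mulrC; congr (_ * _); apply/eqP; rewrite eq_complex /=.
  by rewrite mul0r mulr0 !mulr1 mul0r addr0 !subrr !eqxx.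
by have := Hd (x +i* s); rewrite nc_vert; apply.
Qed.

Lemma rect_horiz F a b c d y : cdiff_rect F a b c d -> c <= y -> y <= d ->
  ccont_on (fun x => F (x +i* y)) a b.
Proof.
by move=> H cy yd x ax xb; have [A /cdiff_horiz/rdiff_cont] := H x y ax xb cy yd.
Qed.
Lemma rect_vert F a b c d x : cdiff_rect F a b c d -> a <= x -> x <= b ->
  ccont_on (fun y => F (x +i* y)) c d.
Proof.
by move=> H ax xb y cy yd; have [A /cdiff_vert/rdiff_cont] := H x y ax xb cy yd.
Qed.

Lemma cdiff_rectS F a b c d a' b' c' d' : a <= a' -> b' <= b -> c <= c' -> d' <= d ->
  cdiff_rect F a b c d -> cdiff_rect F a' b' c' d'.
Proof.
move=> aa bb cc dd H x y ax xb cy yd; apply: H.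
- exact: le_trans ax.
- exact: le_trans bb.
- exact: le_trans cy.
- exact: le_trans dd.
Qed.

Lemma dist_itv (s w t u : R) : s <= t -> t <= s + w -> s <= u -> u <= s + w ->
  `|t - u| <= w.
Proof. by move=> *; rewrite ler_norml; apply/andP; split; lra. Qed.

Lemma bdry_quad F a m b c n d : a <= m -> m <= b -> c <= n -> n <= d ->
  cdiff_rect F a b c d ->
  bdry_int F a b c d = bdry_int F a m c n + bdry_int F m b c n
    + bdry_int F a m n d + bdry_int F m b n d.
Proof.
move=> am mb cn nd H; rewrite /bdry_int.
have ab := le_trans am mb; have cd := le_trans cn nd.
rewrite (cint_cat am mb (rect_horiz H (lexx c) cd)).
rewrite (cint_cat am mb (rect_horiz H cd (lexx d))).
rewrite (cint_cat cn nd (rect_vert H (lexx a) ab)).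
rewrite (cint_cat cn nd (rect_vert H ab (lexx b))).
by do 12![move: (cint _ _ _)]; clear => *; ring.
Qed.

Lemma bdry_intD F G a b c d : a <= b -> c <= d -> cdiff_rect F a b c d -> cdiff_rect G a b c d ->
  bdry_int (fun w => F w + G w) a b c d = bdry_int F a b c d + bdry_int G a b c d.
Proof.
move=> ab cd HF HG; rewrite /bdry_int.
rewrite (cintD (rect_horiz HF (lexx c) cd) (rect_horiz HG (lexx c) cd)).
rewrite (cintD (rect_horiz HF cd (lexx d)) (rect_horiz HG cd (lexx d))).
rewrite (cintD (rect_vert HF ab (lexx b)) (rect_vert HG ab (lexx b))).
rewrite (cintD (rect_vert HF (lexx a) ab) (rect_vert HG (lexx a) ab)).
ring.
Qed.

Lemma bdry_prim F G a b c d : a <= b -> c <= d ->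
  (forall x y, a <= x -> x <= b -> c <= y -> y <= d -> cdiff F (x +i* y) (G (x +i* y))) ->
  cdiff_rect G a b c d -> bdry_int G a b c d = 0.
Proof.
move=> ab cd H HG; rewrite /bdry_int.
have Hh y : c <= y -> y <= d ->
    cint (fun x => G (x +i* y)) a b = F (b +i* y) - F (a +i* y).
  move=> cy yd; apply: (cint_FTC (F := fun x => F (x +i* y))) => //.
    by move=> x ax xb; apply: cdiff_horiz; exact: H.
  exact: rect_horiz HG _ _.
have Hv x : a <= x -> x <= b ->
    'i * cint (fun y => G (x +i* y)) c d = F (x +i* d) - F (x +i* c).
  move=> ax xb; rewrite -cintZ; last exact: rect_vert HG _ _.
  apply: (cint_FTC (F := fun y => F (x +i* y))) => //.
    by move=> y cy yd; apply: cdiff_vert; exact: H.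
  move=> y cy yd; have [A /cdiff_vert HA] := HG x y ax xb cy yd.
  have [B] : exists B, cdiff (fun w => 'i * G w) (x +i* y) B.
    have [A' HA'] := HG x y ax xb cy yd.
    exists (0 * G (x +i* y) + 'i * A'); apply: cdiffM HA'; exact: cdiff_cst.
  by move=> /cdiff_vert/rdiff_cont.
rewrite !Hh// !Hv//; ring.
Qed.

Lemma bdry_bound F a b c d (e : R) : a <= b -> c <= d -> cdiff_rect F a b c d ->
  (forall x y, a <= x -> x <= b -> c <= y -> y <= d -> normc (F (x +i* y)) <= e) ->
  normc (bdry_int F a b c d) <= 4 * e * ((b - a) + (d - c)).
Proof.
move=> ab cd H Fe.
have h y : c <= y -> y <= d -> normc (cint (fun x => F (x +i* y)) a b) <= 2 * e * (b - a).
  move=> cy yd; apply: cint_bound => //; first exact: rect_horiz H _ _.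
  by move=> t ta tb; exact: Fe.
have v x : a <= x -> x <= b -> normc ('i * cint (fun y => F (x +i* y)) c d) <= 2 * e * (d - c).
  move=> ax xb; rewrite ncM.
  have -> : normc ('i : C) = 1 by rewrite /Normc.normc/= expr0n expr1n add0r sqrtr1.
  rewrite mul1r; apply: cint_bound => //; first exact: rect_vert H _ _.
  by move=> t ta tb; exact: Fe.
rewrite /bdry_int; set A := cint _ a b; set B := 'i * _; set A' := cint _ a b; set B' := 'i * _.
have hA : normc A <= 2 * e * (b - a) by exact: h.
have hA' : normc A' <= 2 * e * (b - a) by exact: h.
have hB : normc B <= 2 * e * (d - c) by exact: v.
have hB' : normc B' <= 2 * e * (d - c) by exact: v.
have := nc_sub (A + B - A') B'; have := nc_sub (A + B) A'; have := normc_triangle A B.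
lra.
Qed.

(** Repeated quartering. If the integral were larger than [e], some quarter would keep the ratio of
    integral to squared size above [e1]. Near the common point of the nested rectangles [F] is
    affine up to a small error; the affine part has a primitive, and the error is too small for that
    ratio. *)
Theorem Goursat F a b c d : a <= b -> c <= d -> cdiff_rect F a b c d ->
  bdry_int F a b c d = 0.
Proof.
move=> ab cd H; apply/eqP; rewrite -nc_eq0; apply/eqP/le_anti; rewrite normc_ge0 andbT.
apply/ler_addgt0Pl => e e0; rewrite addr0 leNgt; apply/negP => Hbad.
(* The added 1 keeps the size positive for a degenerate rectangle. *)
pose l0 := (b - a) + (d - c) + 1.
have l0gt : 0 < l0 by rewrite /l0; lra.
pose e1 := e / l0 ^+ 2.
have e1gt : 0 < e1 by rewrite divr_gt0// exprn_gt0.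
pose wx n := (b - a) / 2 ^+ n; pose wy n := (d - c) / 2 ^+ n.
have wx0 n : 0 <= wx n by rewrite divr_ge0// subr_ge0.
have wy0 n : 0 <= wy n by rewrite divr_ge0// subr_ge0.
have wxS n : wx n = wx n.+1 + wx n.+1 by rewrite /wx exprS invfM; field; rewrite expf_neq0.
have wyS n : wy n = wy n.+1 + wy n.+1 by rewrite /wy exprS invfM; field; rewrite expf_neq0.
pose ln n := l0 / 2 ^+ n.
have lnS n : ln n = ln n.+1 + ln n.+1 by rewrite /ln exprS invfM; field; rewrite expf_neq0.
pose P n (p : R * R) := [/\ a <= p.1, p.1 + wx n <= b, c <= p.2, p.2 + wy n <= d &
  e1 * ln n ^+ 2 < normc (bdry_int F p.1 (p.1 + wx n) p.2 (p.2 + wy n))].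
pose Q n (p p' : R * R) := [/\ p.1 <= p'.1, p'.1 + wx n.+1 <= p.1 + wx n,
  p.2 <= p'.2 & p'.2 + wy n.+1 <= p.2 + wy n].
have step n p : P n p -> exists2 p', P n.+1 p' & Q n p p'.
  case: p => x y [/= ax xb cy yd]; apply: contraPP => Hno; apply/negP; rewrite -leNgt.
  have w1 := wx0 n.+1; have w2 := wy0 n.+1; have wxs := wxS n; have wys := wyS n.
  have K x' y' : (x' = x \/ x' = x + wx n.+1) -> (y' = y \/ y' = y + wy n.+1) ->
      normc (bdry_int F x' (x' + wx n.+1) y' (y' + wy n.+1)) <= e1 * ln n.+1 ^+ 2.
    move=> [->|->] [->|->]; rewrite leNgt; apply/negP => HB; apply: Hno;
      (eexists (_, _); [split; last exact: HB|split] => /=);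
      move: ax xb cy yd w1 w2 wxs wys; clear;
      move: (wx n) (wx n.+1) (wy n) (wy n.+1) => *; lra.
  rewrite (@bdry_quad _ _ (x + wx n.+1) _ _ (y + wy n.+1)); first last.
  - by apply: cdiff_rectS H => //; lra.
  - by lra.
  - by lra.
  - by lra.
  - by lra.
  have := K x y (or_introl erefl) (or_introl erefl).
  have := K (x + wx n.+1) y (or_intror erefl) (or_introl erefl).
  have := K x (y + wy n.+1) (or_introl erefl) (or_intror erefl).
  have := K (x + wx n.+1) (y + wy n.+1) (or_intror erefl) (or_intror erefl).
  have -> : x + wx n.+1 + wx n.+1 = x + wx n by rewrite wxs addrA.
  have -> : y + wy n.+1 + wy n.+1 = y + wy n by rewrite wys addrA.
  set B1 := bdry_int _ _ _ _ _; set B2 := bdry_int _ _ _ _ _.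
  set B3 := bdry_int _ _ _ _ _; set B4 := bdry_int _ _ _ _ _.
  have := normc_triangle (B4 + B3 + B2) B1; have := normc_triangle (B4 + B3) B2.
  have := normc_triangle B4 B3.
  have -> : e1 * ln n ^+ 2 = e1 * ln n.+1 ^+ 2 *+ 4 by rewrite lnS; ring.
  clearbody B1 B2 B3 B4; move: (e1 * _); clear; move=> *; lra.
(* [choice] wants a total function; where the invariant fails, any value will do. *)
have : forall np : nat * (R * R), exists p', P np.1 np.2 -> P np.1.+1 p' /\ Q np.1 np.2 p'.
  move=> [n p]; have [Pnp|nP] := pselect (P n p); last by exists p.
  by have [p' ? ?] := step n p Pnp; exists p'.
move=> /choice [f Hf].
pose s := fix s n := if n is n'.+1 then f (n', s n') else (a, c).
have Ps n : P n (s n).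
  elim: n => [|n IH].
    rewrite /P /wx /wy /ln /= expr0 !divr1 !subrKC; split => //.
    by rewrite /e1 divfK// expf_neq0// gt_eqF.
  by have [] := Hf (n, s n) IH.
have Qs n : Q n (s n) (s n.+1) by have [] := Hf (n, s n) (Ps n).
have mono m n : [/\ (s m).1 <= (s (m + n)%N).1, (s (m + n)%N).1 <= (s m).1 + wx m,
    (s m).2 <= (s (m + n)%N).2 & (s (m + n)%N).2 <= (s m).2 + wy m].
  suff : [/\ (s m).1 <= (s (m + n)%N).1, (s (m + n)%N).1 + wx (m + n)%N <= (s m).1 + wx m,
    (s m).2 <= (s (m + n)%N).2 & (s (m + n)%N).2 + wy (m + n)%N <= (s m).2 + wy m].
    move=> [? h2 ? h4]; split => //.
      by apply: le_trans h2; rewrite lerDl.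
    by apply: le_trans h4; rewrite lerDl.
  elim: n => [|n [h1 h2 h3 h4]]; first by rewrite addn0.
  have [q1 q2 q3 q4] := Qs (m + n)%N; rewrite addnS.
  by split; [exact: le_trans q1|exact: le_trans q2 h2|exact: le_trans q3|exact: le_trans q4 h4].
have monox m n : (s m).1 <= (s n).1 + wx n.
  have [mn|/ltnW mn] := leqP m n.
    have [h _ _ _] := mono m (n - m)%N; rewrite subnKC// in h.
    by apply: le_trans h _; rewrite lerDl.
  by have [_ h _ _] := mono n (m - n)%N; rewrite subnKC// in h.
have monoy m n : (s m).2 <= (s n).2 + wy n.
  have [mn|/ltnW mn] := leqP m n.
    have [_ _ h _] := mono m (n - m)%N; rewrite subnKC// in h.
    by apply: le_trans h _; rewrite lerDl.
  by have [_ _ _ h] := mono n (m - n)%N; rewrite subnKC// in h.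
(* The lower left corners increase in both coordinates, so their suprema give a point common to all
   the rectangles. *)
pose X := [set (s n).1 | n in setT]; pose Y := [set (s n).2 | n in setT].
pose x := sup X; pose y := sup Y.
have xl n : (s n).1 <= x.
  by apply: ub_le_sup; [exists ((s 0%N).1 + wx 0%N) => _ [m _ <-]|exists n].
have xu n : x <= (s n).1 + wx n.
  by apply: ge_sup; [exists (s 0%N).1, 0%N|move=> _ [m _ <-]].
have yl n : (s n).2 <= y.
  by apply: ub_le_sup; [exists ((s 0%N).2 + wy 0%N) => _ [m _ <-]|exists n].
have yu n : y <= (s n).2 + wy n.
  by apply: ge_sup; [exists (s 0%N).2, 0%N|move=> _ [m _ <-]].
have [A HA] : exists A, cdiff F (x +i* y) A.
  have [ax xb cy yd _] := Ps 0%N; apply: H.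
  - exact: le_trans (xl 0%N).
  - exact: le_trans (xu 0%N) _.
  - exact: le_trans (yl 0%N).
  - exact: le_trans (yu 0%N) _.
(* The 8 pays for the factor 4 of [bdry_bound], with a factor 2 to spare. *)
have e8 : 0 < e1 / 8 by lra.
have [dl dl0 Hdl] := HA _ e8.
have [n Hn] : exists n, ln n < dl.
  have : (fun n => l0 * 2^-1 ^+ n : R) @ \oo --> (0 : R).
    rewrite -(mulr0 l0); apply: cvgMr; apply: cvg_expr.
    by rewrite ger0_norm ?invr_ge0// invf_lt1// ltr1n.
  move=> /cvgrPdist_lt /(_ dl dl0) [n _ Hn]; exists n.
  have := Hn n (leqnn n); rewrite sub0r normrN /ln -exprVn ger0_norm//.
  by rewrite mulr_ge0// ltW.
have [ax xb cy yd Pb] := Ps n.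
have size : wx n + wy n <= ln n.
  by rewrite /wx /wy /ln -mulrDl ler_pM2r ?invr_gt0 ?exprn_gt0// /l0; lra.
set x0 := (s n).1 in ax xb Pb; set y0 := (s n).2 in cy yd Pb.
have wxn := wx0 n; have wyn := wy0 n.
have xl' : x0 <= x by exact: xl. have xu' : x <= x0 + wx n by exact: xu.
have yl' : y0 <= y by exact: yl. have yu' : y <= y0 + wy n by exact: yu.
pose p := x +i* y.
pose L w := F p + A * (w - p).
have Ldiff w : cdiff L w A.
  have := cdiffD (cdiff_cst (F p) w) (cdiffM (cdiff_cst A w) (cdiffB (cdiff_id w) (cdiff_cst p w))).
  by rewrite mul0r subr0 !add0r mulr1.
pose E w := F w - L w.
have HF' : cdiff_rect F x0 (x0 + wx n) y0 (y0 + wy n) by apply: cdiff_rectS H.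
have HE : cdiff_rect E x0 (x0 + wx n) y0 (y0 + wy n).
  move=> u v h1 h2 h3 h4; have [B HB] := HF' u v h1 h2 h3 h4.
  by exists (B - A); apply: cdiffB.
have x0w : x0 <= x0 + wx n by rewrite lerDl.
have y0w : y0 <= y0 + wy n by rewrite lerDl.
have J : bdry_int F x0 (x0 + wx n) y0 (y0 + wy n) = bdry_int E x0 (x0 + wx n) y0 (y0 + wy n).
  have -> : F = (fun w => E w + L w) by apply/funext => w; rewrite /E subrK.
  rewrite bdry_intD//; last by move=> u v _ _ _ _; exists A.
  rewrite (_ : bdry_int L _ _ _ _ = 0); last first.
    apply: (@bdry_prim (fun w => F p * w + A * ((w - p) * (w - p)) / 2)) => //.
      move=> u v _ _ _ _; set w := u +i* v.
      have d1 := cdiffB (cdiff_id w) (cdiff_cst p w).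
      have := cdiffD (cdiffM (cdiff_cst (F p) w) (cdiff_id w))
        (cdiffM (cdiffM (cdiff_cst A w) (cdiffM d1 d1)) (cdiff_cst 2^-1 w)).
      by congr cdiff; rewrite /L; field.
    by move=> u v _ _ _ _; exists A.
  by rewrite addr0.
move: Pb; rewrite J; apply/negP; rewrite -leNgt.
apply: le_trans (bdry_bound (e := e1 / 8 * ln n) x0w y0w HE _) _; last first.
  have lngt : 0 < ln n by rewrite divr_gt0// exprn_gt0.
  have -> : 4 * (e1 / 8 * ln n) * (x0 + wx n - x0 + (y0 + wy n - y0)) =
    e1 * (ln n / 2 * (wx n + wy n)) by field.
  rewrite ler_wpM2l ?ltW//; move: size lngt wxn wyn.
  by move: (wx n) (wy n) (ln n); clear => u v l *; nra.
move=> u v h1 h2 h3 h4.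
have D : normc (u +i* v - p) <= ln n.
  apply: le_trans (nc_ReIm _) _; apply: le_trans size; rewrite ReB ImB /=.
  by apply: lerD; [exact: dist_itv h1 h2 xl' xu'|exact: dist_itv h3 h4 yl' yu'].
rewrite /E /L opprD addrA; apply: le_trans (Hdl _ (le_lt_trans D Hn)) _.
by rewrite ler_wpM2l// ltW.
Qed.
End Goursat.

(** * The complex exponential *)

Section ComplexExp.
Variable R : realType.
Local Notation C := R[i].
Implicit Types (z w : C) (t x y : R).

Definition expi t : C := cos t +i* sin t.

Lemma expiD s t : expi (s + t) = expi s * expi t.
Proof.
rewrite /expi cosD sinD; apply/eqP; rewrite eq_complex /= eqxx/=.
by rewrite addrC.
Qed.
Lemma expi0 : expi 0 = 1. Proof. by rewrite /expi cos0 sin0. Qed.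
Lemma nc_expi t : normc (expi t) = 1.
Proof. by rewrite /Normc.normc/= cos2Dsin2 sqrtr1. Qed.
Lemma expi_neq0 t : expi t != 0.
Proof. by rewrite -nc_eq0 nc_expi oner_eq0. Qed.
Lemma expi2pi : expi (pi *+ 2) = 1.
Proof. by rewrite /expi cos2pi sin2pi. Qed.
Lemma expipi : expi pi = -1.
Proof. by rewrite /expi cospi sinpi; apply/eqP; rewrite eq_complex /= oppr0 !eqxx. Qed.
Lemma expiX t n : expi t ^+ n = expi (t *+ n).
Proof. by elim: n => [|n IH]; rewrite ?expi0// exprS IH mulrS expiD. Qed.
Lemma expi_conj t : (expi t)^* = (expi t)^-1.
Proof.
apply: (mulfI (expi_neq0 t)); rewrite mulfV ?expi_neq0// mulcC_conj nc_expi expr1n.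
by [].
Qed.

Lemma rderiv_eps (f : R -> R) x A : is_derive x 1 f A -> forall e : R, 0 < e ->
  exists2 d : R, 0 < d & forall s, `|s - x| < d -> `|f s - f x - A * (s - x)| <= e * `|s - x|.
Proof.
move=> [df dA] e e0.
have c : (fun h : R => h^-1 *: (f (h *: 1 + x) - f x)) @ 0^' --> A.
  by rewrite -dA; exact: df.
move/cvgrPdist_le : c => /(_ e e0); rewrite near_withinE => -[d d0 H].
exists d => // s sd; have [->|sx] := eqVneq s x; first by rewrite !subrr mulr0 subr0 normr0 mulr0.
have h0 : s - x != 0 by rewrite subr_eq0.
have := H (s - x); rewrite /= sub0r normrN => /(_ sd h0).
rewrite /GRing.scale/= mulr1 subrK => {}H.
have h0' : 0 < `|s - x| by rewrite normr_gt0.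
rewrite -(ler_pM2r h0') in H; apply: le_trans H.
by rewrite -normrM distrC mulrBl [(_^-1 * _) * _]mulrAC mulVf// mul1r.
Qed.

Definition cexp z : C := (expR (complex.Re z))%:C * expi (complex.Im z).

Lemma cexpD z w : cexp (z + w) = cexp z * cexp w.
Proof. by rewrite /cexp ReD ImD expRD expiD rmorphM/= mulrACA. Qed.
Lemma nc_cexp z : normc (cexp z) = expR (complex.Re z).
Proof. by rewrite /cexp ncM nc_expi mulr1 nc_real ger0_norm// expR_ge0. Qed.

Lemma cexp0 : cexp 0 = 1.
Proof. by rewrite /cexp /= expR0 expi0 mulr1. Qed.

Lemma cdiff_cexp0 : cdiff cexp 0 1.
Proof.
(* The split below costs at most [7 e1 |h|], hence [e / 8]; the bound [1 / 2] keeps [expR u] below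
   2. *)
move=> e e0; pose e1 := Num.min (e / 8) (1 / 2).
have e10 : 0 < e1 by rewrite lt_min !divr_gt0.
have e1e : e1 <= e / 8 by rewrite ge_min lexx.
have e1h : e1 <= 1 / 2 by rewrite ge_min lexx orbT.
clearbody e1.
have [d1 d10 H1] := rderiv_eps (is_derive_expR 0) e10.
have [d2 d20 H2] := rderiv_eps (is_derive_cos 0) e10.
have [d3 d30 H3] := rderiv_eps (is_derive_sin 0) e10.
exists (Num.min (Num.min d1 d2) (Num.min d3 e1)); first by rewrite !lt_min d10 d20 d30 e10.
move=> h; rewrite subr0 !lt_min => /andP[/andP[hd1 hd2] /andP[hd3 he]].
rewrite cexp0 mul1r; case: h hd1 hd2 hd3 he => u v hd1 hd2 hd3 he.
set N := normc (u +i* v) in hd1 hd2 hd3 he *; have uN : `|u| <= N by exact: Re_le_normc (u +i* v).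
have vN : `|v| <= N by exact: Im_le_normc (u +i* v).
move: (H1 u) (H2 v) (H3 v); rewrite !subr0 expR0 cos0 sin0 oppr0 mul0r !mul1r subr0.
move=> /(_ (le_lt_trans uN hd1)) {}H1 /(_ (le_lt_trans vN hd2)) {}H2 /(_ (le_lt_trans vN hd3)) {}H3.
rewrite addr0 in H3.
(* Each summand isolates one of the real first-order remainders of exp, cos and sin at 0, or is a
   product of two small factors. *)
have -> : cexp (u +i* v) - 1 - (u +i* v) =
   (expR u)%:C * ((cos v - 1) +i* (sin v - v)) + (expR u - 1 - u)%:C + ((expR u - 1) * v)%:C * 'i.
  rewrite /cexp /expi; apply/eqP; rewrite eq_complex /=; apply/andP; split; apply/eqP; ring.
apply: le_trans (normc_triangle _ _) _.
apply: le_trans (lerD (normc_triangle _ _) (lexx _)) _.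
rewrite !ncM !nc_real.
have -> : normc ('i : C) = 1 by rewrite /Normc.normc/= expr0n expr1n add0r sqrtr1.
rewrite mulr1 normrM.
have N0 : 0 <= N by exact: normc_ge0.
have a1 : `|expR u - 1| <= 2 * N.
  rewrite -(subrK u (expR u - 1)); apply: le_trans (ler_normD _ _) _.
  have : e1 * `|u| <= 1 * N by apply: ler_pM => //; rewrite ?normr_ge0 ?ltW//; lra.
  lra.
have a2 : `|expR u| <= 2.
  have := ler_normD (expR u - 1) 1; rewrite subrK normr1; lra.
have a3 : normc ((cos v - 1) +i* (sin v - v)) <= e1 * N + e1 * N.
  apply: le_trans (nc_ReIm _) _; rewrite /= lerD//.
    by apply: le_trans H2 _; rewrite ler_pM2l.
  by apply: le_trans H3 _; rewrite ler_pM2l.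
have a4 : `|expR u| * normc ((cos v - 1) +i* (sin v - v)) <= 2 * (e1 * N + e1 * N).
  by apply: ler_pM => //; exact: normc_ge0.
have a5 : `|expR u - 1| * `|v| <= 2 * N * e1 by apply: ler_pM => //; apply: le_trans vN (ltW he).
have a6 : e1 * `|u| <= e1 * N by rewrite ler_pM2l.
have a7 : e1 * N <= e / 8 * N by rewrite ler_wpM2r.
have -> : e * N = e / 8 * N *+ 8 by field.
apply: (@le_trans _ _ (2 * (e1 * N + e1 * N) + e1 * N + 2 * N * e1)).
  by apply: lerD => //; apply: lerD => //; exact: le_trans a6.
have -> : 2 * (e1 * N + e1 * N) + e1 * N + 2 * N * e1 = e1 * N *+ 7 by ring.
have : 0 <= e1 * N by rewrite mulr_ge0// ltW.
move: a7; move: (e1 * N) (e / 8 * N); clear => *; lra.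
Qed.

Lemma cdiff_cexp z : cdiff cexp z (cexp z).
Proof.
have -> : cexp = (fun w => cexp z * cexp (w - z)).
  by apply/funext => w; rewrite -cexpD addrC subrK.
have d1 := cdiffB (cdiff_id z) (cdiff_cst z z).
have h : cdiff cexp (z - z) 1 by rewrite subrr; exact: cdiff_cexp0.
have := cdiffM (cdiff_cst (cexp z) z) (cdiff_comp d1 h).
by rewrite !subr0 mulr1 mul0r add0r subrr cexp0.
Qed.

End ComplexExp.

(** * Integrals over circles centred at 0 *)

Section CircleMean.
Variable R : realType.
Local Notation C := R[i].
Implicit Types (h : C -> C) (z w : C) (r t : R).

Definition ccontC h z := forall e : R, 0 < e -> exists2 d : R, 0 < d &
  forall w, normc (w - z) < d -> normc (h w - h z) <= e.

Definition circ h r : R -> C := fun t => h (r%:C * expi t).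
(** Not normalised: a constant is multiplied by [2 pi]. *)
Definition cmean h r : C := cint (circ h r) 0 (pi *+ 2).

Lemma pi2_ge0 : 0 <= (pi *+ 2 : R). Proof. by rewrite mulrn_wge0// pi_ge0. Qed.

Lemma expi_cont t : ccont_at (@expi R) t.
Proof.
have h : @expi R = (fun y => cexp (0 +i* y)).
  by apply/funext => y; rewrite /cexp /= expR0 mul1r.
by rewrite h; have /cdiff_vert/rdiff_cont := cdiff_cexp (0 +i* t : C).
Qed.

Lemma circ_ccont h r t : ccontC h (r%:C * expi t) -> ccont_at (circ h r) t.
Proof.
move=> H e e0; have [d d0 Hd] := H e e0.
have r0 : 0 < `|r| + 1 by rewrite ltr_wpDl.
have [d' d'0 Hd'] := expi_cont t (divr_gt0 d0 (mulr_gt0 r0 (@ltr0n R 2))).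
exists d' => // s sd; apply: Hd; rewrite -mulrBr ncM nc_real.
apply: (@le_lt_trans _ _ ((`|r| + 1) * (d / ((`|r| + 1) * 2)))).
  by apply: ler_pM; rewrite ?normc_ge0 ?lerDl ?Hd'.
have -> : (`|r| + 1) * (d / ((`|r| + 1) * 2)) = d / 2 by field; rewrite gt_eqF.
lra.
Qed.

Lemma cdiff_ccontC h z A : cdiff h z A -> ccontC h z.
Proof. by move=> H e e0; exact: cdiff_cont H e e0. Qed.

Lemma nc_rexpi r t : normc (r%:C * expi t) = `|r|.
Proof. by rewrite ncM nc_expi mulr1 nc_real. Qed.

(** The exponential maps the rectangle [[ln r1, ln r2] x [0, 2 pi]] onto the annulus. In Goursat's
    theorem for [h] composed with it, the horizontal sides cancel by periodicity and the vertical
    sides are the two means. *)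
Lemma cmean_annulus h r1 r2 : 0 < r1 -> r1 <= r2 ->
  (forall z, r1 <= normc z -> normc z <= r2 -> exists A, cdiff h z A) ->
  cmean h r1 = cmean h r2.
Proof.
move=> r10 r12 H; pose F w := h (cexp w).
have r20 : 0 < r2 by apply: lt_le_trans r12.
have HF : cdiff_rect F (ln r1) (ln r2) 0 (pi *+ 2).
  move=> x y xa xb _ _.
  have [||A HA] := H (cexp (x +i* y)).
  - by rewrite nc_cexp /= -(lnK r10) ler_expR.
  - by rewrite nc_cexp /= -[leRHS](lnK r20) ler_expR.
  by eexists; exact: cdiff_comp (cdiff_cexp _) HA.
have lab : ln r1 <= ln r2 by rewrite ler_ln.
have := Goursat lab pi2_ge0 HF; rewrite /bdry_int.
have -> : (fun x => F (x +i* 0)) = (fun x => F (x +i* (pi *+ 2))).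
  by apply/funext => x; rewrite /F /cexp /= expi0 expi2pi.
have E r : 0 < r -> (fun y => F (ln r +i* y)) = circ h r.
  by move=> r0; apply/funext => y; rewrite /F /cexp /= lnK.
rewrite (E _ r10) (E _ r20) -/(cmean h r1) -/(cmean h r2).
set X := cint _ _ _ => H0; have : 'i * (cmean h r2 - cmean h r1) = 0.
  by rewrite -{}H0; ring.
have i0 : ('i : C) != 0.
  by rewrite -nc_eq0 /Normc.normc/= expr0n expr1n add0r sqrtr1 oner_eq0.
by move/eqP; rewrite mulf_eq0 (negbTE i0) subr_eq0 => /eqP.
Qed.

(** Compactness of the interval of angles makes the continuity in the radius uniform. *)
Lemma cmean_cont h r (e : R) : 0 < e -> (forall z, normc z = `|r| -> ccontC h z) ->
  exists2 d : R, 0 < d & forall r', `|r' - r| < d ->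
    forall t, 0 <= t -> t <= pi *+ 2 -> normc (circ h r' t - circ h r t) <= e.
Proof.
move=> e0 H.
have cK : compact (`[0, (pi *+ 2)] : set R) by exact: segment_compact.
move/compact_near_coveringP : cK.
move=> /(_ R (nbhs r) (fun r' t => normc (circ h r' t - circ h r t) <= e) _).
case.
  move=> t _; set z := r%:C * expi t.
  have [|d d0 Hd] := H z _ (e / 2) (divr_gt0 e0 (ltr0n _ 2)); first exact: nc_rexpi.
  have r0 : 0 < `|r| + 1 by rewrite ltr_wpDl.
  have d40 : 0 < d / 4 by rewrite divr_gt0.
  have [d' d'0 Hd'] := expi_cont t (divr_gt0 d40 r0).
  exists (ball t d', ball r (d / 4)); first by split; exact: nbhsx_ballx.
  move=> [t' r'] /= [bt br].
  have bt' : `|t' - t| < d' by move: bt; rewrite /ball/= distrC.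
  have br' : `|r' - r| < d / 4 by move: br; rewrite /ball/= distrC.
  have k1 : normc (r%:C * expi t' - z) <= d / 4.
    rewrite /z -mulrBr ncM nc_real.
    apply: (@le_trans _ _ ((`|r| + 1) * (d / 4 / (`|r| + 1)))).
      by apply: ler_pM; rewrite ?normc_ge0 ?lerDl ?Hd'.
    by rewrite mulrC divfK// gt_eqF.
  have k2 : normc (r'%:C * expi t' - z) <= d / 4 + d / 4.
    apply: le_trans (nc_dist _ _ (r%:C * expi t')) _; rewrite lerD//.
    by rewrite -mulrBl -rmorphB nc_rexpi ltW.
  have := Hd (r%:C * expi t') (le_lt_trans k1 _); have := Hd (r'%:C * expi t') (le_lt_trans k2 _).
  rewrite /circ => h1 h2; apply: le_trans (nc_dist _ _ (h z)) _.
  rewrite (splitr e) lerD ?h1//; first lra.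
  by rewrite ncB h2//; lra.
move=> d /= d0 Hd; exists d => // r' r'r t t0 t2.
by apply: Hd => /=; [rewrite distrC|rewrite in_itv/= t0].
Qed.

Lemma circ_ccont_on h r : (forall z, normc z = `|r| -> ccontC h z) ->
  ccont_on (circ h r) 0 (pi *+ 2).
Proof. by move=> H t _ _; apply: circ_ccont; apply: H; exact: nc_rexpi. Qed.

Lemma cmean_bound h r (e : R) : (forall z, normc z = `|r| -> ccontC h z) ->
  (forall z, normc z = `|r| -> normc (h z) <= e) ->
  normc (cmean h r) <= 2 * e * (pi *+ 2).
Proof.
move=> Hc He; have := cint_bound (B := e) pi2_ge0 (circ_ccont_on Hc).
by rewrite subr0; apply => t _ _; apply: He; exact: nc_rexpi.
Qed.

Lemma ccontC_D h k z : ccontC h z -> ccontC k z -> ccontC (fun w => h w + k w) z.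
Proof.
move=> ch ck e e0; have e2 : 0 < e / 2 by rewrite divr_gt0.
have [d1 d10 H1] := ch _ e2; have [d2 d20 H2] := ck _ e2.
exists (Num.min d1 d2); first by rewrite lt_min d10.
move=> w; rewrite lt_min => /andP[w1 w2]; rewrite opprD addrACA (splitr e).
by apply: le_trans (normc_triangle _ _) _; rewrite lerD ?H1 ?H2.
Qed.
Lemma ccontC_M h k z : ccontC h z -> ccontC k z -> ccontC (fun w => h w * k w) z.
Proof.
move=> ch ck e e0; pose B := normc (k z) + 1; pose A := normc (h z) + 1.
have B0 : 0 < B by rewrite ltr_wpDl ?normc_ge0.
have A0 : 0 < A by rewrite ltr_wpDl ?normc_ge0.
have eB : 0 < e / 2 / B by rewrite !divr_gt0.
have eA : 0 < Num.min 1 (e / 2 / A) by rewrite lt_min ltr01 !divr_gt0.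
have [d1 d10 H1] := ch _ eB; have [d2 d20 H2] := ck _ eA.
exists (Num.min d1 d2); first by rewrite lt_min d10.
move=> w; rewrite lt_min => /andP[/H1 {}H1 /H2 {}H2].
have -> : h w * k w - h z * k z = (h w - h z) * k w + h z * (k w - k z) by ring.
apply: le_trans (normc_triangle _ _) _; rewrite (splitr e) !ncM lerD//.
  have kB : normc (k w) <= B.
    have := normc_triangle (k w - k z) (k z); rewrite subrK => kk.
    apply: le_trans kk _; rewrite addrC lerD2l; apply: le_trans H2 _.
    by rewrite ge_min lexx.
  have -> : e / 2 = e / 2 / B * B by rewrite divfK// gt_eqF.
  by apply: ler_pM; rewrite ?normc_ge0.
have -> : e / 2 = A * (e / 2 / A) by rewrite [RHS]mulrC divfK// gt_eqF.
apply: ler_pM; rewrite ?normc_ge0 ?lerDl//; apply: le_trans H2 _.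
by rewrite ge_min lexx orbT.
Qed.
Lemma ccontC_cst (c : C) z : ccontC (fun=> c) z.
Proof. exact: cdiff_ccontC (cdiff_cst c z). Qed.

Lemma cmeanD h k r : (forall z, normc z = `|r| -> ccontC h z) ->
  (forall z, normc z = `|r| -> ccontC k z) ->
  cmean (fun z => h z + k z) r = cmean h r + cmean k r.
Proof. by move=> ch ck; apply: cintD; exact: circ_ccont_on. Qed.

Lemma cmeanZ (c : C) h r : (forall z, normc z = `|r| -> ccontC h z) ->
  cmean (fun z => c * h z) r = c * cmean h r.
Proof. by move=> ch; apply: cintZ; exact: circ_ccont_on. Qed.

Lemma eq_cmean h k r : (forall z, normc z = `|r| -> h z = k z) -> cmean h r = cmean k r.
Proof. by move=> hk; apply: cint_eq => t _ _; apply: hk; exact: nc_rexpi. Qed.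

Lemma cmean_cst (c : C) r : cmean (fun=> c) r = c * (pi *+ 2)%:C.
Proof.
rewrite /cmean /circ (@cint_FTC _ (fun t => c * t%:C)) ?pi2_ge0//.
- by rewrite mulr0 subr0.
- move=> t _ _ e e0; exists 1 => // s _.
  by rewrite [(s - t)%:C]rmorphB /= mulrBl ![_ * c]mulrC subrr nc0 mulr_ge0// ltW.
- by move=> t _ _ e e0; exists 1 => // s _; rewrite subrr nc0 ltW.
Qed.

(** Differentiability may fail on the circle of radius [r0], where continuity is enough. This admits
    a difference quotient whose singularity has been filled in. *)
Lemma cmean_const h (r0 : R) :
  (forall z, 0 < normc z < 1 -> normc z != r0 -> exists A, cdiff h z A) ->
  (forall z, 0 < normc z < 1 -> ccontC h z) ->
  forall r1 r2, 0 < r1 < 1 -> 0 < r2 < 1 -> cmean h r1 = cmean h r2.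
Proof.
move=> Hd Hc.
have key r r' : 0 < r -> r <= r' -> r' < 1 -> (r' < r0) || (r0 < r) -> cmean h r = cmean h r'.
  move=> r_0 rr r1 out; apply: cmean_annulus => // z z1 z2; apply: Hd.
    by rewrite (lt_le_trans r_0)//= (le_lt_trans z2).
  apply/eqP => zr; move: out; rewrite -zr => /orP[|]; first by rewrite ltNge z2.
  by rewrite ltNge z1.
(* The exceptional circle is reached as a limit: between [r] and a radius close to [r0] the mean is
   constant, and it is continuous at [r0]. *)
have key2 r : 0 < r0 < 1 -> 0 < r < 1 -> cmean h r = cmean h r0.
  move=> /andP[r00 r01] /andP[r_0 r_1].
  have [->//|rr0] := eqVneq r r0.
  apply/eqP; rewrite -subr_eq0 -nc_eq0; apply/eqP/le_anti; rewrite normc_ge0 andbT.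
  apply/ler_addgt0Pl => e e0; rewrite addr0.
  have p0 : 0 < (pi *+ 2 : R) by rewrite mulrn_wgt0// pi_gt0.
  have K0 : 0 < 2 * (pi *+ 2 : R) by rewrite mulr_gt0.
  have c0 : forall z, normc z = `|r0| -> ccontC h z.
    by move=> z zr; apply: Hc; rewrite zr gtr0_norm// r00.
  have [d d0 Hdd] := cmean_cont (divr_gt0 e0 K0) c0.
  have near_r r' : 0 < r' < 1 -> `|r' - r0| < d -> normc (cmean h r' - cmean h r0) <= e.
    move=> /andP[r'0 r'1] r'd.
    have c' : ccont_on (circ h r') 0 (pi *+ 2).
      by apply: circ_ccont_on => z zr; apply: Hc; rewrite zr gtr0_norm// r'0.
    have c0' : ccont_on (circ h r0) 0 (pi *+ 2) by exact: circ_ccont_on.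
    have c1 : ccont_on (fun t => -1 * circ h r0 t) 0 (pi *+ 2).
      move=> t t0 t1 e' e'0; have [d' d'0 Hd'] := c0' t t0 t1 e' e'0; exists d' => // s sd.
      by rewrite !mulN1r -opprD ncN; exact: Hd'.
    rewrite -[X in _ + X]mulN1r -cintZ// -cintD//.
    apply: le_trans (cint_bound (B := e / (2 * (pi *+ 2))) pi2_ge0 _ _) _.
    - move=> t t0 t1 e' e'0.
      have e2 : 0 < e' / 2 by rewrite divr_gt0.
      have [d1 d10 Hd1] := c' t t0 t1 _ e2; have [d2 d20 Hd2] := c1 t t0 t1 _ e2.
      exists (Num.min d1 d2); first by rewrite lt_min d10.
      move=> s; rewrite lt_min => /andP[s1 s2]; rewrite opprD addrACA (splitr e').
      by apply: le_trans (normc_triangle _ _) _; rewrite lerD ?Hd1 ?Hd2.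
    - by move=> t t0 t1; rewrite mulN1r; exact: Hdd.
    - by rewrite subr0 mulrAC mulrC divfK// gt_eqF.
  case: (ltgtP r r0) rr0 => // rr _.
    have [r' [h1 h2 h3]] : exists r', [/\ r <= r', r' < r0 & `|r' - r0| < d].
      exists (Num.max r (r0 - d / 2)); split.
      - by rewrite le_max lexx.
      - by rewrite gt_max rr; lra.
      - rewrite ltr0_norm; first by rewrite opprB ltrBlDr -ltrBlDl lt_max; apply/orP; right; lra.
        by rewrite subr_lt0 gt_max rr; lra.
    rewrite (key r r')//; [|lra|by rewrite h2].
    by apply: near_r => //; apply/andP; split; lra.
  have [r' [h1 h2 h3]] : exists r', [/\ r' <= r, r0 < r' & `|r' - r0| < d].
    exists (Num.min r (r0 + d / 2)); split.
    - by rewrite ge_min lexx.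
    - by rewrite lt_min rr; lra.
    - rewrite gtr0_norm; first by rewrite ltrBlDr gt_min; apply/orP; right; lra.
      by rewrite subr_gt0 lt_min rr; lra.
  rewrite -(key r' r)//; [|lra|by rewrite h2 orbT].
  by apply: near_r => //; apply/andP; split; lra.
(* If [r0] is not in [(0, 1)], no circle is exceptional and [key] applies throughout. *)
have [r0in|r0out] := boolP (0 < r0 < 1).
  by move=> r1 r2 h1 h2; rewrite !key2.
have main r1 r2 : r1 <= r2 -> 0 < r1 < 1 -> 0 < r2 < 1 -> cmean h r1 = cmean h r2.
  move=> r12 /andP[a1 a2] /andP[b1 b2]; apply: key => //.
  by move: r0out; rewrite negb_and -!leNgt => /orP[?|?]; apply/orP; [right|left]; lra.
move=> r1 r2 h1 h2; have [|/ltW] := leP r1 r2 => ?; first exact: main.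
by apply/esym; exact: main.
Qed.
End CircleMean.

(** * Power series *)

Section ComplexSequences.
Variable R : realType.
Local Notation C := R[i].
Implicit Types (u v : nat -> C) (l m : C).

Definition ccvg u l := forall e : R, 0 < e -> exists N, forall n, (N <= n)%N -> normc (u n - l) <= e.

Lemma ccvg_le u l (b : nat -> R) : (forall n, normc (u n - l) <= b n) ->
  b @ \oo --> (0 : R) -> ccvg u l.
Proof.
move=> H /cvgrPdist_le bc e e0; have [N _ HN] := bc e e0; exists N => n Nn.
apply: le_trans (H n) _; have := HN n Nn; rewrite sub0r normrN; exact: le_trans (ler_norm _).
Qed.
Lemma ccvg_cst l : ccvg (fun=> l) l.
Proof. by move=> e e0; exists 0%N => n _; rewrite subrr nc0 ltW. Qed.
Lemma ccvgD u v l m : ccvg u l -> ccvg v m -> ccvg (fun n => u n + v n) (l + m).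
Proof.
move=> H1 H2 e e0; have e2 : 0 < e / 2 by rewrite divr_gt0.
have [N1 h1] := H1 _ e2; have [N2 h2] := H2 _ e2; exists (maxn N1 N2) => n.
rewrite geq_max => /andP[n1 n2]; rewrite opprD addrACA (splitr e).
by apply: le_trans (normc_triangle _ _) _; rewrite lerD ?h1 ?h2.
Qed.
Lemma ccvgZ u l (c : C) : ccvg u l -> ccvg (fun n => c * u n) (c * l).
Proof.
move=> H e e0; have c0 : 0 < normc c + 1 by rewrite ltr_wpDl ?normc_ge0.
have [N h] := H _ (divr_gt0 e0 c0); exists N => n /h {}h; rewrite -mulrBr ncM.
apply: (@le_trans _ _ ((normc c + 1) * (e / (normc c + 1)))).
  by apply: ler_pM; rewrite ?normc_ge0 ?lerDl.
by rewrite mulrC divfK// gt_eqF.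
Qed.
Lemma ccvgB u v l m : ccvg u l -> ccvg v m -> ccvg (fun n => u n - v n) (l - m).
Proof.
move=> H1 /(@ccvgZ _ _ (-1)) H2; have := ccvgD H1 H2; rewrite mulN1r.
by congr ccvg; apply/funext => n; rewrite mulN1r.
Qed.
Lemma eq_ccvg u v l : (forall n, u n = v n) -> ccvg u l -> ccvg v l.
Proof. by move=> /funext ->. Qed.
Lemma ccvg_bound u l (b : R) : (exists N, forall n, (N <= n)%N -> normc (u n) <= b) ->
  ccvg u l -> normc l <= b.
Proof.
move=> [N0 H0] H; apply/ler_addgt0Pl => e e0; have [N HN] := H e e0.
have := HN (maxn N0 N) (leq_maxr _ _); have := H0 (maxn N0 N) (leq_maxl _ _).
rewrite ncB => h1 h2; have := normc_triangle (l - u (maxn N0 N)) (u (maxn N0 N)).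
rewrite subrK => h3; apply: le_trans h3 _; exact: lerD.
Qed.
Lemma ccvg_uniq u l m : ccvg u l -> ccvg u m -> l = m.
Proof.
move=> H1 H2; apply/eqP; rewrite -subr_eq0 -nc_eq0; apply/eqP/le_anti.
rewrite normc_ge0 andbT; apply: (ccvg_bound _ (ccvgB H1 H2)); exists 0%N => n _.
by rewrite subrr nc0.
Qed.
Lemma ccvg_shift u l k : ccvg (fun n => u (n + k)%N) l -> ccvg u l.
Proof.
move=> H e e0; have [N HN] := H e e0; exists (N + k)%N => n Nn.
have := HN (n - k)%N; rewrite subnK; last by lia.
by apply; lia.
Qed.

Definition csum u l := ccvg (fun n => \sum_(i < n) u i) l.

Lemma csum_norm_le u l (B : R) : (forall n, \sum_(i < n) normc (u i) <= B) ->
  csum u l -> normc l <= B.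
Proof.
move=> H; apply: ccvg_bound; exists 0%N => n _; exact: le_trans (nc_sum _ _ _) (H n).
Qed.

Lemma real_nondec_cvg (s : nat -> R) (B : R) : (forall n, s n <= s n.+1) ->
  (forall n, s n <= B) -> exists2 l : R, s @ \oo --> l & forall n, s n <= l.
Proof.
move=> ns bs; have nd : nondecreasing_seq s by apply/nondecreasing_seqP.
have cs : cvgn s by apply: nondecreasing_is_cvgn => //; exists B => _ [n _ <-].
by exists (limn s) => // n; exact: nondecreasing_cvgn_le.
Qed.

Lemma abs_csum u (B : R) : (forall n, \sum_(i < n) normc (u i) <= B) -> exists l, csum u l.
Proof.
move=> H.
have part (p : C -> R) : (forall z w, p (z + w) = p z + p w) -> p 0 = 0 ->
    (forall z, `|p z| <= normc z) ->
    exists l : R, (fun n => p (\sum_(i < n) u i)) @ \oo --> l.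
  move=> pD p0 pl.
  have := @normed_cvg R R^o (fun i => p (u i)).
  have h1 : cvgn (series (fun i => `|p (u i)|)).
    apply: nondecreasing_is_cvgn.
      by apply/nondecreasing_seqP => n; rewrite !seriesEord/= big_ord_recr lerDl.
    exists B => _ [n _ <-]; apply: le_trans (H n); rewrite seriesEord.
    by apply: ler_sum => i _; exact: pl.
  move=> /(_ h1) /cvg_ex[l Hl]; exists l; move: Hl.
  suff -> : (fun n => p (\sum_(i < n) u i)) = series (fun i => p (u i)) by [].
  apply/funext => n; rewrite seriesEord.
  rewrite /=; elim: n => [|n IH]; first by rewrite !big_ord0.
  by rewrite !big_ord_recr/= pD IH.
have [a Ha] := part _ (@ReD R) erefl (@Re_le_normc R).
have [b Hb] := part _ (@ImD R) erefl (@Im_le_normc R).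
exists (a +i* b).
apply: (@ccvg_le _ _ (fun n => `|complex.Re (\sum_(i < n) u i) - a| +
    `|complex.Im (\sum_(i < n) u i) - b|)).
  by move=> n; apply: le_trans (nc_ReIm _) _; rewrite ReB ImB.
rewrite -[X in _ --> X]addr0; apply: cvgD.
  have -> : (0 : R) = `|a - a| by rewrite subrr normr0.
  by apply: cvg_norm; apply: cvgB => //; exact: cvg_cst.
have -> : (0 : R) = `|b - b| by rewrite subrr normr0.
by apply: cvg_norm; apply: cvgB => //; exact: cvg_cst.
Qed.

Lemma geo_sum_le (q : R) n : 0 <= q < 1 -> \sum_(i < n) q ^+ i <= (1 - q)^-1.
Proof.
move=> /andP[q0 q1]; have p : 0 < 1 - q by rewrite subr_gt0.
rewrite -(ler_pM2l p) mulfV ?gt_eqF// -opprB mulNr -subrX1 opprB lerBlDr lerDl.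
exact: exprn_ge0.
Qed.

Lemma geo_cvg0 (q c : R) : 0 <= q < 1 -> (fun n => c * q ^+ n) @ \oo --> (0 : R).
Proof.
move=> /andP[q0 q1]; rewrite -(mulr0 c); apply: cvgMr; apply: cvg_expr.
by rewrite ger0_norm.
Qed.

End ComplexSequences.

(** * Taylor expansion with coefficient bounds *)

Section Taylor.
Variable R : realType.
Local Notation C := R[i].
Implicit Types (f h : C -> C) (z w : C) (r t : R).

Let div2K (e t : R) : 0 < t -> 2 * (e / (2 * t)) * t = e.
Proof. by move=> t0; field; rewrite gt_eqF. Qed.

Let geoE (r u v t : R) n : r != 0 -> v ^+ n.+1 * (2 * ((r ^+ n.+1)^-1 * (r * u)) * t) =
  t * (2 * (r * u) * (v / r) * (v / r) ^+ n).
Proof. by move=> r0; rewrite expr_div_n !exprS; field; rewrite r0 expf_neq0. Qed.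

Lemma cdiffX n z : cdiff (fun w : C => w ^+ n) z (n%:R * z ^+ n.-1).
Proof.
elim: n => [|n IH]; first by rewrite mul0r; exact: cdiff_cst.
have := cdiffM (cdiff_id z) IH.
have -> : 1 * z ^+ n + z * (n%:R * z ^+ n.-1) = n.+1%:R * z ^+ n.+1.-1.
  by case: n {IH} => [|n]; rewrite ?mul0r ?mulr0 ?addr0//= exprS -[n.+2]addn1 natrD; ring.
by have -> : (fun w : C => w * w ^+ n) = (fun w => w ^+ n.+1) by apply/funext => w; rewrite exprS.
Qed.

(** The mean does not depend on the radius, yet scales like [r^-(n+1)]; hence it is 0. *)
Lemma cmean_expN r n : 0 < r < 1 -> cmean (fun z => (z ^+ n.+1)^-1) r = 0.
Proof.
move=> rr.
have d z : z != 0 -> exists A, cdiff (fun z : C => (z ^+ n.+1)^-1) z A.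
  move=> z0; have zn : z ^+ n.+1 != 0 by rewrite expf_neq0.
  have [A HA] : exists A, cdiff (fun z : C => z ^+ n.+1) z A.
    by exists (n.+1%:R * z ^+ n); exact: cdiffX.
  by eexists; exact: (@cdiffV _ (fun w => w ^+ n.+1) z A zn HA).
have H : forall r1 r2, 0 < r1 < 1 -> 0 < r2 < 1 ->
   cmean (fun z : C => (z ^+ n.+1)^-1) r1 = cmean (fun z => (z ^+ n.+1)^-1) r2.
  apply: (@cmean_const _ _ 0).
    by move=> z /andP[z0 _] _; apply: d; rewrite -nc_gt0.
  move=> z /andP[z0 _]; have [|A] := d z; first by rewrite -nc_gt0.
  exact: cdiff_ccontC.
pose X := cint (fun t => (expi t ^+ n.+1)^-1) 0 (pi *+ 2) : C.
have E r' : 0 < r' -> cmean (fun z => (z ^+ n.+1)^-1) r' = (r'%:C ^+ n.+1)^-1 * X.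
  move=> r'0; rewrite /cmean /circ -cintZ.
    by apply: cint_eq => t _ _; rewrite exprMn invfM.
  move=> t _ _; have := @circ_ccont _ (fun z : C => (z ^+ n.+1)^-1) 1 t.
  have -> : circ (fun z : C => (z ^+ n.+1)^-1) 1 = (fun t => (expi t ^+ n.+1)^-1).
    by apply/funext => s; rewrite /circ mul1r.
  apply; rewrite mul1r; have [A HA] := d _ (expi_neq0 t); exact: cdiff_ccontC HA.
have h1 : 0 < (1 / 2 : R) < 1 by apply/andP; split; lra.
have h2 : 0 < (1 / 4 : R) < 1 by apply/andP; split; lra.
have /andP[h1' _] := h1; have /andP[h2' _] := h2.
have := H _ _ h1 h2; rewrite (E _ h1') (E _ h2').
move=> /eqP; rewrite -subr_eq0 -mulrBl mulf_eq0 => /orP[|/eqP X0].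
  rewrite subr_eq0 (inj_eq invr_inj) => /eqP/(congr1 (@Normc.normc R)).
  rewrite !ncX !nc_real !ger0_norm ?divr_ge0// => /eqP.
  have q : (1 / 4 : R) < 1 / 2 by lra.
  by rewrite eqrXn2// ?divr_ge0// (gt_eqF q).
by have /andP[r0 _] := rr; rewrite E// X0 mulr0.
Qed.

(** The difference quotient at [w]; the value [A], meant to be the derivative, fills the removable
    singularity. *)
Definition difq f w A z := if z == w then A else (f z - f w) / (z - w).

Lemma difq_cont f w A : cdiff f w A -> ccontC (difq f w A) w.
Proof.
move=> H e e0; have [d d0 Hd] := H e e0; exists d => // z zd.
rewrite /difq eqxx; case: eqVneq => [_|zw]; first by rewrite subrr nc0 ltW.
have p : 0 < normc (z - w) by rewrite nc_gt0 subr_eq0.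
rewrite -(ler_pM2r p) -ncM mulrBl divfK ?subr_eq0//; exact: Hd.
Qed.

Lemma difq_diff f w A z B : z != w -> cdiff f z B -> exists B', cdiff (difq f w A) z B'.
Proof.
move=> zw H; have zw0 : z - w != 0 by rewrite subr_eq0.
have d := cdiffM (cdiffB H (cdiff_cst (f w) z))
  (@cdiffV _ (fun v => v - w) z _ zw0 (cdiffB (cdiff_id z) (cdiff_cst w z))).
have p : 0 < normc (z - w) by rewrite nc_gt0.
eexists; apply: (cdiff_near p _ d).
by move=> v vz; rewrite /difq; case: eqVneq => // vw; move: vz; rewrite vw ncB ltxx.
Qed.

(** The function [h z = z (f z - f w) / (z - w)] has mean 0 on every circle, which is Cauchy's
    formula in disguise. Expanding [z / (z - w)] in powers of [w / z] turns this into the Taylor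
    series. *)
Theorem Taylor f : analytic f -> exists a : nat -> C,
  (forall r B n, 0 < r < 1 -> (forall z, normc z = r -> normc (f z) <= B) ->
      normc (a n) * r ^+ n <= 2 * B) /\
  (forall w, normc w < 1 -> csum (fun n => a n * w ^+ n) (f w)).
Proof.
move=> fa; have fd z : normc z < 1 -> cdiff f z (derive1 f z).
  by move=> z1; apply: cdiff_derive1; exact: fa.
have fc z : normc z < 1 -> ccontC f z by move=> /fd /cdiff_ccontC.
have invd (z : C) n : z != 0 -> exists A, cdiff (fun z => (z ^+ n)^-1) z A.
  move=> z0; have [A HA] : exists A, cdiff (fun z : C => z ^+ n) z A.
    by exists (n%:R * z ^+ n.-1); exact: cdiffX.
  have zn : z ^+ n != 0 by rewrite expf_neq0.
  by eexists; exact: (@cdiffV _ (fun w => w ^+ n) z A zn HA).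
have invc (z : C) n : z != 0 -> ccontC (fun z => (z ^+ n)^-1) z.
  by move=> /(invd _ n)[A]; exact: cdiff_ccontC.
pose tau : R := pi *+ 2.
have tau0 : 0 < tau by rewrite mulrn_wgt0// pi_gt0.
have tauC : (tau%:C : C) != 0 by rewrite -nc_eq0 nc_real normr_eq0 gt_eqF.
(* By [cmean_const] every radius in [(0, 1)] gives the same coefficient; [1 / 2] is one choice. *)
pose a n := cmean (fun z => f z * (z ^+ n)^-1) (1 / 2) / tau%:C.
have half : 0 < (1 / 2 : R) < 1 by apply/andP; split; lra.
have aE r n : 0 < r < 1 -> cmean (fun z => f z * (z ^+ n)^-1) r = a n * tau%:C.
  move=> rr.
  have -> : a n * tau%:C = cmean (fun z => f z * (z ^+ n)^-1) (1 / 2).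
    by rewrite /a -[LHS]mulrA (mulVf tauC) mulr1.
  refine (@cmean_const _ (fun z => f z * (z ^+ n)^-1) 0 _ _ _ _ rr half).
    move=> z /andP[z0 z1] _; rewrite nc_gt0 in z0; have [A HA] := invd z n z0.
    by eexists; exact: cdiffM (fd z z1) HA.
  move=> z /andP[z0 z1]; apply: ccontC_M; first exact: fc.
  by apply: invc; rewrite -nc_gt0.
exists a; split.
  move=> r B n rr fB; have /andP[r0 r1] := rr.
  have rn : 0 < r ^+ n by rewrite exprn_gt0.
  rewrite -(ler_pM2r tau0) mulrAC.
  have -> : normc (a n) * tau = normc (a n * tau%:C) by rewrite ncM nc_real ger0_norm// ltW.
  rewrite -ler_pdivlMr// -(aE r)//.
  have -> : 2 * B * tau / r ^+ n = 2 * (B / r ^+ n) * tau by field; rewrite gt_eqF.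
  apply: cmean_bound.
    move=> z zr; rewrite gtr0_norm// in zr; apply: ccontC_M; first by apply: fc; rewrite zr.
    by apply: invc; rewrite -nc_gt0 zr.
  move=> z zr; rewrite gtr0_norm// in zr; rewrite ncM ncV ncX zr ler_pM2r ?invr_gt0//.
  exact: fB.
move=> w w1; pose A := derive1 f w; pose q := difq f w A; pose h z := z * q z.
have qc z : normc z < 1 -> ccontC q z.
  move=> z1; have [->|zw] := eqVneq z w; first by apply: difq_cont; exact: fd.
  by have [B] := difq_diff A zw (fd z z1); exact: cdiff_ccontC.
have hc z : normc z < 1 -> ccontC h z.
  by move=> z1; apply: ccontC_M; [exact: cdiff_ccontC (cdiff_id z)|exact: qc].
have hE r1 r2 : 0 < r1 < 1 -> 0 < r2 < 1 -> cmean h r1 = cmean h r2.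
  apply: (@cmean_const _ _ (normc w)).
    move=> z /andP[z0 z1] zw; have zw' : z != w by apply: contraNneq zw => ->.
    have [B HB] := difq_diff A zw' (fd z z1).
    by eexists; exact: cdiffM (cdiff_id z) HB.
  by move=> z /andP[_ z1]; exact: hc.
(* The mean is independent of the radius, and it is small on small circles because [h] is continuous
   with [h 0 = 0]. *)
have h0 r : 0 < r < 1 -> cmean h r = 0.
  move=> rr; apply/eqP; rewrite -nc_eq0; apply/eqP/le_anti; rewrite normc_ge0 andbT.
  apply/ler_addgt0Pl => e e0; rewrite addr0.
  have e1 : 0 < e / (2 * tau) by rewrite divr_gt0// mulr_gt0.
  have [|d d0 Hd] := hc 0 _ _ e1; first by rewrite nc0.
  pose r' := Num.min (d / 2) (1 / 2).
  have r'0 : 0 < r' by rewrite lt_min !divr_gt0.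
  have r'1 : r' <= 1 / 2 by rewrite ge_min lexx orbT.
  have r'd : r' <= d / 2 by rewrite ge_min lexx.
  clearbody r'.
  rewrite (hE r r')//; last by apply/andP; split; lra.
  rewrite -(div2K e tau0).
  apply: cmean_bound => z zr; rewrite gtr0_norm// in zr; first by apply: hc; rewrite zr; lra.
  have h00 : h 0 = 0 by rewrite /h mul0r.
  by have := Hd z; rewrite subr0 zr h00 subr0; apply; lra.
pose r := (1 + normc w) / 2.
have w0 := normc_ge0 w.
have wr : normc w < r by rewrite /r; lra.
have r0 : 0 < r by rewrite /r; lra.
have r1 : r < 1 by rewrite /r; lra.
clearbody r; have rr : 0 < r < 1 by rewrite r0.
have [M0 HM0] := analytic_bounded fa r1.
pose M := M0 + normc (f w).
have zpos z : normc z = `|r| -> [/\ normc z < 1, z != 0 & z != w].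
  rewrite gtr0_norm// => zr; split; first by rewrite zr.
    by rewrite -nc_gt0 zr.
  by apply: contraTneq wr => <-; rewrite zr ltxx.
(* Each step uses [z^-N h = z^-N (f - f w) + w z^-(N+1) h]; the mean of [z^-N] survives only for
   [N = 0]. *)
have key N : 0 = \sum_(n < N) w ^+ n * (a n * tau%:C - f w * (if n == 0%N :> nat then tau%:C else 0))
    + w ^+ N * cmean (fun z => (z ^+ N)^-1 * h z) r.
  elim: N => [|N IH].
    rewrite big_ord0 add0r expr0 mul1r -(h0 r rr); apply: eq_cmean => z _.
    by rewrite expr0 invr1 mul1r.
  rewrite big_ord_recr/= {1}IH -!addrA; congr (_ + _).
  have -> : cmean (fun z => (z ^+ N)^-1 * h z) r =
     cmean (fun z => f z * (z ^+ N)^-1 + (- f w) * (z ^+ N)^-1 + w * ((z ^+ N.+1)^-1 * h z)) r.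
    apply: eq_cmean => z /zpos[z1 z0 zw].
    rewrite /h /q /difq (negbTE zw) exprS; field.
    by rewrite subr_eq0 zw expf_neq0.
  have c1 z : normc z = `|r| -> ccontC (fun z => f z * (z ^+ N)^-1) z.
    by move=> /zpos[z1 z0 _]; apply: ccontC_M; [exact: fc|exact: invc].
  have c2 z : normc z = `|r| -> ccontC (fun z => (z ^+ N)^-1) z.
    by move=> /zpos[z1 z0 _]; exact: invc.
  have c3 z : normc z = `|r| -> ccontC (fun z => (z ^+ N.+1)^-1 * h z) z.
    by move=> /zpos[z1 z0 _]; apply: ccontC_M; [exact: invc|exact: hc].
  rewrite cmeanD; first last.
  - by move=> z zr; apply: ccontC_M; [exact: ccontC_cst|exact: c3].
  - move=> z zr; apply: ccontC_D; first exact: c1.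
    by apply: ccontC_M; [exact: ccontC_cst|exact: c2].
  rewrite cmeanD//; last by move=> z zr; apply: ccontC_M; [exact: ccontC_cst|exact: c2].
  rewrite !cmeanZ// aE//.
  have -> : cmean (fun z : C => (z ^+ N)^-1) r = if N == 0%N then tau%:C else 0.
    case: N {IH c1 c2 c3} => [|N]; last exact: cmean_expN.
    by rewrite -[RHS]mul1r -(cmean_cst _ r); apply: eq_cmean => z _; rewrite expr0 invr1.
  rewrite [w ^+ N.+1]exprS; set X := cmean _ _; set Y := (if _ then _ else _).
  by clearbody X Y; move: (a N * _) => u; ring.
pose K := 2 * (r * (M / (r - normc w))).
have rw : 0 < r - normc w by rewrite subr_gt0.
have hM z : normc z = `|r| -> normc (h z) <= r * (M / (r - normc w)).
  move=> zr; have [z1 z0 zw] := zpos z zr; rewrite gtr0_norm// in zr.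
  rewrite /h /q /difq (negbTE zw) !ncM ncV zr ler_pM2l//; apply: ler_pM.
  - exact: normc_ge0.
  - by rewrite invr_ge0 normc_ge0.
  - by apply: le_trans (nc_sub _ _) _; rewrite lerD2r; apply: HM0; rewrite zr.
  - rewrite lef_pV2 ?posrE// ?nc_gt0 ?subr_eq0//.
    by apply: le_trans (nc_ge _ _); rewrite zr.
have q1 : 0 <= normc w / r < 1 by rewrite divr_ge0 ?(ltW r0)//= ltr_pdivrMr// mul1r.
(* With the shift, the term of index 0, the only one involving [f w], can be split off. *)
apply: (@ccvg_shift _ _ _ 1).
apply: (ccvg_le _ (geo_cvg0 (K * (normc w / r)) q1)) => n; rewrite addn1.
have := key n.+1.
have -> : \sum_(i < n.+1) w ^+ i * (a i * tau%:C - f w * (if i == 0%N :> nat then tau%:C else 0)) =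
   tau%:C * (\sum_(i < n.+1) a i * w ^+ i - f w).
  rewrite mulrBr mulr_sumr !big_ord_recl /= !expr0 mul1r mulr1.
  have -> : \sum_(i < n) w ^+ bump 0 i * (a (bump 0 i) * tau%:C - f w * 0) =
     \sum_(i < n) tau%:C * (a (bump 0 i) * w ^+ bump 0 i).
    by apply: eq_bigr => i _; ring.
  by ring.
set D := \sum_(i < n.+1) _ - f w => /esym/eqP; rewrite addr_eq0 => /eqP HD.
have : normc (tau%:C * D) <= normc w ^+ n.+1 * (2 * ((r ^+ n.+1)^-1 * (r * (M / (r - normc w)))) * tau).
  rewrite HD ncN ncM ncX ler_wpM2l ?exprn_ge0//; apply: cmean_bound.
    by move=> z /zpos[z1 z0 _]; apply: ccontC_M; [exact: invc|exact: hc].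
  move=> z zr; rewrite ncM ncV ncX zr gtr0_norm// ler_pM2l ?invr_gt0 ?exprn_gt0//.
  exact: hM.
rewrite ncM nc_real (gtr0_norm tau0) => HH; rewrite -(ler_pM2l tau0).
by apply: le_trans HH _; rewrite /K geoE// gt_eqF.
Qed.
End Taylor.

(** * Calculus with power series, Cauchy estimates and the line integral *)

Section PowerSeries.
Variable R : realType.
Local Notation C := R[i].
Implicit Types (a : nat -> C) (f h : C -> C) (z w : C) (r : R).

(** This says that the radius of convergence is at least 1. *)
Definition tame a := forall r, 0 < r < 1 -> exists B : R, forall n, normc (a n) * r ^+ n <= B.

Lemma csum_lin u v (l m c : C) : csum u l -> csum v m ->
  csum (fun n => u n + c * v n) (l + c * m).
Proof.
move=> Hu /(@ccvgZ _ _ _ c) Hv; apply: eq_ccvg (ccvgD Hu Hv) => n.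
by rewrite big_split/= mulr_sumr.
Qed.

Lemma csum_shift u (l : C) : u 0%N = 0 -> csum (fun n => u n.+1) l -> csum u l.
Proof.
move=> u0 H; apply: (@ccvg_shift _ _ _ 1); apply: eq_ccvg H => n.
by rewrite addn1 big_ord_recl u0 add0r.
Qed.

Lemma geo_sum1 (q : R) n : (1 - q) * \sum_(i < n) (i.+1%:R * q ^+ i) = 
  \sum_(i < n) q ^+ i - n%:R * q ^+ n.
Proof.
elim: n => [|n IH]; first by rewrite !big_ord0 mul0r subr0 mulr0.
rewrite !big_ord_recr/= mulrDr IH exprS -natr1; ring.
Qed.
Lemma geo_sum1_le (q : R) n : 0 <= q < 1 ->
  \sum_(i < n) (i.+1%:R * q ^+ i) <= (1 - q) ^- 2.
Proof.
move=> qq; have /andP[q0 q1] := qq; have p : 0 < 1 - q by rewrite subr_gt0.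
rewrite -(ler_pM2l p) geo_sum1 expr2 invfM mulrA mulfV ?gt_eqF// mul1r.
apply: le_trans (geo_sum_le n qq); rewrite lerBlDr lerDl mulr_ge0// exprn_ge0//.
Qed.
Lemma geo_sum2 (q : R) n : (1 - q) * \sum_(i < n) (i.+1%:R * i.+2%:R * q ^+ i) = 
  2 * \sum_(i < n) (i.+1%:R * q ^+ i) - n%:R * n.+1%:R * q ^+ n.
Proof.
elim: n => [|n IH]; first by rewrite !big_ord0 !mul0r subr0 !mulr0.
rewrite !big_ord_recr/= mulrDr IH exprS -[n.+2]addn2 -[n.+1]addn1 !natrD; ring.
Qed.
Lemma geo_sum2_le (q : R) n : 0 <= q < 1 ->
  \sum_(i < n) (i.+1%:R * i.+2%:R * q ^+ i) <= 2 * (1 - q) ^- 3.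
Proof.
move=> qq; have /andP[q0 q1] := qq; have p : 0 < 1 - q by rewrite subr_gt0.
rewrite -(ler_pM2l p) geo_sum2.
have -> : (1 - q) * (2 * (1 - q) ^- 3) = 2 * (1 - q) ^- 2 by field; rewrite gt_eqF.
apply: (@le_trans _ _ (2 * \sum_(i < n) (i.+1%:R * q ^+ i))).
  by rewrite lerBlDr lerDl !mulr_ge0// exprn_ge0.
by rewrite ler_pM2l//; exact: geo_sum1_le.
Qed.

Lemma tame_coef a r : tame a -> 0 <= r < 1 ->
  exists B q : R, [/\ 0 <= B, 0 <= q < 1 & forall n, normc (a n) * r ^+ n <= B * q ^+ n].
Proof.
move=> ta /andP[r0 r1]; pose s := (1 + r) / 2.
have s1 : s < 1 by rewrite /s; lra.
have s0 : 0 < s by rewrite /s; lra.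
have [|B HB] := ta s; first by rewrite s0.
exists B, (r / s); split.
- by apply: le_trans (HB 0%N); rewrite mulr1 normc_ge0.
- by rewrite divr_ge0 ?(ltW s0)//= ltr_pdivrMr// mul1r /s; lra.
- move=> n; rewrite expr_div_n; have sn : 0 < s ^+ n by rewrite exprn_gt0.
  rewrite mulrA ler_pdivlMr// mulrAC ler_wpM2r ?exprn_ge0//; exact: HB.
Qed.

(** Second-order remainder of a power, by induction on multiplication by [w]. Writing [r ^+ n / r]
    avoids the truncated exponent [n - 1]. *)
Lemma expn_err (z w : C) r n : 0 < r -> normc z <= r -> normc w <= r ->
  normc (w ^+ n.+1 - z ^+ n.+1 - n.+1%:R * z ^+ n * (w - z)) <=
  n.+1%:R ^+ 2 * r ^+ n / r * normc (w - z) ^+ 2.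
Proof.
move=> r0 zr wr; set h := normc (w - z).
have h0 : 0 <= h ^+ 2 by rewrite exprn_ge0// normc_ge0.
elim: n => [|n IH].
  rewrite !expr1 expr0 mulr1 mul1r subrr nc0; apply: mulr_ge0 => //.
  by rewrite expr1n expr0 mulr1 divr_ge0// ltW.
have -> : w ^+ n.+2 - z ^+ n.+2 - n.+2%:R * z ^+ n.+1 * (w - z) =
   w * (w ^+ n.+1 - z ^+ n.+1 - n.+1%:R * z ^+ n * (w - z)) + n.+1%:R * z ^+ n * (w - z) ^+ 2.
  by rewrite -[n.+2%:R]natr1 (exprS w n.+1) (exprS z n.+1) (exprS z n); ring.
apply: le_trans (normc_triangle _ _) _.
have -> : n.+2%:R ^+ 2 * r ^+ n.+1 / r * h ^+ 2 =
   r * (n.+1%:R ^+ 2 * r ^+ n / r * h ^+ 2) + (n.+1%:R + n.+2%:R) * r ^+ n * h ^+ 2.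
  have e1 : n.+2%:R = n.+1%:R + 1 :> R by rewrite natr1.
  by rewrite e1 (exprS r n); field; rewrite gt_eqF.
apply: lerD; first by rewrite ncM; apply: ler_pM; rewrite ?normc_ge0.
rewrite ncM ncX -/h ler_wpM2r// ncM nc_natr ncX.
apply: ler_pM; rewrite ?ler0n ?exprn_ge0 ?normc_ge0//; first by rewrite lerDl.
by apply: lerXn2r => //; rewrite nnegrE ?normc_ge0// ltW.
Qed.

Lemma tame_deriv a : tame a -> tame (fun n => n.+1%:R * a n.+1).
Proof.
move=> ta r /andP[r0 r1].
have [|B [q [B0 /andP[q0 q1] H]]] := tame_coef ta (r := r); first by rewrite (ltW r0).
exists (B / r * (1 - q) ^- 2) => n.
have h1 : n.+1%:R * q ^+ n <= (1 - q) ^- 2.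
  have qq : 0 <= q < 1 by rewrite q0.
  apply: le_trans (geo_sum1_le n.+1 qq); rewrite big_ord_recr/= lerDr.
  by apply: sumr_ge0 => i _; rewrite mulr_ge0// exprn_ge0.
rewrite ncM nc_natr.
have -> : n.+1%:R * normc (a n.+1) * r ^+ n = n.+1%:R * (normc (a n.+1) * r ^+ n.+1) / r.
  by rewrite exprS; field; rewrite gt_eqF.
apply: (@le_trans _ _ (n.+1%:R * (B * q ^+ n.+1) / r)).
  by rewrite ler_wpM2r ?invr_ge0 ?(ltW r0)// ler_wpM2l.
have -> : n.+1%:R * (B * q ^+ n.+1) / r = B / r * (q * (n.+1%:R * q ^+ n)).
  by rewrite exprS; ring.
rewrite ler_wpM2l ?divr_ge0 ?(ltW r0)//; apply: le_trans h1.
by rewrite ler_piMl ?(ltW q1)// mulr_ge0// exprn_ge0.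
Qed.

Lemma tame_csum a : tame a -> exists f : C -> C, forall z, normc z < 1 ->
  csum (fun n => a n * z ^+ n) (f z).
Proof.
move=> ta; suff : forall z, exists l, normc z < 1 -> csum (fun n => a n * z ^+ n) l.
  by move=> /choice[f Hf]; exists f.
move=> z; have [z1|z1] := pselect (normc z < 1); last by exists 0.
have [|B [q [B0 qq H]]] := tame_coef ta (r := normc z); first by rewrite normc_ge0.
have [l Hl] : exists l, csum (fun n => a n * z ^+ n) l.
  apply: (@abs_csum _ _ (B * (1 - q)^-1)) => n.
  apply: (@le_trans _ _ (\sum_(i < n) B * q ^+ i)).
    by apply: ler_sum => i _; rewrite ncM ncX; exact: H.
  by rewrite -mulr_sumr ler_wpM2l// geo_sum_le.
by exists l.
Qed.

(** Termwise, the first-order remainder is at most a coefficient times [normc (w - z) ^+ 2], and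
    these coefficients are summable on a slightly larger disk. *)
Lemma pser_diff a f f1 : tame a ->
  (forall w, normc w < 1 -> csum (fun n => a n * w ^+ n) (f w)) ->
  (forall w, normc w < 1 -> csum (fun n => n.+1%:R * a n.+1 * w ^+ n) (f1 w)) ->
  forall z, normc z < 1 -> cdiff f z (f1 z).
Proof.
move=> ta Hf Hf1 z z1; pose r := (1 + normc z) / 2.
have z0 := normc_ge0 z.
have zr : normc z < r by rewrite /r; lra.
have r1 : r < 1 by rewrite /r; lra.
have r0 : 0 < r by rewrite /r; lra.
have [|B [q [B0 qq H]]] := tame_coef ta (r := r); first by rewrite (ltW r0).
have /andP[q0 q1] := qq.
pose K := B * 2 * (1 - q) ^- 3 / r ^+ 2.
have p : 0 < 1 - q by rewrite subr_gt0.
have K0 : 0 <= K by rewrite /K !mulr_ge0 ?invr_ge0 ?exprn_ge0 ?(ltW r0) ?(ltW p).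
have main w : normc w <= r -> normc (f w - f z - f1 z * (w - z)) <= K * normc (w - z) ^+ 2.
  move=> wr; have w1 := le_lt_trans wr r1.
  (* The differentiated series is moved up by one index, so that it aligns with the original one. *)
  pose u n := a n * w ^+ n - a n * z ^+ n -
    (if n is m.+1 then n%:R * a n * z ^+ m else 0) * (w - z).
  have Hu : csum u (f w - f z - f1 z * (w - z)).
    have s1 := csum_lin (-1) (Hf w w1) (Hf z z1).
    have s2 : csum (fun n => if n is m.+1 then n%:R * a n * z ^+ m else 0) (f1 z).
      by apply: csum_shift => //; exact: Hf1.
    have := csum_lin (- (w - z)) s1 s2.
    rewrite mulN1r mulNr [_ * f1 z]mulrC; congr csum; apply/funext => n.
    by rewrite /u mulN1r mulNr [(w - z) * _]mulrC.
  apply: csum_norm_le Hu => -[|n].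
    by rewrite big_ord0 mulr_ge0// exprn_ge0// normc_ge0.
  rewrite big_ord_recl /u /= !expr0 subrr mul0r subrr nc0 add0r.
  apply: (@le_trans _ _ (\sum_(i < n) B / r ^+ 2 * (i.+1%:R * i.+2%:R * q ^+ i) * normc (w - z) ^+ 2)).
    apply: ler_sum => i _; rewrite /bump /= add1n.
    have -> : a i.+1 * w ^+ i.+1 - a i.+1 * z ^+ i.+1 - i.+1%:R * a i.+1 * z ^+ i * (w - z) =
      a i.+1 * (w ^+ i.+1 - z ^+ i.+1 - i.+1%:R * z ^+ i * (w - z)) by ring.
    rewrite ncM.
    apply: (@le_trans _ _ (normc (a i.+1) * (i.+1%:R ^+ 2 * r ^+ i / r * normc (w - z) ^+ 2))).
      by rewrite ler_wpM2l ?normc_ge0// expn_err// ltW.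
    have -> : normc (a i.+1) * (i.+1%:R ^+ 2 * r ^+ i / r * normc (w - z) ^+ 2) =
       (normc (a i.+1) * r ^+ i.+1) * (i.+1%:R ^+ 2 / r ^+ 2) * normc (w - z) ^+ 2.
      by rewrite (exprS r i); field; rewrite gt_eqF.
    rewrite ler_wpM2r ?exprn_ge0 ?normc_ge0//.
    have -> : B / r ^+ 2 * (i.+1%:R * i.+2%:R * q ^+ i) = (B * q ^+ i) * (i.+1%:R * i.+2%:R / r ^+ 2) by ring.
    apply: ler_pM; rewrite ?mulr_ge0 ?divr_ge0 ?invr_ge0 ?exprn_ge0 ?normc_ge0 ?(ltW r0)//.
      apply: le_trans (H i.+1) _; rewrite ler_wpM2l// exprS ler_piMl ?exprn_ge0// ltW//.
    by rewrite ler_wpM2r ?invr_ge0 ?exprn_ge0 ?(ltW r0)// expr2 ler_wpM2l// ler_nat.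
  rewrite -mulr_suml -mulr_sumr ler_wpM2r ?exprn_ge0 ?normc_ge0//.
  have -> : K = B / r ^+ 2 * (2 * (1 - q) ^- 3) by rewrite /K; ring.
  by rewrite ler_wpM2l ?geo_sum2_le// divr_ge0// exprn_ge0// ltW.
move=> e e0; have K1 : 0 < K + 1 by rewrite ltr_wpDl.
exists (Num.min (r - normc z) (e / (K + 1))); first by rewrite lt_min subr_gt0 zr divr_gt0.
move=> w; rewrite lt_min => /andP[wr we].
have wr' : normc w <= r.
  have := normc_triangle (w - z) z; rewrite subrK => /le_trans; apply.
  by rewrite -lerBrDr ltW.
apply: le_trans (main w wr') _; rewrite expr2 mulrA ler_wpM2r ?normc_ge0//.
rewrite ltr_pdivlMr// in we; apply: le_trans (ltW we).
by rewrite mulrC ler_wpM2l ?normc_ge0// lerDl.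
Qed.

Lemma Taylor_tame f : analytic f -> exists2 a, tame a &
  forall w, normc w < 1 -> csum (fun n => a n * w ^+ n) (f w).
Proof.
move=> fa; have [a [H1 H2]] := Taylor fa; exists a => // r rr.
have /andP[_ r1] := rr; have [M HM] := analytic_bounded fa r1.
by exists (2 * M) => n; apply: H1 => // z zr; apply: HM; rewrite zr.
Qed.

Lemma analytic_cdiff f z : analytic f -> normc z < 1 -> cdiff f z (derive1 f z).
Proof. by move=> fa z1; apply: cdiff_derive1; exact: fa. Qed.

Lemma cdiff_uniq f z (A B : C) : cdiff f z A -> cdiff f z B -> A = B.
Proof. by move=> /cdiff_derivable[_ <-] /cdiff_derivable[_ <-]. Qed.

(** The derivative is itself the sum of a tame series, to which [pser_diff] applies again. *)
Lemma analytic_derive1 f : analytic f -> analytic (derive1 f).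
Proof.
move=> fa; have [a ta Ha] := Taylor_tame fa.
have tb := tame_deriv ta; have [f1 Hf1] := tame_csum tb.
have [f2 Hf2] := tame_csum (tame_deriv tb).
have d1 := pser_diff ta Ha Hf1; have d2 := pser_diff tb Hf1 Hf2.
move=> z z1; apply: (proj1 (cdiff_derivable (A := f2 z) _)).
have p : 0 < 1 - normc z by rewrite subr_gt0.
apply: (cdiff_near p _ (d2 z z1)) => w wz.
have w1 : normc w < 1.
  by have := normc_triangle (w - z) z; rewrite subrK => /le_lt_trans; apply; rewrite -ltrBrDr.
by apply: cdiff_uniq (d1 w w1) _; exact: analytic_cdiff.
Qed.

Lemma analytic_primitive h : analytic h -> exists H : C -> C, forall z, normc z < 1 -> cdiff H z (h z).
Proof.
move=> ha; have [a ta Ha] := Taylor_tame ha.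
pose b n := if n is m.+1 then a m / n%:R else 0.
have tb : tame b.
  move=> r rr; have [B HB] := ta r rr; have /andP[r0 r1] := rr.
  exists B => -[|n]; first by rewrite nc0 mul0r; apply: le_trans (HB 0%N); rewrite mulr1 normc_ge0.
  apply: le_trans (HB n); rewrite /b ncM ncV nc_natr exprS.
  have -> : normc (a n) / n.+1%:R * (r * r ^+ n) = normc (a n) * r ^+ n * (r / n.+1%:R) by ring.
  rewrite ler_piMr ?mulr_ge0 ?normc_ge0 ?exprn_ge0 ?(ltW r0)// ler_pdivrMr// mul1r.
  by apply: le_trans (ltW r1) _; rewrite ler1n.
have [H HH] := tame_csum tb; exists H; apply: (pser_diff tb HH) => w w1.
have := Ha w w1; congr csum; apply/funext => n; congr (_ * _).
by rewrite /b mulrC divfK// pnatr_eq0.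
Qed.

(** On the circle of radius [3 / 4] the coefficients are at most [2 B]. With [q = |v| / r <= 1 / 3]
    the series without its constant term is at most [2 B q (3 / 2) = 4 B |v|]. *)
Lemma lip0 f (B : R) v : analytic f -> (forall z, normc z < 1 -> normc (f z) <= B) ->
  normc v <= 1 / 4 -> normc (f v - f 0) <= 4 * B * normc v.
Proof.
move=> fa fB v4; have [a [H1 H2]] := Taylor fa.
have B0 : 0 <= B by apply: le_trans (fB 0 _); rewrite ?normc_ge0// nc0.
have [r r3] : exists r : R, r = 3 / 4 by eexists.
have r0 : 0 < r by rewrite r3; lra.
have r1 : r < 1 by rewrite r3; lra.
have Ha n : normc (a n) * r ^+ n <= 2 * B.
  by apply: H1; rewrite ?r0// => z zr; apply: fB; rewrite zr.
have v1 : normc v < 1 by lra.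
have z1 : normc (0 : C) < 1 by rewrite nc0.
have := csum_lin (-1) (H2 v v1) (H2 0 z1); rewrite mulN1r => Hs.
pose q := normc v / r.
have qq : 0 <= q < 1.
  by rewrite /q divr_ge0 ?normc_ge0 ?(ltW r0)//= ltr_pdivrMr// mul1r r3; lra.
apply: csum_norm_le Hs => -[|n]; first by rewrite big_ord0 mulr_ge0 ?normc_ge0// mulr_ge0.
rewrite big_ord_recl /= !expr0 mulN1r subrr nc0 add0r.
apply: (@le_trans _ _ (\sum_(i < n) 2 * B * q * q ^+ i)).
  apply: ler_sum => i _; rewrite /bump /= add1n expr0n /= !mulr0 addr0 ncM ncX.
  have -> : normc v ^+ i.+1 = r ^+ i.+1 * (q * q ^+ i).
    by rewrite -[q * _]exprS -exprMn /q mulrC divfK// gt_eqF.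
  rewrite mulrA -[leRHS]mulrA ler_wpM2r//.
  by have /andP[q0 _] := qq; rewrite mulr_ge0// exprn_ge0.
rewrite -mulr_sumr; have /andP[q0 q1] := qq.
have Bq0 : 0 <= 2 * B * q by apply: mulr_ge0 => //; exact: mulr_ge0.
apply: (@le_trans _ _ (2 * B * q * (1 - q)^-1)).
  by rewrite ler_wpM2l// geo_sum_le.
have q3 : q <= 1 / 3.
  by rewrite /q ler_pdivrMr// r3; lra.
have -> : 4 * B * normc v = 2 * B * q * (3 / 2) by rewrite /q r3; field.
rewrite ler_wpM2l//.
rewrite -[leRHS]invrK lef_pV2 ?posrE ?invr_gt0; lra.
Qed.

Lemma Schwarz_lip f z v (d B : R) : analytic f -> 0 < d -> normc z + d <= 1 ->
  (forall w, normc (w - z) < d -> normc (f w) <= B) ->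
  normc v <= d / 4 -> normc (f (z + v) - f z) <= 4 * B * normc v / d.
Proof.
move=> fa d0 zd fB vd; pose k w := f (z + d%:C * w).
have inb w : normc w < 1 -> normc (z + d%:C * w - z) < d.
  by move=> w1; rewrite addrC addKr ncM nc_real gtr0_norm// gtr_pMr.
have ind w : normc w < 1 -> disk (z + d%:C * w).
  move=> /inb wd; have := normc_triangle (z + d%:C * w - z) z; rewrite subrK => /le_lt_trans; apply.
  by apply: lt_le_trans zd; rewrite addrC ltrD2l.
have ka : analytic k.
  move=> w w1; have dw := cdiffD (cdiff_cst z w) (cdiffM (cdiff_cst d%:C w) (cdiff_id w)).
  by have [] := cdiff_derivable (cdiff_comp dw (analytic_cdiff fa (ind w w1))).
have dC : (d%:C : C) != 0 by rewrite -nc_eq0 nc_real normr_eq0 gt_eqF.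
have vd' : normc (v / d%:C) = normc v / d by rewrite ncM ncV nc_real gtr0_norm.
have := @lip0 k B (v / d%:C) ka _ _; rewrite vd' /k mulr0 addr0 [d%:C * _]mulrC divfK// mulrA.
apply; first by move=> w w1; apply: fB; exact: inb.
by rewrite ler_pdivrMr// mulrC mulrA mulr1.
Qed.

(** The Lipschitz bound passes to the limit of the difference quotients along small real
    increments. *)
Lemma Cauchy_est f z (d B : R) : analytic f -> 0 < d -> normc z + d <= 1 ->
  (forall w, normc (w - z) < d -> normc (f w) <= B) ->
  normc (derive1 f z) <= 4 * B / d.
Proof.
move=> fa d0 zd fB; have z1 : normc z < 1 by apply: lt_le_trans zd; rewrite ltrDl.
apply/ler_addgt0Pl => e e0; have [d1 d10 H] := analytic_cdiff fa z1 e0.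
pose t := Num.min (d / 4) (d1 / 2).
have t0 : 0 < t by rewrite lt_min !divr_gt0.
have td : t <= d / 4 by rewrite ge_min lexx.
have td1 : t < d1 by rewrite gt_min; apply/orP; right; lra.
have nt : normc (t%:C : C) = t by rewrite nc_real gtr0_norm.
have := H (z + t%:C); rewrite addrC addKr addrC nt => /(_ td1).
have := Schwarz_lip fa d0 zd fB (v := t%:C); rewrite nt => /(_ td) h1 h2.
rewrite -(ler_pM2r t0) -[in leLHS]nt -ncM.
have := nc_dist (derive1 f z * t%:C) 0 (f (z + t%:C) - f z).
rewrite subr0 => /le_trans; apply; rewrite subr0 ncB mulrDl lerD//.
  by rewrite addrC.
by apply: le_trans h1 _; rewrite mulrAC.
Qed.

(** The fundamental theorem along the segment from 0 to [z]: the factor [z] of [int_op] is the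
    derivative of its parametrisation. *)
Lemma int_op_primitive (g phi f H : C -> C) z :
  analytic f -> analytic g -> analytic phi -> self_map phi ->
  (forall w, normc w < 1 -> cdiff H w (f (phi w) * derive1 g w)) ->
  normc z < 1 -> int_op g phi f z = H z - H 0.
Proof.
move=> fa ga pa ps HH z1.
have g'a := analytic_derive1 ga.
have tz t : 0 <= t -> t <= 1 -> normc (t%:C * z) < 1.
  move=> t0 t1; rewrite ncM nc_real ger0_norm//; apply: le_lt_trans z1.
  by rewrite ler_piMl ?normc_ge0.
pose F t := f (phi (t%:C * z)) * derive1 g (t%:C * z).
have rline (k : C -> C) t A : cdiff k (t%:C * z) A -> rdiff (fun t => k (t%:C * z)) t (z * A).
  move=> Hk e e0; have z0 : 0 < normc z + 1 by rewrite ltr_wpDl ?normc_ge0.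
  have [d d0 Hd] := Hk _ (divr_gt0 e0 z0); exists (d / (normc z + 1)); first by rewrite divr_gt0.
  move=> s; rewrite ltr_pdivlMr// => sd.
  have sz : normc (s%:C * z - t%:C * z) <= `|s - t| * (normc z + 1).
    by rewrite -mulrBl -rmorphB ncM nc_real ler_wpM2l// lerDl.
  have := Hd (s%:C * z) (le_lt_trans sz sd).
  have -> : (s - t)%:C * (z * A) = A * (s%:C * z - t%:C * z) by rewrite rmorphB/=; ring.
  move/le_trans; apply; rewrite -[leRHS](_ : e / (normc z + 1) * (`|s - t| * (normc z + 1)) = _).
    by rewrite ler_wpM2l// divr_ge0 ?(ltW e0) ?(ltW z0).
  by field; rewrite gt_eqF.
have Fc : ccont_on F 0 1.
  move=> t t0 t1; have tz1 := tz t t0 t1.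
  have d1 := cdiff_comp (analytic_cdiff pa tz1) (analytic_cdiff fa (ps _ tz1)).
  have := rline _ _ _ (cdiffM d1 (analytic_cdiff g'a tz1)); exact: rdiff_cont.
have -> : int_op g phi f z = z * cint F 0 1 by [].
rewrite -cintZ// (@cint_FTC _ (fun t => H (t%:C * z)))//.
- by rewrite mul1r mul0r.
- by move=> t t0 t1; apply: rline; apply: HH; exact: tz.
- move=> t t0 t1; have tz1 := tz t t0 t1.
  have d1 := cdiff_comp (analytic_cdiff pa tz1) (analytic_cdiff fa (ps _ tz1)).
  have := rline _ _ _ (cdiffM (cdiff_cst z _) (cdiffM d1 (analytic_cdiff g'a tz1))); exact: rdiff_cont.
Qed.
End PowerSeries.

(** * Normal weights at dyadic radii *)

Section WeightLevels.
Variable R : realType.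
Local Notation C := R[i].
Implicit Types (nu mu : radial_weight R) (z w : C).

Definition qn n : R := 2^-1 ^+ n.
Definition rho n : R := 1 - qn n.

Lemma qn_gt0 n : 0 < qn n. Proof. by rewrite exprn_gt0. Qed.
Lemma qnS n : qn n = 2 * qn n.+1.
Proof. by rewrite /qn exprS mulrA mulfV ?mul1r. Qed.
Lemma qn0 : qn 0 = 1. Proof. by []. Qed.
Lemma qn_le n m : (n <= m)%N -> qn m <= qn n.
Proof. by move=> nm; apply: ler_wiXn2l => //; lra. Qed.
Lemma qn_le1 n : qn n <= 1. Proof. exact: (qn_le (leq0n n)). Qed.
Lemma qn_sub n m : (n <= m)%N -> qn m = qn (m - n) * qn n.
Proof. by move=> nm; rewrite -exprD subnK. Qed.
Lemma qn_inv n : qn n = (2 ^+ n)^-1. Proof. by rewrite /qn exprVn. Qed.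
Lemma rho_ge0 n : 0 <= rho n. Proof. by rewrite subr_ge0 qn_le1. Qed.
Lemma rho_lt1 n : rho n < 1. Proof. by rewrite ltrBlDr ltrDl qn_gt0. Qed.
Lemma rho_le n m : (n <= m)%N -> rho n <= rho m.
Proof. by move=> nm; rewrite lerD2l lerN2 qn_le. Qed.
Lemma nc_rho n : normc ((rho n)%:C : C) = rho n.
Proof. by rewrite nc_real ger0_norm// rho_ge0. Qed.
Lemma disk_rho n : disk ((rho n)%:C : C).
Proof. by rewrite /disk /= nc_rho rho_lt1. Qed.

(** The least index reaching inside [z] picks out its dyadic annulus, the scale at which everything
    near [z] is measured. *)
Lemma level z : disk z -> exists n, qn n.+1 < 1 - normc z /\ 1 - normc z <= qn n.
Proof.
move=> z1; have p : 0 < 1 - normc z by rewrite subr_gt0.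
have [n Hn] : exists n, qn n < 1 - normc z.
  have : (fun n => 1 * 2^-1 ^+ n : R) @ \oo --> (0 : R) by apply: geo_cvg0; lra.
  move=> /cvgrPdist_lt /(_ _ p) [n _ Hn]; exists n.
  have := Hn n (leqnn n); rewrite sub0r normrN mul1r ger0_norm// ltW//; exact: qn_gt0.
pose P n := qn n < 1 - normc z.
have exP : exists n, P n by exists n.
case: (ex_minnP exP) => -[|k] Pk Hk.
  by move: Pk; rewrite /P qn0 ltrBrDr gtrDl ltNge normc_ge0.
exists k; split => //; rewrite leNgt; apply/negP => /Hk.
by rewrite ltnn.
Qed.

Definition wl nu n : R := nu (rho n)%:C.
Lemma wl_gt0 nu n : 0 < wl nu n. Proof. exact: weight_gt0 (disk_rho n). Qed.
Lemma wl_ge nu n z : disk z -> rho n <= normc z -> nu z <= wl nu n.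
Proof. by move=> Dz h; apply: weight_noninc => //; rewrite nc_rho. Qed.
Lemma wl_le nu n z : normc z <= rho n -> wl nu n <= nu z.
Proof. by move=> h; apply: weight_noninc; [exact: disk_rho|rewrite nc_rho]. Qed.
Lemma rho_sq_ge n : qn n <= 1 - rho n ^+ 2.
Proof. have := qn_gt0 n; have := qn_le1 n; rewrite /rho => *; nra. Qed.
Lemma rho_sq_le n : 1 - rho n ^+ 2 <= 2 * qn n.
Proof. have := qn_gt0 n; have := qn_le1 n; rewrite /rho => *; nra. Qed.

Lemma powR_natX (x b : R) n : 0 <= x -> (x ^+ n) `^ b = (x `^ b) ^+ n.
Proof. by move=> x0; rewrite -powR_mulrn// powRAC powR_mulrn// powR_ge0. Qed.

Lemma powR_le_mul (x c y b : R) : 0 <= b -> 0 <= x -> 0 <= c -> 0 <= y -> x <= c * y ->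
  x `^ b <= c `^ b * y `^ b.
Proof.
move=> b0 x0 c0 y0 h; rewrite -powRM//; apply: ge0_ler_powR => //.
by rewrite nnegrE mulr_ge0.
Qed.

Let p k : 0 < 1 - rho k ^+ 2.
Proof. by apply: lt_le_trans (rho_sq_ge k); exact: qn_gt0. Qed.

(** Condition (I) at dyadic radii: one level costs the weight at most a factor [2^beta]. The extra
    [2^beta] in the constant comes from [1 - rho^2] lying between [qn] and [2 qn]. *)
Lemma wl_I nu beta : normal_exponent_I nu beta -> exists2 K : R, 0 < K &
  forall n m, (n <= m)%N -> wl nu n <= K * (2 `^ beta) ^+ (m - n) * wl nu m.
Proof.
move=> [b0 [K K0 H]]; exists (K * 2 `^ beta); first by rewrite mulr_gt0// powR_gt0.
move=> n m nm; have := H _ _ (rho_ge0 n) (rho_le nm) (rho_lt1 m).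
rewrite -/(wl nu n) -/(wl nu m) => {}H.
have pp k : 0 < (1 - rho k ^+ 2) `^ beta by rewrite powR_gt0.
rewrite ler_pdivrMr// in H; apply: le_trans H _.
have -> : K * 2 `^ beta * 2 `^ beta ^+ (m - n) * wl nu m =
  K * (wl nu m / (1 - rho m ^+ 2) `^ beta) *
  (2 `^ beta * (2 `^ beta ^+ (m - n) * (1 - rho m ^+ 2) `^ beta)).
  by field; rewrite gt_eqF.
rewrite ler_pM2l ?mulr_gt0 ?invr_gt0 ?wl_gt0// -powR_natX//.
rewrite mulrA -powRM ?exprn_ge0//; apply: powR_le_mul => //; rewrite ?(ltW b0) ?(ltW (p _)) ?mulr_ge0 ?exprn_ge0//.
apply: le_trans (rho_sq_le n) _; rewrite -mulrA ler_pM2l//.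
apply: (@le_trans _ _ (2 ^+ (m - n) * qn m)).
  by rewrite (qn_sub nm) mulrA (qn_inv (m - n)) mulfV ?mul1r// expf_neq0.
by rewrite ler_pM2l ?exprn_gt0// rho_sq_ge.
Qed.

(** Condition (II) at dyadic radii: the weight decays at least geometrically, with ratio
    [2^-gamma]. *)
Lemma wl_II nu : (exists gamma, normal_exponent_II nu gamma) -> exists K tau : R,
  [/\ 0 < K, 0 < tau, tau < 1 &
  forall n m, (n <= m)%N -> wl nu m <= K * tau ^+ (m - n) * wl nu n].
Proof.
move=> [gamma [b0 [K K0 H]]]; exists (K * 2 `^ gamma), (2^-1 `^ gamma); split.
- by rewrite mulr_gt0// powR_gt0.
- by rewrite powR_gt0.
- have h : (2^-1 : R) < 1 by lra.
  by have := gt0_ltr_powR b0 _ _ h; rewrite powR1; apply; rewrite nnegrE.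
move=> n m nm; have := H _ _ (rho_ge0 n) (rho_le nm) (rho_lt1 m).
rewrite -/(wl nu n) -/(wl nu m) => {}H.
have pp k : 0 < (1 - rho k ^+ 2) `^ gamma by rewrite powR_gt0.
rewrite ler_pdivrMr// in H; apply: le_trans H _.
have -> : K * 2 `^ gamma * 2^-1 `^ gamma ^+ (m - n) * wl nu n =
  K * (wl nu n / (1 - rho n ^+ 2) `^ gamma) *
  (2 `^ gamma * (2^-1 `^ gamma ^+ (m - n) * (1 - rho n ^+ 2) `^ gamma)).
  by field; rewrite gt_eqF.
rewrite ler_pM2l ?mulr_gt0 ?invr_gt0 ?wl_gt0// -powR_natX//.
rewrite mulrA -powRM ?exprn_ge0//; apply: powR_le_mul => //; rewrite ?(ltW b0) ?(ltW (p _)) ?mulr_ge0 ?exprn_ge0//.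
apply: le_trans (rho_sq_le m) _; rewrite -mulrA ler_pM2l//.
by rewrite (qn_sub nm) ler_pM2l ?qn_gt0// rho_sq_ge.
Qed.

Lemma geo_le (t : R) n : 0 <= t < 1 -> \sum_(i < n) t ^+ (n - i.+1) <= (1 - t)^-1.
Proof.
move=> tt; rewrite (reindex_inj rev_ord_inj) /=.
under eq_bigr => i _.
  have -> : (n - (n - i.+1).+1 = i)%N by have := ltn_ord i; lia.
  over.
exact: geo_sum_le.
Qed.

(** By the geometric decay of the weight, the reciprocals are dominated by the last one. *)
Lemma wl_inv_sum nu : (exists gamma, normal_exponent_II nu gamma) -> exists2 K : R, 0 < K &
  forall m, \sum_(i < m.+1) (wl nu i)^-1 <= K / wl nu m.
Proof.
move=> /wl_II[K [t [K0 t0 t1 H]]]; exists (K * (1 - t)^-1).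
  by rewrite mulr_gt0// invr_gt0 subr_gt0.
move=> m; have tt : 0 <= t < 1 by rewrite (ltW t0).
apply: (@le_trans _ _ (\sum_(i < m.+1) K / wl nu m * t ^+ (m.+1 - i.+1))).
  apply: ler_sum => i _; have im : (i <= m)%N by rewrite -ltnS.
  have h : wl nu m / wl nu i <= K * t ^+ (m - i) by rewrite ler_pdivrMr ?wl_gt0 ?H.
  rewrite subSS -(ler_pM2l (wl_gt0 nu m)); apply: le_trans h _.
  by rewrite le_eqVlt; apply/orP; left; apply/eqP; field; rewrite gt_eqF ?wl_gt0.
rewrite -mulr_sumr [leRHS]mulrAC; apply: ler_wpM2l; last exact: geo_le.
by rewrite divr_ge0 ?(ltW K0) ?(ltW (wl_gt0 _ _)).
Qed.
End WeightLevels.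

(** * The weighted norm of a function and of its derivative *)

Section NormEstimates.
Variable R : realType.
Local Notation C := R[i].
Implicit Types (mu : radial_weight R) (z w : C).

Lemma Hinf_le mu (y : Hinf mu) n z : normc z <= rho R n -> normc (y z) <= wnorm mu y / wl mu n.
Proof.
move=> zn; have Dz : disk z by exact: le_lt_trans zn (rho_lt1 _ _).
rewrite ler_pdivlMr ?wl_gt0// mulrC; apply: le_trans (wnorm_ub y Dz).
by rewrite ler_wpM2r ?normc_ge0// wl_le.
Qed.

(** Cauchy's estimate at half the distance to the circle. The constant 16 combines its factor 4 with
    [1 - |z|^2 <= 4 d]; condition (I) pays for the two levels by which the small disk may go deeper
    than [z]. *)
Lemma Hinf_deriv_le mu : (exists beta, normal_exponent_I mu beta) -> exists2 K : R, 0 < K &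
  forall (y : Hinf mu) z, disk z -> (1 - normc z ^+ 2) * mu z * normc (derive1 y z) <= K * wnorm mu y.
Proof.
move=> [beta /wl_I[K K0 H]]; exists (16 * (K * (2 `^ beta) ^+ 2)).
  by rewrite mulr_gt0// mulr_gt0// exprn_gt0// powR_gt0.
move=> y z Dz; have [n [n1 n2]] := level Dz.
have z1 : normc z < 1 by [].
pose d := (1 - normc z) / 2; have d0 : 0 < d by rewrite divr_gt0// subr_gt0.
have [ya _ _] := HinfP y.
have yB w : normc (w - z) < d -> normc (y w) <= wnorm mu y / wl mu n.+2.
  move=> wd; apply: Hinf_le; have := normc_triangle (w - z) z; rewrite subrK => h.
  by have := qnS R n.+1; rewrite /rho; move: n1 wd; rewrite /d; lra.
have zd : normc z + d <= 1 by rewrite /d; lra.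
have est := Cauchy_est ya d0 zd yB.
have w0 : 0 <= wnorm mu y by exact: wnorm_ge0.
have muz : mu z <= K * (2 `^ beta) ^+ 2 * wl mu n.+2.
  have := H n n.+2 (leqW (leqnSn n)); have -> : (n.+2 - n = 2)%N by rewrite -addn2 addKn.
  apply: le_trans.
  by apply: wl_ge => //; rewrite /rho; lra.
have z0 := normc_ge0 z.
have mu0 : 0 < mu z by exact: weight_gt0.
apply: (@le_trans _ _ ((4 * d) * (K * (2 `^ beta) ^+ 2 * wl mu n.+2) * (4 * (wnorm mu y / wl mu n.+2) / d))).
  apply: ler_pM => //; [|exact: normc_ge0|apply: ler_pM => //; last 2 first].
  - by rewrite mulr_ge0 ?(ltW mu0)// subr_ge0 expr_le1// ltW.
  - exact: ltW.
  - by rewrite /d; move: z0 z1; move: (normc z); clear => *; nra.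
  - by rewrite subr_ge0 expr_le1// ltW.
rewrite le_eqVlt; apply/orP; left; apply/eqP; field.
by rewrite !gt_eqF ?wl_gt0.
Qed.

Lemma seg_bound (H k : C -> C) a b (B : R) :
  (forall t : R, 0 <= t -> t <= 1 -> cdiff H (a + t%:C * (b - a)) (k (a + t%:C * (b - a)))) ->
  (forall t : R, 0 <= t -> t <= 1 -> exists A, cdiff k (a + t%:C * (b - a)) A) ->
  (forall t : R, 0 <= t -> t <= 1 -> normc (k (a + t%:C * (b - a))) <= B) ->
  normc (H b - H a) <= 2 * B * normc (b - a).
Proof.
move=> HH Hk kB.
have rline (f : C -> C) t A : cdiff f (a + t%:C * (b - a)) A ->
    rdiff (fun t => f (a + t%:C * (b - a))) t ((b - a) * A).
  move=> Hf e e0; have z0 : 0 < normc (b - a) + 1 by rewrite ltr_wpDl ?normc_ge0.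
  have [d d0 Hd] := Hf _ (divr_gt0 e0 z0); exists (d / (normc (b - a) + 1)); first by rewrite divr_gt0.
  move=> s; rewrite ltr_pdivlMr// => sd.
  have E : a + s%:C * (b - a) - (a + t%:C * (b - a)) = (s - t)%:C * (b - a) by rewrite rmorphB/=; ring.
  have sz : normc (a + s%:C * (b - a) - (a + t%:C * (b - a))) <= `|s - t| * (normc (b - a) + 1).
    by rewrite E ncM nc_real ler_wpM2l// lerDl.
  have := Hd _ (le_lt_trans sz sd).
  have -> : (s - t)%:C * ((b - a) * A) = A * (a + s%:C * (b - a) - (a + t%:C * (b - a))).
    by rewrite E; ring.
  move/le_trans; apply; rewrite -[leRHS](_ : e / (normc (b - a) + 1) * (`|s - t| * (normc (b - a) + 1)) = _).
    by rewrite ler_wpM2l// divr_ge0 ?(ltW e0) ?(ltW z0).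
  by field; rewrite gt_eqF.
have c1 : ccont_on (fun t => k (a + t%:C * (b - a))) 0 1.
  by move=> t t0 t1; have [A /rline/rdiff_cont] := Hk t t0 t1.
have c2 : ccont_on (fun t => (b - a) * k (a + t%:C * (b - a))) 0 1.
  move=> t t0 t1; have [A HA] := Hk t t0 t1.
  by have /rline/rdiff_cont := cdiffM (cdiff_cst (b - a) _) HA.
have E := @cint_FTC _ (fun t => H (a + t%:C * (b - a))) _ _ _ ler01
  (fun t t0 t1 => rline H t _ (HH t t0 t1)) c2.
rewrite mul1r mul0r addr0 subrKC in E; rewrite -E cintZ// ncM mulrC ler_wpM2r ?normc_ge0//.
by have := cint_bound ler01 c1 kB; rewrite subr0 mulr1.
Qed.

(** The converse bound, integrating along a radius annulus by annulus. Condition (II) sums the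
    contributions and condition (I) compares the last one with the weight at [z]. *)
Lemma Hinf_primitive_le mu : normal mu -> exists2 K : R, 0 < K &
  forall (H k : C -> C) (B : R), analytic k -> (forall z, normc z < 1 -> cdiff H z (k z)) ->
  (forall z, disk z -> (1 - normc z ^+ 2) * mu z * normc (k z) <= B) ->
  forall z, disk z -> mu z * normc (H z - H 0) <= K * B.
Proof.
move=> [[beta /wl_I[K1 K10 HI]] /wl_inv_sum[K2 K20 HII]].
exists (2 * K2 * (K1 * 2 `^ beta)); first by rewrite !mulr_gt0// powR_gt0.
move=> H k B ka HH kB z Dz; have [m [m1 m2]] := level Dz.
have z1 : normc z < 1 by [].
have B0 : 0 <= B.
  apply: le_trans (kB 0 (disk0 R)); rewrite !mulr_ge0 ?normc_ge0//.
    by rewrite nc0 expr0n subr0.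
  exact/ltW/weight_gt0/disk0.
have kn n w : normc w <= rho R n -> normc (k w) <= B / (qn R n * wl mu n).
  move=> wn; have Dw : disk w by exact: le_lt_trans wn (rho_lt1 _ _).
  rewrite ler_pdivlMr ?mulr_gt0 ?qn_gt0 ?wl_gt0// mulrC; apply: le_trans (kB w Dw).
  rewrite ler_wpM2r ?normc_ge0//; apply: ler_pM; rewrite ?(ltW (qn_gt0 _ _)) ?(ltW (wl_gt0 _ _))//.
    have := normc_ge0 w; have := rho_lt1 R n; move: wn; rewrite /rho => *; nra.
  exact: wl_le.
have seg a b n : normc a <= rho R n -> normc b <= rho R n ->
    normc (H b - H a) <= 2 * (B / (qn R n * wl mu n)) * normc (b - a).
  move=> an bn.
  have conv t : 0 <= t -> t <= 1 -> normc (a + t%:C * (b - a)) <= rho R n.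
    move=> t0 t1; have -> : a + t%:C * (b - a) = (1 - t)%:C * a + t%:C * b.
      by rewrite rmorphB/=; ring.
    apply: le_trans (normc_triangle _ _) _; rewrite !ncM !nc_real ger0_norm ?subr_ge0// ger0_norm//.
    have : (1 - t) * normc a <= (1 - t) * rho R n by rewrite ler_wpM2l// subr_ge0.
    have : t * normc b <= t * rho R n by rewrite ler_wpM2l.
    lra.
  apply: (@seg_bound H k).
  - by move=> t t0 t1; apply: HH; exact: le_lt_trans (conv t t0 t1) (rho_lt1 _ _).
  - move=> t t0 t1; exists (derive1 k (a + t%:C * (b - a))); apply: analytic_cdiff => //.
    exact: le_lt_trans (conv t t0 t1) (rho_lt1 _ _).
  - by move=> t t0 t1; apply: kn; exact: conv.
(* The direction of [z]; for [z = 0] the value 0 still satisfies [zu] and [nu1]. *)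
pose u := if z == 0 then 0 else z / (normc z)%:C.
have nu1 : normc u <= 1.
  rewrite /u; case: eqVneq => [_|z0]; first by rewrite nc0.
  by rewrite ncM ncV nc_real ger0_norm ?normc_ge0// mulfV// nc_eq0.
have zu : z = (normc z)%:C * u.
  rewrite /u; case: eqVneq => [->|z0]; first by rewrite mulr0.
  by rewrite mulrC divfK// -nc_eq0 nc_real normr_eq0 nc_eq0.
have nru (r : R) : 0 <= r -> normc (r%:C * u) <= r.
  by move=> r0; rewrite ncM nc_real ger0_norm// ler_piMr.
(* The width [qn i.+1] of each annulus cancels the same factor in the bound for [k], leaving the
   reciprocal weight. *)
have chain n : normc (H ((rho R n)%:C * u) - H 0) <= \sum_(i < n) 2 * (B / wl mu i.+1).
  elim: n => [|n IH].
    by rewrite big_ord0 /rho qn0 subrr mul0r subrr nc0.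
  rewrite big_ord_recr/= addrC.
  apply: le_trans (nc_dist _ _ (H ((rho R n)%:C * u))) _; rewrite lerD//.
  apply: le_trans (seg _ _ n.+1 _ _) _.
  - by apply: le_trans (nru _ (rho_ge0 _ _)) (rho_le _ _).
  - exact: nru (rho_ge0 _ _).
  have E : (rho R n.+1)%:C * u - (rho R n)%:C * u = (qn R n.+1)%:C * u.
    by rewrite -mulrBl -rmorphB /rho; congr (_%:C * _); rewrite (qnS R n); ring.
  rewrite E; have h := nru _ (ltW (qn_gt0 R n.+1)).
  apply: le_trans (ler_wpM2l _ h) _.
    by rewrite mulr_ge0// divr_ge0// mulr_ge0 ?(ltW (qn_gt0 _ _)) ?(ltW (wl_gt0 _ _)).
  rewrite le_eqVlt; apply/orP; left; apply/eqP; field.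
  by rewrite !gt_eqF ?wl_gt0 ?qn_gt0.
have last_step : normc (H z - H ((rho R m)%:C * u)) <= 2 * (B / wl mu m.+1).
  apply: le_trans (seg _ _ m.+1 _ _) _.
  - by apply: le_trans (nru _ (rho_ge0 _ _)) (rho_le _ _).
  - by rewrite /rho; lra.
  have E : z - (rho R m)%:C * u = (normc z - rho R m)%:C * u.
    by rewrite {1}zu -mulrBl -rmorphB.
  have d0 : 0 <= normc z - rho R m by rewrite /rho; lra.
  have d1 : normc z - rho R m <= qn R m.+1 by rewrite /rho; have := qnS R m; lra.
  rewrite E; have h := le_trans (nru _ d0) d1.
  apply: le_trans (ler_wpM2l _ h) _.
    by rewrite mulr_ge0// divr_ge0// mulr_ge0 ?(ltW (qn_gt0 _ _)) ?(ltW (wl_gt0 _ _)).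
  rewrite le_eqVlt; apply/orP; left; apply/eqP; field.
  by rewrite !gt_eqF ?wl_gt0 ?qn_gt0.
have tot : normc (H z - H 0) <= 2 * B * (K2 / wl mu m.+1).
  apply: le_trans (nc_dist _ _ (H ((rho R m)%:C * u))) _.
  apply: le_trans (lerD last_step (chain m)) _.
  have -> : 2 * (B / wl mu m.+1) + \sum_(i < m) 2 * (B / wl mu i.+1) =
      \sum_(i < m.+1) 2 * (B / wl mu i.+1) by rewrite big_ord_recr/= addrC.
  have -> : \sum_(i < m.+1) 2 * (B / wl mu i.+1) = 2 * B * \sum_(i < m.+1) (wl mu i.+1)^-1.
    by rewrite mulr_sumr; apply: eq_bigr => i _; rewrite mulrA.
  rewrite ler_wpM2l ?mulr_ge0//; apply: le_trans (HII m.+1).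
  by rewrite [leRHS]big_ord_recl /= lerDr invr_ge0 ltW// wl_gt0.
have muz : mu z <= K1 * 2 `^ beta * wl mu m.+1.
  have := HI m m.+1 (leqnSn m); rewrite subSnn expr1; apply: le_trans.
  by apply: wl_ge => //; rewrite /rho; lra.
apply: (@le_trans _ _ ((K1 * 2 `^ beta * wl mu m.+1) * (2 * B * (K2 / wl mu m.+1)))).
  by apply: ler_pM => //; [exact/ltW/weight_gt0|exact: normc_ge0].
rewrite le_eqVlt; apply/orP; left; apply/eqP; field.
by rewrite gt_eqF ?wl_gt0.
Qed.
End NormEstimates.

(** * Roots of unity and the discrete Forelli-Rudin estimate *)

Section RootsOfUnity.
Variable R : realType.
Local Notation C := R[i].
Implicit Types (z w t : C).

Definition rt (N k : nat) : C := expi (pi *+ 2 * k%:R / N%:R).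

Lemma nc_rt N k : normc (rt N k) = 1. Proof. exact: nc_expi. Qed.
Lemma rtD N j k : rt N (j + k) = rt N j * rt N k.
Proof. by rewrite /rt -expiD natrD; congr expi; ring. Qed.
Lemma rt0 N : rt N 0 = 1. Proof. by rewrite /rt mulr0 mul0r expi0. Qed.
Lemma rtN N : (0 < N)%N -> rt N N = 1.
Proof. by move=> N0; rewrite /rt mulfK ?expi2pi// pnatr_eq0 -lt0n. Qed.
Lemma rtX N k j : rt N k ^+ j = rt N (k * j).
Proof. by elim: j => [|j IH]; rewrite ?muln0 ?rt0// exprS IH mulnS rtD. Qed.
Lemma rtXN N k : (0 < N)%N -> rt N k ^+ N = 1.
Proof. by move=> N0; rewrite rtX mulnC -rtX rtN// expr1n. Qed.
Lemma rt_neq0 N k : rt N k != 0. Proof. exact: expi_neq0. Qed.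
Lemma rt_mul N k j : (0 < j)%N -> rt (N * j) (k * j) = rt N k.
Proof.
move=> j0; rewrite /rt; congr expi; rewrite !natrM.
have [->|N0] := eqVneq N 0%N; first by rewrite mul0r !invr0 !mulr0.
by field; rewrite !pnatr_eq0 N0 -lt0n j0.
Qed.
Lemma rt_conj N k : (rt N k)^* = (rt N k)^-1. Proof. exact: expi_conj. Qed.

(** Removing the powers of 2 from [k] leaves an odd index, and an odd power of -1 is -1. *)
Lemma rt_half p k : (0 < k < 2 ^ p)%N -> exists2 i, (i < p)%N & rt (2 ^ p) k ^+ (2 ^ i) = -1.
Proof.
elim: p k => [|p IH] k /andP[k0 kp]; first by move: k0 kp; rewrite expn0; lia.
have [ko|ke] := boolP (odd k).
  exists p => //; rewrite rtX expnSr /rt.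
  have -> : pi *+ 2 * (k * 2 ^ p)%:R / (2 ^ p * 2)%:R = pi *+ k :> R.
    rewrite !natrM -[pi *+ 2]mulr_natr -[pi *+ k]mulr_natr; field.
    by rewrite pnatr_eq0 expn_eq0.
  rewrite -expiX expipi -signr_odd ko expr1//.
have kE : k = (k./2 * 2)%N by rewrite muln2 even_halfK.
have [|i ip Hi] := IH k./2.
  by move: k0 kp; rewrite {1 2}kE expnSr; lia.
exists i; first exact: leqW.
by rewrite {1}kE expnSr rt_mul.
Qed.

Lemma unimod_powB z n : normc z = 1 -> normc (z ^+ n - 1) <= n%:R * normc (z - 1).
Proof.
move=> z1; elim: n => [|n IH]; first by rewrite subrr nc0 mul0r.
have -> : z ^+ n.+1 - 1 = z * (z ^+ n - 1) + (z - 1) by rewrite exprS; ring.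
apply: le_trans (normc_triangle _ _) _.
by rewrite ncM z1 mul1r -natr1 mulrDl mul1r lerD2r.
Qed.

(** Some power [2^i] with [i < p] sends the root to -1, at distance 2 from 1, while taking that
    power stretches the distance to 1 by at most [2^i]. No estimate of the sine is needed. *)
Lemma rt_sep p k : (0 < k < 2 ^ p)%N -> 4 / (2 ^ p)%:R <= normc (rt (2 ^ p) k - 1).
Proof.
move=> /rt_half[i ip H].
have := unimod_powB (2 ^ i) (nc_rt (2 ^ p) k); rewrite H.
have -> : normc (-1 - 1 : C) = 2.
  by rewrite -opprD ncN -(natrD _ 1 1) nc_natr.
have p0 : 0 < (2 ^ p)%:R :> R by rewrite ltr0n expn_gt0.
move=> h; rewrite ler_pdivrMr//.
have : (2 ^ i.+1)%:R <= (2 ^ p)%:R :> R by rewrite ler_nat leq_exp2l.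
rewrite expnS natrM => h2; have := normc_ge0 (rt (2 ^ p) k - 1).
move: h h2; move: (normc _) ((2 ^ i)%:R) ((2 ^ p)%:R) => a b c; clear => *; nra.
Qed.

Lemma rt_dist p k l : (k < 2 ^ p)%N -> (l < 2 ^ p)%N -> k <> l ->
  4 / (2 ^ p)%:R <= normc (rt (2 ^ p) k - rt (2 ^ p) l).
Proof.
wlog kl : k l / (k < l)%N => [W|] kp lp nkl.
  have [kl|kl|//] := ltngtP k l; first exact: W.
  by rewrite ncB; apply: W => //; exact: nesym.
have -> : rt (2 ^ p) k - rt (2 ^ p) l = - rt (2 ^ p) k * (rt (2 ^ p) (l - k) - 1).
  by rewrite mulrBr mulNr -rtD subnKC ?(ltnW kl)//; ring.
rewrite ncM ncN nc_rt mul1r; apply: rt_sep; lia.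
Qed.

Lemma rt_orth p j : \sum_(k < 2 ^ p) rt (2 ^ p) (k * j) =
  if (2 ^ p %| j)%N then (2 ^ p)%:R else 0.
Proof.
have N0 : (0 < 2 ^ p)%N by rewrite expn_gt0.
have E (i : nat) : rt (2 ^ p) (i * j) = rt (2 ^ p) j ^+ i by rewrite rtX mulnC.
under eq_bigr do rewrite E.
have [/dvdnP[d ->]|nd] := ifPn.
  rewrite [rt _ _](_ : _ = 1); last by rewrite mulnC -rtX rtN// expr1n.
  by under eq_bigr do rewrite expr1n; rewrite sumr_const card_ord.
have jm : (0 < j %% 2 ^ p < 2 ^ p)%N by rewrite ltn_mod N0 lt0n andbT.
have e1 : rt (2 ^ p) j = rt (2 ^ p) (j %% 2 ^ p).
  by rewrite {1}(divn_eq j (2 ^ p)) rtD mulnC -rtX rtN// expr1n mul1r.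
have ne1 : rt (2 ^ p) j - 1 != 0.
  rewrite -nc_gt0 e1; apply: lt_le_trans (rt_sep jm).
  by rewrite divr_gt0// ltr0n.
apply: (mulfI ne1); rewrite mulr0 -subrX1 rtXN// subrr//.
Qed.

Lemma rt_conj_orth p j : \sum_(k < 2 ^ p) ((rt (2 ^ p) k)^*) ^+ j =
  if (2 ^ p %| j)%N then (2 ^ p)%:R else 0.
Proof.
have -> : \sum_(k < 2 ^ p) ((rt (2 ^ p) k)^*) ^+ j = (\sum_(k < 2 ^ p) rt (2 ^ p) (k * j))^*.
  by rewrite rmorph_sum; apply: eq_bigr => k _; rewrite -rmorphXn rtX.
by rewrite rt_orth; case: ifP => _; rewrite ?rmorph_nat ?rmorph0.
Qed.

(** The partial fraction expansion of [N / (1 - t^N)]: after multiplication by [1 - t^N] each term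
    is a finite geometric sum, and orthogonality leaves only the constant. *)
Lemma cauchy_rt p t : normc t < 1 ->
  \sum_(k < 2 ^ p) (1 - (rt (2 ^ p) k)^* * t)^-1 = (2 ^ p)%:R / (1 - t ^+ (2 ^ p)).
Proof.
move=> t1; set N := (2 ^ p)%N; have N0 : (0 < N)%N by rewrite expn_gt0.
have tN : 1 - t ^+ N != 0.
  rewrite -nc_gt0; apply: lt_le_trans (nc_ge _ _); rewrite nc1 ncX subr_gt0.
  by rewrite exprn_ilt1 ?normc_ge0// -lt0n.
apply: (mulIf tN); rewrite divfK// mulr_suml.
have E (k : 'I_N) : (1 - (rt N k)^* * t)^-1 * (1 - t ^+ N) = \sum_(j < N) ((rt N k)^*) ^+ j * t ^+ j.
  set e := (rt N k)^*; have eN : e ^+ N = 1 by rewrite -rmorphXn rtXN ?rmorph1.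
  have e0 : 1 - e * t != 0.
    rewrite -nc_gt0; apply: lt_le_trans (nc_ge _ _).
    by rewrite nc1 ncM nc_conj nc_rt mul1r subr_gt0.
  apply: (mulfI e0); rewrite mulrA mulfV// mul1r.
  have -> : t ^+ N = (e * t) ^+ N by rewrite exprMn eN mul1r.
  by rewrite -opprB subrX1 -mulNr opprB; congr (_ * _); apply: eq_bigr => j _; rewrite exprMn.
under eq_bigr do rewrite E.
rewrite exchange_big /=.
under eq_bigr do rewrite -mulr_suml rt_conj_orth.
rewrite (bigD1 (Ordinal N0)) //= dvdn0 expr0 mulr1 big1 ?addr0// => j j0.
rewrite gtnNdvd ?mul0r//; rewrite lt0n; apply: contraNneq j0 => jz.
exact/eqP/val_inj.
Qed.

(** The Poisson kernel as the real part of an analytic function; it reduces the sum of inverse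
    squares to [cauchy_rt]. *)
Lemma Re_inv_1m z : normc z < 1 ->
  normc (1 - z) ^- 2 = (2 * complex.Re (1 - z)^-1 - 1) / (1 - normc z ^+ 2).
Proof.
move=> z1; have p : 0 < 1 - normc z ^+ 2.
  by rewrite subr_gt0 exprn_ilt1// normc_ge0.
have q : 0 < normc (1 - z).
  by apply: lt_le_trans (nc_ge _ _); rewrite nc1 subr_gt0.
have q2 : 0 < normc (1 - z) ^+ 2 by rewrite exprn_gt0.
have R1 : complex.Re (1 - z)^-1 = complex.Re (1 - z) / normc (1 - z) ^+ 2.
  by rewrite nc_sq; case: (1 - z) => a b /=.
rewrite R1; apply: (mulIf (lt0r_neq0 p)); rewrite divfK ?lt0r_neq0//.
apply: (mulfI (lt0r_neq0 q2)); rewrite mulrA mulfV ?lt0r_neq0// mul1r.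
have -> : normc (1 - z) ^+ 2 * (2 * (complex.Re (1 - z) / normc (1 - z) ^+ 2) - 1) =
   2 * complex.Re (1 - z) - normc (1 - z) ^+ 2 by field; rewrite gt_eqF.
by rewrite !nc_sq ReB ImB /=; ring.
Qed.

(** The hypothesis [|t|^N <= 1 / 2] keeps the denominator [1 - t^N] of [cauchy_rt] at modulus at
    least [1 / 2]. *)
Lemma angle_sum p t : normc t < 1 -> normc t ^+ (2 ^ p) <= 2^-1 ->
  \sum_(k < 2 ^ p) normc (1 - (rt (2 ^ p) k)^* * t) ^- 2 <= 4 * (2 ^ p)%:R / (1 - normc t).
Proof.
move=> t1 tN; set N := (2 ^ p)%N.
have et k : normc ((rt N k)^* * t) = normc t by rewrite ncM nc_conj nc_rt mul1r.
have p1 : 0 < 1 - normc t by rewrite subr_gt0.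
have p2 : 1 - normc t <= 1 - normc t ^+ 2.
  by rewrite lerD2l lerN2 expr2 ler_piMr ?normc_ge0// ltW.
have p2' : 0 < 1 - normc t ^+ 2 by apply: lt_le_trans p2.
have N0 : 0 <= N%:R :> R by rewrite ler0n.
have -> : \sum_(k < N) normc (1 - (rt N k)^* * t) ^- 2 =
   (2 * complex.Re (N%:R / (1 - t ^+ N)) - N%:R) / (1 - normc t ^+ 2).
  rewrite -cauchy_rt//; under eq_bigr do rewrite Re_inv_1m ?et//.
  rewrite -mulr_suml; congr (_ / _); rewrite big_split/= -mulr_sumr sumr_const card_ord mulNrn.
  congr (_ - _); congr (_ * _).
  by elim/big_rec2: _ => // k y1 y2 _ ->; rewrite ReD.
have h : complex.Re (N%:R / (1 - t ^+ N)) <= 2 * N%:R.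
  apply: le_trans (Re_le _) _; rewrite ncM nc_natr ncV mulrC ler_wpM2r//.
  rewrite -[leRHS]invrK lef_pV2 ?posrE ?invr_gt0//.
    by apply: le_trans (nc_ge _ _); rewrite nc1 ncX; lra.
  by apply: lt_le_trans (nc_ge _ _); rewrite nc1 ncX subr_gt0; lra.
rewrite ler_pdivrMr//; apply: (@le_trans _ _ (4 * N%:R)); first by lra.
by rewrite mulrAC ler_pdivlMr// ler_wpM2l// mulr_ge0.
Qed.

Lemma bernoulli_inv (x : R) m : 0 <= x <= 1 -> (1 - x) ^+ m * (1 + m%:R * x) <= 1.
Proof.
move=> /andP[x0 x1]; elim: m => [|m IH]; first by rewrite mul0r addr0 mulr1.
apply: le_trans IH; rewrite exprSr -mulrA ler_wpM2l//.
  by rewrite exprn_ge0// subr_ge0.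
have m0 : 0 <= m%:R :> R by rewrite ler0n.
have -> : (1 - x) * (1 + m.+1%:R * x) = 1 + m%:R * x - (m%:R + 1) * x ^+ 2.
  by rewrite -natr1; ring.
by rewrite lerBlDr lerDl mulr_ge0 ?addr_ge0// exprn_ge0.
Qed.

End RootsOfUnity.

(** * The nodes and the sum of kernels over them *)

Section Nodes.
Variable R : realType.
Local Notation C := R[i].
Implicit Types (nu : radial_weight R) (z w : C).
Local Notation qn := (qn R).

Definition Rn n : R := 1 - qn n / 4.
(** The 6 makes the angular step [2 pi / Nn n] at most [qn n / 8], fine enough for the cells to be
    covered by boxes of half-side [qn n]; it also gives [RnN]. *)
Definition Nn n : nat := (2 ^ (n + 6))%N.
Definition node n k : C := (Rn n)%:C * rt R (Nn n) k.

Lemma conjM_real (r : R) z : (r%:C * z)^* = r%:C * z^*.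
Proof. by case: z => a b; apply/eqP; rewrite eq_complex /= !mul0r subr0 !addr0 mulrN !eqxx. Qed.

Lemma node_conj n k : (node n k)^* = (Rn n)%:C * (rt R (Nn n) k)^*.
Proof. exact: conjM_real. Qed.

Lemma Nn_gt0 n : (0 < Nn n)%N. Proof. by rewrite expn_gt0. Qed.
Lemma NnE n : (Nn n)%:R = 64 / qn n :> R.
Proof. by rewrite /Nn expnD natrM /= qn_inv invrK natrX mulrC. Qed.
Lemma Rn_lt1 n : Rn n < 1. Proof. have := qn_gt0 R n; rewrite /Rn; lra. Qed.
Lemma Rn_ge n : 3 / 4 <= Rn n.
Proof. have := qn_le1 R n; rewrite /Rn; lra. Qed.
Lemma Rn_gt0 n : 0 < Rn n. Proof. have := Rn_ge n; lra. Qed.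
Lemma nc_node n k : normc (node n k) = Rn n.
Proof. by rewrite ncM nc_rt mulr1 nc_real gtr0_norm// Rn_gt0. Qed.

Lemma kern_neq0 n k w : disk w -> 0 < normc (1 - (node n k)^* * w).
Proof.
move=> w1; apply: lt_le_trans (nc_ge _ _); rewrite nc1 ncM nc_conj nc_node subr_gt0.
by apply: le_lt_trans w1; rewrite ler_piMl ?normc_ge0// ltW// Rn_lt1.
Qed.

Lemma RnN n : Rn n ^+ Nn n <= 2^-1.
Proof.
have q0 := qn_gt0 R n; have q1 := qn_le1 R n.
have h := @bernoulli_inv R (qn n / 4) (Nn n).
have : Rn n ^+ Nn n * 17 <= 1.
  (* Since [Nn n = 64 / qn n], the product [Nn n * (qn n / 4)] is 16. *)
  have -> : 17 = 1 + (Nn n)%:R * (qn n / 4) by rewrite NnE; field; rewrite gt_eqF.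
  by apply: h; apply/andP; split; lra.
lra.
Qed.

(** Two of the [M + 2] powers are summed over the angle by [angle_sum]; the other [M] are bounded by
    the distance of [t] to the unit circle. *)
Lemma angle_sum_node n M w : disk w ->
  \sum_(k < Nn n) normc (1 - (node n k)^* * w) ^- M.+2 <=
  4 * (Nn n)%:R / (1 - Rn n * normc w) ^+ M.+1.
Proof.
move=> w1; pose t := (Rn n)%:C * w.
have R0 := Rn_gt0 n; have w0 := normc_ge0 w; have wlt : normc w < 1 by [].
have nt : normc t = Rn n * normc w by rewrite ncM nc_real gtr0_norm.
have tR : normc t <= Rn n by rewrite nt ler_piMr ?(ltW R0) ?(ltW wlt).
have t1 : normc t < 1 by apply: le_lt_trans tR (Rn_lt1 n).
have p : 0 < 1 - normc t by rewrite subr_gt0.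
have tN : normc t ^+ Nn n <= 2^-1.
  apply: le_trans (RnN n); apply: lerXn2r => //; rewrite nnegrE ?normc_ge0//; exact: ltW.
have E k : (node n k)^* * w = (rt R (Nn n) k)^* * t.
  by rewrite [X in X * w](node_conj n k) /t; ring.
rewrite -nt; apply: (@le_trans _ _ (\sum_(k < Nn n)
    normc (1 - (rt R (Nn n) k)^* * t) ^- 2 * (1 - normc t) ^- M)).
  apply: ler_sum => k _; rewrite E -[M.+2]addn2 exprD invfM mulrC.
  have et : normc ((rt R (Nn n) k)^* * t) = normc t by rewrite ncM nc_conj nc_rt mul1r.
  have l : 1 - normc t <= normc (1 - (rt R (Nn n) k)^* * t).
    by apply: le_trans (nc_ge _ _); rewrite nc1 et.
  rewrite ler_wpM2l ?invr_ge0 ?exprn_ge0 ?normc_ge0//.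
  rewrite lef_pV2 ?posrE ?exprn_gt0//; last exact: lt_le_trans l.
  by apply: lerXn2r => //; rewrite nnegrE ?(ltW p)// normc_ge0.
rewrite -mulr_suml exprS invfM mulrA ler_wpM2r ?invr_ge0 ?exprn_ge0 ?(ltW p)//.
exact: angle_sum.
Qed.

Lemma sum_split_le (F G H : nat -> R) (j m : nat) (A B : R) :
  (forall n, (n <= j)%N -> F n <= G n) -> (forall n, F (j.+1 + n)%N <= H n) ->
  (forall n, 0 <= F n) -> (forall n, 0 <= H n) ->
  \sum_(n < j.+1) G n <= A -> (forall m, \sum_(n < m) H n <= B) ->
  \sum_(n < m) F n <= A + B.
Proof.
move=> FG FH F0 H0 GA HB.
apply: (@le_trans _ _ (\sum_(n < j.+1 + m) F n)).
  rewrite addnC big_split_ord/= lerDl; by apply: sumr_ge0.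
rewrite big_split_ord/= lerD//.
  by apply: le_trans GA; apply: ler_sum => i _; apply: FG; rewrite -ltnS.
by apply: le_trans (HB m); apply: ler_sum => i _; exact: FH.
Qed.

(** The circles are split at the level [j] of [w]. On either side the sum is geometric, dominated by
    its terms near [j]: by condition (II) for the coarse circles, by condition (I) and
    [beta < M + 1] for the fine ones. *)
Lemma discrete_FR nu beta M : normal nu -> normal_exponent_I nu beta -> beta < M.+1%:R ->
  exists2 K : R, 0 < K & forall m w, disk w ->
  nu w * (\sum_(n < m) qn n ^+ M.+2 / wl nu n *
    \sum_(k < Nn n) normc (1 - (node n k)^* * w) ^- M.+2) <= K.
Proof.
move=> [_ /wl_inv_sum[K2 K20 H2]] /wl_I[K1 K10 H1] bM.
(* Ratio between successive fine circles: the reciprocal weight grows by at most [2^beta], the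
   kernel factor shrinks by [2^-(M+1)]. *)
pose t : R := 2 `^ beta / 2 ^+ M.+1.
have l0 : 0 < 2 `^ beta :> R by rewrite powR_gt0.
have t0 : 0 <= t by rewrite divr_ge0 ?(ltW l0).
have t1 : t < 1.
  rewrite ltr_pdivrMr ?exprn_gt0// mul1r -powR_mulrn//.
  rewrite lt_neqAle ler_powR ?ler1n ?(ltW bM)// andbT; apply/eqP => /(congr1 (@ln R)).
  rewrite !ln_powR => /(mulIf _) => h; move: bM; rewrite h ?ltxx//.
  by rewrite gt_eqF// ln_gt0// ltr1n.
have tt : 0 <= t < 1 by rewrite t0.
have subE a b : ((a + b).+1 - a = b.+1)%N by lia.
have [L LE] : exists L : R, L = 4 * 64 by eexists.
have L0 : 0 < L by rewrite LE mulr_gt0.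
have LN n : 4 * (Nn n)%:R = L / qn n by rewrite NnE LE mulrA.
clear LE.
have [A AE] : exists A : R, A = 4 ^+ M.+1 by eexists.
have A0 : 0 < A by rewrite AE exprn_gt0.
have bA : 2 `^ beta <= A.
  apply: (@le_trans _ _ (2 ^+ M.+1)).
    by rewrite -[leRHS]powR_mulrn// ler_powR ?ler1n// ltW.
  by rewrite AE; apply: lerXn2r => //; rewrite ?nnegrE// ler_nat.
have s0 : 0 < (1 - t)^-1 by rewrite invr_gt0 subr_gt0.
exists (L * A * (K2 + K1 * (1 - t)^-1)).
  by apply: mulr_gt0; [exact: mulr_gt0|apply: addr_gt0 => //; exact: mulr_gt0].
move=> m w w1; have wlt : normc w < 1 by []. have w0 := normc_ge0 w.
have [j [j1 j2]] := level w1.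
have nuw : nu w <= wl nu j by apply: wl_ge => //; rewrite /rho; lra.
have nj0 := wl_gt0 nu j.
pose F n := qn n ^+ M.+2 / wl nu n * \sum_(k < Nn n) normc (1 - (node n k)^* * w) ^- M.+2.
have F0 n : 0 <= F n.
  apply: mulr_ge0; first by rewrite divr_ge0 ?exprn_ge0 ?(ltW (qn_gt0 _ _)) ?(ltW (wl_gt0 _ _)).
  by apply: sumr_ge0 => k _; rewrite invr_ge0 exprn_ge0// normc_ge0.
have FB n (c : R) : 0 < c -> c <= 1 - Rn n * normc w ->
    F n <= L * (qn n / c) ^+ M.+1 / wl nu n.
  move=> c0 cn; have q0 := qn_gt0 R n.
  apply: (@le_trans _ _ (qn n ^+ M.+2 / wl nu n * (L / qn n / c ^+ M.+1))).
    rewrite ler_wpM2l ?divr_ge0 ?exprn_ge0 ?(ltW q0) ?(ltW (wl_gt0 _ _))//.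
    apply: le_trans (angle_sum_node n M w1) _; rewrite LN ler_wpM2l//.
      by rewrite divr_ge0// ltW.
    rewrite lef_pV2 ?posrE ?exprn_gt0 ?(lt_le_trans c0)//.
    by apply: lerXn2r => //; rewrite nnegrE ?(ltW c0) ?(le_trans (ltW c0)).
  rewrite expr_div_n [qn n ^+ M.+2]exprS le_eqVlt; apply/orP; left; apply/eqP; field.
  by rewrite !gt_eqF ?exprn_gt0 ?wl_gt0.
have Q := qn_gt0 R.
have main : \sum_(n < m) F n <= L * A * (K2 / wl nu j) + L * A * (K1 / wl nu j * (1 - t)^-1).
  have LA : 0 < L * A by exact: mulr_gt0.
  have Kj : 0 < K1 / wl nu j by exact: divr_gt0.
  refine (@sum_split_le F (fun n => L * A * (wl nu n)^-1)
    (fun n => L * A * (K1 / wl nu j * t ^+ n)) j m _ _ _ _ F0 _ _ _).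
  (* Coarse circles: [1 - Rn n * normc w] is at least [qn n / 4], whatever [w] is, so only
     reciprocal weights remain. *)
  - move=> n nj; have := FB n (qn n / 4) _ _; rewrite divr_gt0// => /(_ isT).
    have -> : qn n / (qn n / 4) = 4 by field; rewrite gt_eqF.
    rewrite -AE; apply; rewrite /Rn lerBrDr; have : (1 - qn n / 4) * normc w <= 1 - qn n / 4.
      by rewrite ler_piMr ?(ltW wlt)//; exact/ltW/(Rn_gt0 n).
    lra.
  (* Fine circles: the distance of [w] to the unit circle, larger than [qn j.+1], bounds the
     kernel. *)
  - move=> n; have := FB (j.+1 + n)%N (qn j.+1) (Q _) _.
    have -> : qn (j.+1 + n) / qn j.+1 = qn n.
      by rewrite /qn exprD mulrAC mulfV ?mul1r// expf_neq0.
    have h1 : qn j.+1 <= 1 - Rn (j.+1 + n) * normc w.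
      have : Rn (j.+1 + n) * normc w <= normc w by rewrite ler_piMl// ltW// Rn_lt1.
      lra.
    move=> /(_ h1) /le_trans; apply.
    have := H1 j (j.+1 + n)%N; rewrite addSn leqW ?leq_addr// subE => /(_ isT) h.
    rewrite ler_pdivrMr ?wl_gt0//.
    have h2 : 1 <= K1 * 2 `^ beta ^+ n.+1 * wl nu (j + n).+1 / wl nu j.
      by rewrite ler_pdivlMr// mul1r.
    have e1 : L * A * (K1 / wl nu j * t ^+ n) * wl nu (j + n).+1 =
       L * qn n ^+ M.+1 * (K1 * 2 `^ beta ^+ n.+1 * wl nu (j + n).+1 / wl nu j) * (A / 2 `^ beta).
      have -> : qn n ^+ M.+1 = (2 ^+ M.+1 ^+ n)^-1.
        by rewrite /qn -!exprM mulnC exprVn.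
      rewrite /t expr_div_n (exprS (2 `^ beta) n).
      have := exprn_gt0 M.+1 (ltr0n R 2); move: (2 ^+ M.+1) => u u0.
      by field; rewrite !gt_eqF ?exprn_gt0.
    rewrite e1; have h3 : 1 <= A / 2 `^ beta by rewrite ler_pdivlMr// mul1r.
    have LQ : 0 <= L * qn n ^+ M.+1 by rewrite mulr_ge0 ?exprn_ge0 ?ltW.
    rewrite -[leLHS]mulr1 -[X in X * 1]mulr1; apply: ler_pM => //.
      by rewrite mulr1.
    by rewrite ler_wpM2l.
  - by move=> n; apply: mulr_ge0; [exact: ltW|apply: mulr_ge0; [exact: ltW|exact: exprn_ge0]].
  - by rewrite -mulr_sumr ler_wpM2l// ltW.
  - move=> k; rewrite -!mulr_sumr ler_wpM2l ?(ltW LA)// ler_wpM2l ?(ltW Kj)//.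
    exact: geo_sum_le.
apply: (@le_trans _ _ (wl nu j * (L * A * (K2 / wl nu j) +
    L * A * (K1 / wl nu j * (1 - t)^-1)))).
  apply: ler_pM => //; first exact/ltW/weight_gt0.
  by apply: sumr_ge0 => n _; exact: F0.
move: s0; move: (1 - t)^-1 => s s0.
rewrite le_eqVlt; apply/orP; left; apply/eqP; field.
by rewrite gt_eqF.
Qed.
End Nodes.

(** * Testing a nuclear representation *)

Section DualNorm.
Variable R : realType.
Local Notation C := R[i].

Section General.
Variable X : normedModType C.
Implicit Types (x : {linear X -> C}) (h : X).

Lemma norm_ReC (V : normedModType C) (v : V) : `|v| = (complex.Re `|v|)%:C.
Proof. by rewrite RRe_real// ger0_real. Qed.

Lemma Re_norm_ge0 (V : normedModType C) (v : V) : 0 <= complex.Re `|v|.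
Proof. by rewrite -lecR -norm_ReC; exact: (normr_ge0 v). Qed.

Lemma dual_has_sup x : bounded_operator x ->
  has_sup [set normc (x h) | h in [set h : X | `|h| <= 1]].
Proof.
move=> [M HM]; split; first by exists (normc (x 0)), 0 => //=; rewrite normr0 ler01.
exists `|M| => _ [h /= h1 <-]; rewrite -lecR -normcNE; apply: le_trans (HM h) _.
apply: (@le_trans _ _ (`|M|%:C * `|h|)); first by rewrite ler_wpM2r// lecR ler_norm.
by rewrite ler_piMr// lecR.
Qed.

Lemma dual_norm_ge0 x : bounded_operator x -> 0 <= dual_norm x.
Proof.
move=> bx; have [_ ub] := dual_has_sup bx; apply: le_trans (ub_le_sup ub _); last first.
  by exists 0 => //=; rewrite normr0 ler01.
by rewrite linear0 nc0.
Qed.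

Lemma dual_norm_le x h (B : R) : bounded_operator x -> 0 <= B -> `|h| <= B%:C ->
  normc (x h) <= dual_norm x * B.
Proof.
move=> bx B0 hB; have [_ ub] := dual_has_sup bx.
move: B0; rewrite le_eqVlt => /predU1P[B0|B0].
  move: hB; rewrite -B0 normr_le0 => /eqP ->.
  by rewrite linear0 nc0 mulr0.
have BC : (B%:C : C) != 0 by rewrite -nc_eq0 nc_real normr_eq0 gt_eqF.
rewrite -ler_pdivrMr// ; apply: ub_le_sup => //; exists (B%:C^-1 *: h).
  rewrite /= normrZ normcNE ncV nc_real gtr0_norm//.
  have -> : (1 : C) = (B^-1)%:C * B%:C by rewrite -rmorphM mulVf ?gt_eqF.
  by rewrite ler_wpM2l// lecR invr_ge0 ltW.
by rewrite linearZ ncM ncV nc_real gtr0_norm// mulrC.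
Qed.

(* Unimodular coefficients aligning the values x h_i turn the sum of moduli into a value of x. *)
Lemma dual_norm_sum (I : Type) (s : seq I) (m : I -> R) (h : I -> X) (K : R) x :
  bounded_operator x -> 0 <= K -> (forall i, 0 <= m i) ->
  (forall u : I -> C, (forall i, normc (u i) <= 1) ->
     `|\sum_(i <- s) ((m i)%:C * u i) *: h i| <= K%:C) ->
  \sum_(i <- s) m i * normc (x (h i)) <= dual_norm x * K.
Proof.
move=> bx K0 m0 H.
pose u i : C := if x (h i) == 0 then 0 else (normc (x (h i)))%:C / x (h i).
have u1 i : normc (u i) <= 1.
  rewrite /u; case: eqVneq => [_|n0]; first by rewrite nc0.
  by rewrite ncM ncV nc_real ger0_norm ?normc_ge0// mulfV// nc_eq0.
have ux i : u i * x (h i) = (normc (x (h i)))%:C.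
  by rewrite /u; case: eqVneq => [->|n0]; rewrite ?mul0r ?nc0// divfK.
have E : x (\sum_(i <- s) ((m i)%:C * u i) *: h i) =
    (\sum_(i <- s) m i * normc (x (h i)))%:C.
  rewrite linear_sum rmorph_sum; apply: eq_bigr => i _.
  by rewrite linearZ/= [RHS]rmorphM /= -ux /GRing.scale/= mulrA.
have := dual_norm_le bx K0 (H u u1); rewrite E nc_real; apply: le_trans; exact: ler_norm.
Qed.

End General.

Section NuclearSum.
Variables (X Y : normedModType C) (T : {linear X -> Y}).

(** [S] is the sum of the products of norms in the representation. For each functional the weighted
    sum of moduli is bounded by [dual_norm_sum]; exchanging the two sums gives the claim for
    truncations. *)
Lemma nuclear_sum : nuclear T -> exists2 S : R, 0 <= S &
  forall (I : Type) (s : seq I) (m : I -> R) (h : I -> X) (K : R),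
  0 <= K -> (forall i, 0 <= m i) ->
  (forall u : I -> C, (forall i, normc (u i) <= 1) ->
     `|\sum_(i <- s) ((m i)%:C * u i) *: h i| <= K%:C) ->
  \sum_(i <- s) m i * complex.Re `|T (h i)| <= S * K.
Proof.
move=> [xs [ys [bxs sumf cv]]].
pose nr k := complex.Re `|ys k|.
have nr0 k : 0 <= nr k by exact: Re_norm_ge0.
pose t k := dual_norm (xs k) * nr k.
have t0 k : 0 <= t k by rewrite mulr_ge0// dual_norm_ge0.
have tE : (forall k, (0 <= k)%N -> true -> (0%:E <= (t k)%:E)%E) by move=> k _ _; rewrite lee_fin.
pose S := fine (\sum_(0 <= k <oo) (t k)%:E)%E.
have SE : (\sum_(0 <= k <oo) (t k)%:E)%E = S%:E.
  by rewrite fineK// ge0_fin_numE//; apply: nneseries_ge0.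
have part N : \sum_(k < N) t k <= S.
  rewrite -lee_fin -SE -sumEFin -(big_mkord xpredT (fun k => (t k)%:E)).
  exact: nneseries_lim_ge.
have S0 : 0 <= S by have := part 0%N; rewrite big_ord0.
exists S => // I s m h K K0 m0 H.
apply/ler_addgt0Pl => e e0.
(* The list is finite, so one truncation index serves all its members. *)
have rem : exists N, \sum_(i <- s) m i * complex.Re `|T (h i) - series (fun k => xs k (h i) *: ys k) N| <= e.
  suff : forall d : R, 0 < d -> exists N0, forall N, (N0 <= N)%N -> \sum_(i <- s) m i * complex.Re `|T (h i) - series (fun k => xs k (h i) *: ys k) N| <= d.
    by move=> /(_ e e0)[N0 HN]; exists N0; exact: HN.
  elim: s {H} => [|i s IH] d d0; first by exists 0%N => N _; rewrite big_nil ltW.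
  have d2 : 0 < d / 2 by rewrite divr_gt0.
  have [N1 HN1] := IH _ d2.
  have mi : 0 < m i + 1 by rewrite ltr_wpDl.
  have dC : 0 < (d / 2 / (m i + 1))%:C :> C by rewrite ltcR divr_gt0.
  move/cvgrPdist_le : (cv (h i)) => /(_ _ dC)[N2 _ HN2].
  exists (maxn N1 N2) => N; rewrite geq_max => /andP[n1 n2].
  rewrite big_cons (splitr d) lerD ?HN1//.
  have := HN2 N n2; rewrite norm_ReC lecR => h1.
  apply: (@le_trans _ _ ((m i + 1) * (d / 2 / (m i + 1)))).
    by apply: ler_pM => //; [exact: Re_norm_ge0|rewrite lerDl].
  by rewrite mulrC divfK// gt_eqF.
have [N HN] := rem.
apply: (@le_trans _ _ (\sum_(i <- s) (m i * complex.Re `|T (h i) - series (fun k => xs k (h i) *: ys k) N| +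
   \sum_(k < N) m i * normc (xs k (h i)) * nr k))).
  apply: ler_sum => i _; under [X in _ + X]eq_bigr do rewrite -mulrA.
  rewrite -mulr_sumr -mulrDr ler_wpM2l//.
  rewrite -lecR rmorphD/= -!norm_ReC; apply: (@le_trans _ _ (`|T (h i) - series (fun k => xs k (h i) *: ys k) N| + `|series (fun k => xs k (h i) *: ys k) N|)).
    by rewrite -{1}(subrK (series (fun k => xs k (h i) *: ys k) N) (T (h i))) ler_normD.
  rewrite lerD2l seriesEord /=; apply: le_trans (ler_norm_sum _ _ _) _.
  rewrite rmorph_sum; apply: ler_sum => k _.
  by rewrite normrZ normcNE rmorphM/= -norm_ReC.
rewrite big_split/= lerD// exchange_big/=.
apply: (@le_trans _ _ (\sum_(k < N) t k * K)); last first.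
  by rewrite -mulr_suml ler_wpM2r.
apply: ler_sum => k _; rewrite -mulr_suml /t mulrAC ler_wpM2r//.
exact: dual_norm_sum.
Qed.
End NuclearSum.
End DualNorm.

(** * Kernels as test functions for the operator *)

Section TestFunctions.
Variable R : realType.
Local Notation C := R[i].
Local Notation qn := (qn R).
Implicit Types (nu mu : radial_weight R) (k : C -> C).

(* Elements of [Hinf] and [Hzero] vanish off the disk. *)
Definition dext k (w : C) : C := if normc w < 1 then k w else 0.

Lemma dextE k w : disk w -> dext k w = k w.
Proof. by move=> Dw; rewrite /dext ifT. Qed.

Lemma dext_cdiff k z A : disk z -> cdiff k z A -> cdiff (dext k) z A.
Proof.
move=> Dz; have z1 : 0 < 1 - normc z by rewrite subr_gt0.
apply: (cdiff_near z1) => w wz; rewrite dextE// /disk /mkset.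
have := normc_triangle (w - z) z; rewrite subrK => h.
by apply: le_lt_trans h _; rewrite -ltrBrDr.
Qed.

Lemma wl_vanish nu : (exists gamma, normal_exponent_II nu gamma) ->
  forall e : R, 0 < e -> exists n, wl nu n < e.
Proof.
move=> /wl_II[K [tau [K0 t0 t1 H]]] e e0.
have tt : 0 <= tau < 1 by rewrite ltW.
have e2 : 0 < e / 2 by rewrite divr_gt0.
have /cvgrPdist_le/(_ _ e2)[N _ HN] := @geo_cvg0 R tau (K * wl nu 0) tt.
exists N; apply: le_lt_trans (H 0%N N isT) _; rewrite subn0.
have := HN N (leqnn N); rewrite /= sub0r normrN ger0_norm; last first.
  by rewrite !mulr_ge0 ?exprn_ge0 ?ltW ?wl_gt0.
rewrite mulrAC => h; apply: le_lt_trans h _; rewrite ltr_pdivrMr//.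
by rewrite ltr_pMr// (_ : 2 = 1 + 1)// ltrDl.
Qed.

(** Condition (II) makes the weight tend to 0 at the boundary, so bounded analytic functions vanish
    there in the weighted sense. *)
Lemma dext_Hzero nu k (B : R) : (exists gamma, normal_exponent_II nu gamma) ->
  (forall z, disk z -> exists A, cdiff k z A) ->
  (forall z, disk z -> normc (k z) <= B) -> Hzero_set nu (dext k).
Proof.
move=> hII dk kB; split.
- by move=> z Dz; have [A /(dext_cdiff Dz)/cdiff_derivable[]] := dk z Dz.
- by move=> z Dz; rewrite /dext ifF//; apply/negP.
move=> e e0.
have B0 : 0 <= B by apply: le_trans (kB 0 (disk0 _)); rewrite normc_ge0.
have B1 : 0 < B + 1 by rewrite ltr_wpDl.
have [n Hn] := wl_vanish hII (divr_gt0 e0 B1).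
exists (rho R n); first exact: rho_lt1.
move=> z Dz rz; rewrite dextE//.
apply: (@le_lt_trans _ _ (wl nu n * (B + 1))).
  apply: ler_pM; rewrite ?normc_ge0//; first exact/ltW/weight_gt0.
    exact: wl_ge (ltW rz).
  by rewrite ler_wpDr// kB.
by rewrite -ltr_pdivlMr.
Qed.

End TestFunctions.

Section Operator.
Variable R : realType.
Local Notation C := R[i].
Local Notation qn := (qn R).
Variables (nu mu : radial_weight R).
Hypotheses (nun : normal nu) (mun : normal mu).
Variables (g phi : C -> C).
Hypotheses (ga : analytic g) (pa : analytic phi) (ps : self_map phi).
Variable T : {linear Hinf nu -> Hinf mu}.
Hypothesis TE : forall (f : Hinf nu) z, disk z -> T f z = int_op g phi f z.

Lemma comp_analytic (f : C -> C) : analytic f ->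
  analytic (fun w => f (phi w) * derive1 g w).
Proof.
move=> fa z Dz.
have c1 := cdiff_comp (analytic_cdiff pa Dz) (analytic_cdiff fa (ps Dz)).
have c2 := analytic_cdiff (analytic_derive1 ga) Dz.
by have [] := cdiff_derivable (cdiffM c1 c2).
Qed.

Lemma T_primitive (f : Hinf nu) : exists2 H : C -> C,
  (forall z, disk z -> cdiff H z (f (phi z) * derive1 g z)) &
  (forall z, disk z -> T f z = H z - H 0).
Proof.
have [fa _ _] := HinfP f.
have [H HH] := analytic_primitive (comp_analytic fa).
exists H => // z Dz; rewrite TE//.
exact: (@int_op_primitive R g phi f H z fa ga pa ps HH Dz).
Qed.

Lemma T_deriv (f : Hinf nu) z : disk z ->
  derive1 (T f) z = f (phi z) * derive1 g z.
Proof.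
move=> Dz; have [H HH HE] := T_primitive f.
have [Ta _ _] := HinfP (T f).
apply: (cdiff_uniq (analytic_cdiff Ta Dz)).
have z1 : 0 < 1 - normc z by rewrite subr_gt0.
apply: (@cdiff_near _ (fun w => H w - H 0) _ z _ _ z1).
  move=> w wz; rewrite HE// /disk /mkset.
  have := normc_triangle (w - z) z; rewrite subrK => h.
  by apply: le_lt_trans h _; rewrite -ltrBrDr.
rewrite -[X in cdiff _ _ X]subr0; apply: cdiffB; first exact: HH.
exact: cdiff_cst.
Qed.

(** Differentiation removes the integral: [(T f)' = f(phi) g'], and [Hinf_deriv_le] bounds the
    weighted derivative by the norm. *)
Lemma T_deriv_le : exists2 K : R, 0 < K & forall (f : Hinf nu) z, disk z ->
  (1 - normc z ^+ 2) * mu z * normc (derive1 g z) * normc (f (phi z)) <= K * complex.Re `|T f|.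
Proof.
have [muI _] := mun; have [K K0 HK] := Hinf_deriv_le muI.
exists K => // f z Dz; have := HK (T f) z Dz; rewrite T_deriv// ncM.
by rewrite [normc (f _) * _]mulrC mulrA.
Qed.

Lemma Hzero_eval_sum (I : Type) (s : seq I) (a : I -> C) (h : I -> Hzero nu) z :
  hzero_fun (\sum_(i <- s) a i *: h i) z = \sum_(i <- s) a i * h i z.
Proof.
elim: s => [|i s IH]; first by rewrite !big_nil.
by rewrite !big_cons -IH.
Qed.

Lemma kern_Hzero M n k :
  Hzero_set nu (dext (fun w => (1 - (node R n k)^* * w) ^- M.+2)).
Proof.
have [_ nuII] := nun.
apply: (@dext_Hzero R nu _ ((1 - Rn R n) ^- M.+2) nuII) => z Dz.
  have n0 : 1 - (node R n k)^* * z != 0 by rewrite -nc_gt0; exact: kern_neq0.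
  have c1 : cdiff (fun w => 1 - (node R n k)^* * w) z (0 - (0 * z + (node R n k)^* * 1)).
    by apply: cdiffB; [exact: cdiff_cst|apply: cdiffM; [exact: cdiff_cst|exact: cdiff_id]].
  have c2 := cdiff_comp c1 (@cdiffX R M.+2 _).
  eexists; apply: (@cdiffV _ (fun w => (1 - (node R n k)^* * w) ^+ M.+2) z); last exact: c2.
  by rewrite expf_neq0.
have R1 : 0 < 1 - Rn R n by rewrite subr_gt0 Rn_lt1.
rewrite ncV ncX lef_pV2 ?posrE ?exprn_gt0//; last exact: kern_neq0.
rewrite lerXn2r ?nnegrE ?(ltW R1) ?normc_ge0//.
apply: le_trans (nc_ge _ _); rewrite nc1 ncM nc_conj nc_node lerD2l lerN2.
by rewrite ler_piMr ?ltW// Rn_gt0.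
Qed.

(** [gam n k] is, up to a constant, the norm of [T] at the kernel of the node. [discrete_FR] bounds
    every unimodular combination of weighted kernels, as [nuclear_sum] requires. *)
Lemma test_sum beta M : normal_exponent_I nu beta -> beta < M.+1%:R ->
  nuclear (T \o @Hzero_incl R nu : {linear Hzero nu -> Hinf mu}) ->
  exists (gam : nat -> nat -> R) (B : R), [/\
   (forall n k, 0 <= gam n k),
   (forall n k z, disk z -> (1 - normc z ^+ 2) * mu z * normc (derive1 g z) *
       normc (1 - (node R n k)^* * phi z) ^- M.+2 <= gam n k) &
   forall m, \sum_(n < m) qn n ^+ M.+2 / wl nu n * \sum_(k < Nn n) gam n k <= B].
Proof.
move=> bI bM /nuclear_sum[S S0 HS].
have [K K0 HK] := discrete_FR nun bI bM.
have [L L0 HL] := T_deriv_le.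
pose h n k := MkHzero (introT (Hzero_predP nu _) (kern_Hzero M n k)).
pose gam n k := L * complex.Re `|T (Hzero_incl (h n k))|.
exists gam, (L * (S * K)); split.
- by move=> n k; apply: mulr_ge0; [exact: ltW|exact: Re_norm_ge0].
- move=> n k z Dz; have := HL (Hzero_incl (h n k)) z Dz.
  by rewrite /= dextE ?ncV ?ncX//; exact: ps.
move=> m.
pose s := [seq (n, k) | n <- iota 0 m, k <- iota 0 (Nn n)].
pose mm (p : nat * nat) := qn p.1 ^+ M.+2 / wl nu p.1.
have mm0 p : 0 <= mm p by rewrite divr_ge0 ?exprn_ge0 ?ltW ?qn_gt0 ?wl_gt0.
have sumE (V : nmodType) (F : nat * nat -> V) : \sum_(p <- s) F p = \sum_(n < m) \sum_(k < Nn n) F ((n : nat), (k : nat)).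
  rewrite big_allpairs_dep /=.
  have -> : iota 0 m = index_iota 0 m by rewrite /index_iota subn0.
  rewrite big_mkord; apply: eq_bigr => n _.
  have -> : iota 0 (Nn n) = index_iota 0 (Nn n) by rewrite /index_iota subn0.
  by rewrite big_mkord.
have := HS _ s mm (fun p => h p.1 p.2) K (ltW K0) mm0.
have pre : forall u : nat * nat -> C, (forall i, normc (u i) <= 1) ->
   `|\sum_(i <- s) ((mm i)%:C * u i) *: h i.1 i.2| <= K%:C.
  move=> u u1; rewrite [`|_|](_ : _ = (wnorm nu (hzero_fun (\sum_(i <- s) ((mm i)%:C * u i) *: h i.1 i.2)))%:C)//.
  rewrite lecR; apply: wnorm_le => z Dz.
  rewrite Hzero_eval_sum; apply: le_trans (HK m z Dz).
  rewrite ler_pM2l ?weight_gt0//; apply: le_trans (nc_sum _ _ _) _.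
  rewrite sumE; apply: ler_sum => n _; rewrite mulr_sumr; apply: ler_sum => k _.
  rewrite !ncM nc_real ger0_norm// /= dextE// ncV ncX -mulrA.
  by rewrite ler_wpM2l// ler_piMl ?u1// invr_ge0 exprn_ge0// normc_ge0.
move=> /(_ pre); rewrite sumE => h1.
rewrite -(ler_pM2l L0) in h1; apply: le_trans h1.
rewrite mulr_sumr; apply: ler_sum => n _.
rewrite mulr_sumr mulr_sumr; apply: ler_sum => k _.
by rewrite /mm /gam /= mulrCA.
Qed.

End Operator.

(** * From test functions to the integral *)

Section Ancestors.
Variable R : realType.
Local Notation C := R[i].
Local Notation qn := (qn R).
Implicit Types z w : C.

Lemma rdiff_expi t : rdiff (@expi R) t ('i * expi t).
Proof.
have h := cdiff_cexp (0 +i* t : C); rewrite /cexp /= expR0 mul1r in h.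
have := cdiff_vert h => h1 e e0; have [d d0 Hd] := h1 e e0.
by exists d => // s st; have := Hd s st; rewrite /cexp /= expR0 !mul1r.
Qed.

Lemma nci : normc ('i : C) = 1.
Proof. by rewrite /Normc.normc /= expr0n /= expr1n add0r sqrtr1. Qed.

Lemma expi_lip (a b : R) : normc (expi a - expi b) <= 2 * `|a - b|.
Proof.
wlog ab : a b / b <= a => [h|].
  by have [/h//|/ltW/h] := leP b a; rewrite ncB distrC.
have cc : ccont_on (fun t => 'i * expi t : C) b a.
  move=> t _ _ e e0; have [d d0 Hd] := @expi_cont R t e e0.
  exists d => // s st; rewrite -mulrBr ncM.
  by rewrite nci mul1r Hd.
rewrite -(cint_FTC ab (fun t _ _ => rdiff_expi t) cc) ger0_norm ?subr_ge0//.
have := @cint_bound R _ b a 1 ab cc; rewrite mulr1; apply => t _ _.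
by rewrite ncM nc_expi mulr1 nci.
Qed.

Lemma polar z : exists2 t : R, 0 <= t < pi *+ 2 & z = (normc z)%:C * expi t.
Proof.
have [->|z0] := eqVneq z 0.
  by exists 0; rewrite ?nc0 ?mul0r// lexx mulrn_wgt0// pi_gt0.
have n0 : 0 < normc z by rewrite nc_gt0.
have sq := nc_sq z.
set x := complex.Re z / normc z; set y := complex.Im z / normc z.
have xy : x ^+ 2 + y ^+ 2 = 1.
  by rewrite /x /y !expr_div_n -mulrDl -sq divff// expf_neq0// gt_eqF.
have x1 : -1 <= x <= 1.
  rewrite -ler_norml -(@ler_pXn2r _ 2)// ?nnegrE ?normr_ge0//.
  by rewrite real_normK ?num_real// expr1n -xy lerDl sqr_ge0.
have zE : z = (normc z)%:C * (x +i* y).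
  apply/eqP; rewrite eq_complex ReM ImM /= !mul0r subr0 addr0.
  have E (u : R) : normc z * (u / normc z) = u by rewrite mulrC divfK// gt_eqF.
  by rewrite (E (complex.Re z)) (E (complex.Im z)) !eqxx.
have [/andP[a0 ap] ax] := acos_def x1.
have s2 : sin (acos x) = `|y|.
  by rewrite sin_acos// -xy addrC addKr sqrtr_sqr.
have [y0|y0] := leP 0 y.
  exists (acos x).
    by rewrite a0 (le_lt_trans ap)// mulr2n ltrDl pi_gt0.
  by rewrite {1}zE /expi ax s2 ger0_norm.
exists (pi *+ 2 - acos x).
  rewrite subr_ge0 (le_trans ap) ?mulr2n ?lerDl ?pi_ge0//=.
  rewrite gtrBl lt_neqAle a0 andbT; apply/eqP => h.
  by move: s2; rewrite -h sin0 => /esym/eqP; rewrite normr_eq0 lt_eqF.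
have cE : cos (pi *+ 2 - acos x) = x.
  by rewrite addrC cosD cosN cos2pi sin2pi mulr0 subr0 mulr1.
have sE : sin (pi *+ 2 - acos x) = y.
  by rewrite addrC sinD sinN cosN cos2pi sin2pi mulr0 addr0 mulr1 s2 ltr0_norm// opprK.
by rewrite /expi cE sE.
Qed.

(** With [k] the integer part of the rescaled angle of [z], division of [k] by [2^(n-j)] gives the
    ancestor at level [j]. The radial error is at most [3 / 4] of [qn j], the angular one at most
    [1 / 4] of it. *)
Lemma cell_node z n : disk z -> 1 - normc z <= qn n ->
  exists2 k, (k < Nn n)%N &
  forall j, (j <= n)%N -> normc (z - node R j (k %/ 2 ^ (n - j))) <= qn j.
Proof.
move=> Dz zn; have [t /andP[t0 tpi] zE] := polar z.
have p0 : 0 < pi *+ 2 :> R by rewrite mulrn_wgt0// pi_gt0.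
have p8 : pi *+ 2 <= 8 :> R by have := pihalf_lt2 R; lra.
have Ngt m : 0 < (Nn m)%:R :> R by rewrite ltr0n Nn_gt0.
pose x : R := t / (pi *+ 2) * (Nn n)%:R.
have x0 : 0 <= x by rewrite mulr_ge0 ?divr_ge0// ltW.
pose k := Num.truncn x.
have /andP[kx xk] : k%:R <= x < k.+1%:R by exact: truncn_itv.
have kN : (k < Nn n)%N.
  rewrite -(ltr_nat R); apply: le_lt_trans kx _.
  by rewrite gtr_pMl// ltr_pdivrMr// mul1r.
exists k => // j jn.
set D := (2 ^ (n - j))%N; set l := (k %/ D)%N.
have D0 : (0 < D)%N by rewrite expn_gt0.
have D0' : 0 < D%:R :> R by rewrite ltr0n.
have NE : Nn n = (Nn j * D)%N by rewrite /Nn /D -expnD addnAC subnKC.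
have lk : l%:R * D%:R <= x by apply: le_trans kx; rewrite -natrM ler_nat leq_trunc_div.
have kl : x < (l%:R + 1) * D%:R.
  apply: lt_le_trans xk _; rewrite natr1 -natrM ler_nat.
  by rewrite ltn_ceil.
have xE : x = t / (pi *+ 2) * (Nn j)%:R * D%:R by rewrite /x NE natrM mulrA.
rewrite xE ler_pM2r// in lk; rewrite xE ltr_pM2r// in kl.
have tE : t = (pi *+ 2) * (t / (pi *+ 2)) by rewrite mulrC divfK// gt_eqF.
set y := t / (pi *+ 2) in lk kl tE.
have dist : `|t - pi *+ 2 * l%:R / (Nn j)%:R| <= qn j / 8.
  have -> : t - pi *+ 2 * l%:R / (Nn j)%:R = pi *+ 2 * (y * (Nn j)%:R - l%:R) / (Nn j)%:R.
    by rewrite mulrBr mulrBl mulrA mulfK ?gt_eqF// -tE.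
  rewrite ger0_norm; last by rewrite divr_ge0 ?mulr_ge0 ?subr_ge0// ltW.
  rewrite ler_pdivrMr// [X in _ <= X](_ : _ = 8); last first.
    by rewrite NnE; field; rewrite gt_eqF// qn_gt0.
  by apply: le_trans p8; rewrite ler_piMr ?(ltW p0)// lerBlDr addrC ltW.
rewrite {1}zE /node.
apply: (@le_trans _ _ (`|normc z - Rn R j| + Rn R j * (2 * (qn j / 8)))).
  apply: le_trans (nc_dist _ _ ((Rn R j)%:C * expi t)) _; rewrite lerD//.
    by rewrite -mulrBl -rmorphB ncM nc_expi mulr1 nc_real.
  rewrite -mulrBr ncM nc_real gtr0_norm ?Rn_gt0// ler_wpM2l//; first exact/ltW/Rn_gt0.
  by apply: le_trans (expi_lip _ _) _; rewrite ler_wpM2l.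
have h1 := @Rn_lt1 R j; have h2 := @Rn_gt0 R j; have h3 := qn_gt0 R j.
have h4 : Rn R j * (2 * (qn j / 8)) <= qn j / 4.
  rewrite (_ : 2 * (qn j / 8) = qn j / 4); last by field.
  by rewrite ler_piMl// ?divr_ge0// ltW.
have h5 : `|normc z - Rn R j| <= 3 / 4 * qn j.
  have := qn_le R jn; move: Dz zn; rewrite /disk /mkset /Rn => a b c.
  by rewrite ler_norml; apply/andP; split; clear -a b c h3; lra.
by clear -h4 h5; lra.
Qed.

(** One ancestor is enough: the one whose scale matches [x = |1 - z^* w|]. Moving [z] to it changes
    [x] by at most that scale. The sum over all ancestors spares a choice depending on [w]. *)
Lemma kernel_ancestors (s : R) M z w n (kap : nat -> nat) :
  0 <= s -> disk z -> disk w -> qn n.+1 < 1 - normc z ->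
  (forall j, (j <= n)%N -> normc (z - node R j (kap j)) <= qn j) ->
  (normc (1 - z^* * w) `^ s)^-1 <= 2 `^ s * 3 ^+ M.+2 *
    \sum_(j < n.+1) qn j ^+ M.+2 / qn j `^ s *
       normc (1 - (node R j (kap j))^* * w) ^- M.+2.
Proof.
move=> s0 Dz Dw zn Hk; set x := normc (1 - z^* * w).
have x1 : 1 - normc z <= x.
  apply: le_trans (nc_ge _ _); rewrite nc1 ncM nc_conj lerD2l lerN2.
  by rewrite ler_piMr ?normc_ge0// ltW.
have x2 : x <= 2.
  apply: le_trans (nc_sub _ _) _; rewrite nc1 ncM nc_conj.
  rewrite (_ : 2 = 1 + 1)// lerD2l mulr_ile1 ?normc_ge0// ltW//.
have ex : exists j, qn j.+1 < x by exists n; exact: lt_le_trans zn x1.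
(* The least [j] with [qn j.+1 < x] has [x <= 2 qn j]: by minimality if [j > 0], and by [x <= 2] if
   [j = 0]. *)
have jmin := ex_minnP ex; case: jmin => j xj jm.
have jn : (j <= n)%N by apply: jm; exact: lt_le_trans zn x1.
have xq : x <= 2 * qn j.
  case: j xj jm jn => [|j] xj jm jn; first by rewrite qn0 mulr1.
  have : x <= qn j.+1 by rewrite leNgt; apply/negP => /jm; rewrite ltnn.
  by move/le_trans; apply; rewrite ler_peMl ?(ltW (qn_gt0 _ _))// ler1n.
have qj := qn_gt0 R j.
have x0 : 0 < x by apply: lt_trans xj; exact: qn_gt0.
have xc : normc (1 - (node R j (kap j))^* * w) <= 3 * qn j.
  have -> : 1 - (node R j (kap j))^* * w = (1 - z^* * w) + (z - node R j (kap j))^* * w.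
    by rewrite rmorphB /= mulrBl; ring.
  apply: le_trans (normc_triangle _ _) _.
  rewrite (_ : 3 = 2 + 1); last by rewrite -natr1.
  rewrite mulrDl mul1r lerD// ncM nc_conj.
  by apply: le_trans (Hk j jn); rewrite ler_piMr ?normc_ge0// ltW.
have kp jj : 0 < normc (1 - (node R jj (kap jj))^* * w) by exact: kern_neq0.
have ps2 : 0 < 2 `^ s by rewrite powR_gt0.
have pq jj : 0 < qn jj `^ s by rewrite powR_gt0// qn_gt0.
rewrite (bigD1 (Ordinal (jn : (j < n.+1)%N)))//= mulrDr.
apply: ler_wpDr.
  apply: mulr_ge0; first by rewrite mulr_ge0 ?exprn_ge0// ltW.
  apply: sumr_ge0 => jj _; apply: mulr_ge0; last by rewrite invr_ge0 exprn_ge0// normc_ge0.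
  by rewrite divr_ge0 ?exprn_ge0 ?(ltW (pq _))// ltW// qn_gt0.
apply: (@le_trans _ _ (2 `^ s / qn j `^ s)).
  rewrite -[leRHS]invrK invf_div lef_pV2 ?posrE ?divr_gt0 ?powR_gt0//.
  rewrite ler_pdivrMr// mulrC; apply: powR_le_mul => //; try exact: ltW.
  by rewrite qnS ler_pM2l// ltW.
move: (kp j) xc; set k := normc _ => k0 xc; set P := qn j `^ s.
rewrite (_ : _ * 3 ^+ M.+2 * _ = 2 `^ s / P * (3 * qn j / k) ^+ M.+2); last first.
  by rewrite expr_div_n exprMn; ring.
rewrite ler_peMr ?divr_ge0 ?(ltW ps2) ?(ltW (pq _))// exprn_ege1//.
by rewrite ler_pdivlMr// mul1r.
Qed.

(** The exponent may have either sign, which is why both comparisons are assumed. *)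
Lemma powR_ratio (a c : R) : 1 <= c -> exists2 K : R, 0 < K &
  forall x q : R, 0 < x -> 0 < q -> x <= c * q -> q <= c * x ->
    x `^ a <= K * q `^ a.
Proof.
move=> c1; have c0 : 0 < c by apply: lt_le_trans c1.
have [a0|a0] := leP 0 a.
  exists (c `^ a) => [|x q x0 q0 xq _]; first by rewrite powR_gt0.
  by apply: powR_le_mul => //; exact: ltW.
exists (c `^ (- a)) => [|x q x0 q0 _ qx]; first by rewrite powR_gt0.
have := @powR_le_mul _ q c x (- a); rewrite !powRN !oppr_ge0.
move=> /(_ (ltW a0) (ltW q0) (ltW c0) (ltW x0) qx).
by rewrite ler_pdivlMr ?powR_gt0// mulrC ler_pdivrMr ?powR_gt0.
Qed.

(** On a dyadic annulus [1 - |z|^2] is within a factor 2 of [qn n], and condition (I) limits the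
    drop of the weight across one level. *)
Lemma weight_ratio nu (alpha : R) : normal nu -> exists2 K : R, 0 < K &
  forall n z, disk z -> qn n.+1 < 1 - normc z -> 1 - normc z <= qn n ->
    (1 - normc z ^+ 2) `^ alpha / nu z <= K * (qn n `^ alpha / wl nu n).
Proof.
move=> [[beta bI] _]; have [K1 K10 H1] := wl_I bI.
have c1 : 1 <= 2 :> R by rewrite ler1n.
have [K2 K20 H2] := @powR_ratio alpha 2 c1.
exists (K2 * (K1 * 2 `^ beta)).
  by rewrite !mulr_gt0// powR_gt0.
move=> n z Dz z1 z2; have qp := qn_gt0 R n; have qE := qnS R n.
have n0 := normc_ge0 z.
rewrite mulrACA; apply: ler_pM; rewrite ?powR_ge0 ?invr_ge0 ?(ltW (weight_gt0 _ _))//.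
  apply: H2 => //.
  - by rewrite subr_gt0 expr_lt1.
  - by move: n0 z2; clear; nra.
  - have r1 : normc z ^+ 2 <= normc z by rewrite ler_piMr// ltW.
    by move: r1 z1 qE; clear; lra.
rewrite -[leRHS]invrK invf_div lef_pV2 ?posrE ?divr_gt0 ?mulr_gt0 ?wl_gt0 ?powR_gt0 ?weight_gt0//.
rewrite ler_pdivrMr ?mulr_gt0 ?powR_gt0//.
apply: le_trans (H1 n n.+1 (leqnSn n)) _; rewrite subSnn expr1 mulrC ler_pM2r ?mulr_gt0 ?powR_gt0//.
by apply: wl_le; rewrite /rho; lra.
Qed.

End Ancestors.

(** * Integral bounds by step functions *)

Section MeasureTools.
Variables (d : measure_display) (T : measurableType d) (R : realType).
Variable m : {measure set T -> \bar R}.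
Local Open Scope ereal_scope.
Implicit Types (D : set T) (F G : T -> \bar R).

(* Unlike [ge0_le_integral], no measurability is required. *)
Lemma le_integral_ge0 D F G : (forall x, D x -> 0 <= F x) ->
  (forall x, D x -> F x <= G x) ->
  \int[m]_(x in D) F x <= \int[m]_(x in D) G x.
Proof.
move=> F0 FG; rewrite !(integral_mkcond D).
have r0 x : 0 <= (F \_ D) x by apply: erestrict_ge0.
have rG x : 0 <= (G \_ D) x.
  by apply: erestrict_ge0 => t Dt; exact: le_trans (F0 t Dt) (FG t Dt).
rewrite !ge0_integralTE//; apply: le_ereal_sup => _ [h hF <-].
by exists h => // x; apply: le_trans (hF x) _; apply: lee_restrict.
Qed.

Lemma measurable_weighted_indic (A : set T) (w : R) : measurable A ->
  measurable_fun setT ((fun x => w%:E * (\1_A x)%:E) : T -> \bar R).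
Proof.
move=> mA; apply: measurable_funeM; apply/measurable_EFinP; exact: measurable_indic.
Qed.

Lemma integral_weighted_indic (A : set T) (w : R) : measurable A -> (0 <= w)%R ->
  \int[m]_x (w%:E * (\1_A x)%:E) = w%:E * m A.
Proof.
move=> mA w0; rewrite ge0_integralZl//.
  by rewrite integral_indic// setIT.
by apply/measurable_EFinP; exact: measurable_indic.
Qed.

(** Disjointness leaves at most one nonzero term at each point, so the step function stays below
    [F]; [F] need not be measurable. *)
Lemma integral_lower (I : eqType) (s : seq I) (A : I -> set T) (w : I -> R) D F :
  uniq s -> (forall i, measurable (A i)) -> (forall i, 0 <= w i)%R ->
  (forall i j x, i \in s -> j \in s -> A i x -> A j x -> i = j) ->
  (forall i, i \in s -> A i `<=` D) ->
  (forall x, D x -> 0 <= F x) ->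
  (forall i x, i \in s -> A i x -> (w i)%:E <= F x) ->
  \sum_(i <- s) (w i)%:E * m (A i) <= \int[m]_(x in D) F x.
Proof.
move=> us mA w0 disj AD F0 AF.
have mw i : measurable_fun setT ((fun x => (w i)%:E * (\1_(A i) x)%:E) : T -> \bar R).
  exact: measurable_weighted_indic.
have mw0 i x : setT x -> 0 <= (w i)%:E * (\1_(A i) x)%:E.
  by move=> _; rewrite mule_ge0 ?lee_fin.
rewrite (integral_mkcond D).
under eq_bigr do rewrite -integral_weighted_indic//.
rewrite -ge0_integral_sum//; apply: le_integral_ge0 => x _.
  by apply: sume_ge0 => i _; exact: mw0.
have r0 : 0 <= (F \_ D) x by apply: erestrict_ge0.
have [[i si Aix]|none] := pselect (exists2 i, i \in s & A i x).
  rewrite (bigD1_seq i)//= big1_seq; last first.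
    move=> j /andP[ji sj]; rewrite indicE memNset ?mule0// => Ajx.
    by move: ji; rewrite (disj j i x) ?eqxx.
  by rewrite adde0 indicE mem_set// mule1 patchE mem_set; [exact: AF|exact: AD Aix].
rewrite big1_seq// => i /= si; rewrite indicE memNset ?mule0// => Aix.
by apply: none; exists i.
Qed.

(** The covering sets may overlap: [F] is dominated by the sum of all the weighted indicators, a
    measurable function to which monotone convergence applies. *)
Lemma integral_upper (A : nat -> nat -> set T) (N : nat -> nat) (w : nat -> nat -> R)
    D F (B : \bar R) :
  (forall n k, measurable (A n k)) -> (forall n k, 0 <= w n k)%R ->
  (forall x, D x -> 0 <= F x) ->
  (forall x, D x -> exists n, exists2 k, (k < N n)%N & A n k x /\ F x <= (w n k)%:E) ->
  (forall p, \sum_(0 <= n < p) \sum_(k < N n) (w n k)%:E * m (A n k) <= B) ->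
  \int[m]_(x in D) F x <= B.
Proof.
move=> mA w0 F0 cov bnd.
pose G n x := \sum_(k < N n) (w n k)%:E * (\1_(A n k) x)%:E.
have t0 n k x : 0 <= (w n k)%:E * (\1_(A n k) x)%:E by rewrite mule_ge0 ?lee_fin.
have G0 n x : 0 <= G n x by apply: sume_ge0.
have mG n : measurable_fun setT (G n).
  by apply: emeasurable_sum => k _; exact: measurable_weighted_indic.
have S0 x : 0 <= \sum_(0 <= n <oo) G n x by apply: nneseries_ge0 => n _ _.
apply: (@le_trans _ _ (\int[m]_x \sum_(0 <= n <oo) G n x)).
  rewrite integral_mkcond; apply: le_integral_ge0 => x _; first exact: erestrict_ge0.
  rewrite patchE; case: ifPn => [/set_mem Dx|_]; last exact: S0.
  have [n [k kN [Ax Fw]]] := cov x Dx; apply: le_trans Fw _.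
  apply: (@le_trans _ _ (G n x)).
    rewrite /G (bigD1 (Ordinal kN))//= indicE mem_set// mule1 leeDl//.
    exact: sume_ge0.
  apply: (@le_trans _ _ (\sum_(0 <= j < n.+1) G j x)).
    by rewrite big_nat_recr//= leeDr// sume_ge0.
  by apply: nneseries_lim_ge => j _ _; exact: G0.
rewrite integral_nneseries//.
apply: lime_le; first by apply: is_cvg_nneseries => n _ _; apply: integral_ge0 => x _; exact: G0.
apply: nearW => p; apply: le_trans (bnd p); apply: lee_sum => n _.
rewrite ge0_integral_sum//.
  by apply: lee_sum => k _; rewrite integral_weighted_indic.
by move=> k; exact: measurable_weighted_indic.
Qed.

End MeasureTools.

Section Boxes.
Variable R : realType.
Local Notation C := R[i].

Definition box (c : C) (r : R) : set (R * R) :=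
  `[complex.Re c - r, complex.Re c + r] `*` `[complex.Im c - r, complex.Im c + r].

Lemma measurable_box c r : measurable (box c r).
Proof. exact: measurableX. Qed.

Lemma box_measure c r : 0 < r ->
  (lebesgue_measure \x lebesgue_measure)%E (box c r) = ((2 * r) ^+ 2)%:E :> \bar R.
Proof.
move=> r0; have E a : lebesgue_measure (`[a - r, a + r] : set R) = (2 * r)%:E.
  by rewrite lebesgue_measure_itv/= lte_fin ler_ltD ?gtrN// -EFinB; congr EFin; ring.
rewrite product_measure1E//; apply: etrans (congr2 mule (E _) (E _)) _.
by rewrite -EFinM expr2.
Qed.

Lemma box_near c r x y : normc (x +i* y - c) <= r -> box c r (x, y).
Proof.
move=> h; split; rewrite /= in_itv /= -ler_distl.
  by apply: le_trans h; rewrite -[x]/(complex.Re (x +i* y)) -ReB Re_le_normc.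
by apply: le_trans h; rewrite -[y]/(complex.Im (x +i* y)) -ImB Im_le_normc.
Qed.

Lemma near_box c r x y : box c r (x, y) -> normc (x +i* y - c) <= 2 * r.
Proof.
move=> [] /=; rewrite !in_itv /= -!ler_distl => h1 h2.
by apply: le_trans (nc_ReIm _) _; rewrite ReB ImB /= mulrDl mul1r lerD.
Qed.

End Boxes.

(** * Summation over the ancestors of all cells *)

Section CoverSums.
Variable R : realType.
Local Notation C := R[i].
Local Notation qn := (qn R).
Implicit Types (nu mu : radial_weight R).

Lemma sum_divn (V : pzRingType) (N D : nat) (F : nat -> V) : (0 < D)%N ->
  \sum_(k < N * D) F (k %/ D)%N = D%:R * \sum_(k < N) F k.
Proof.
move=> D0; elim: N => [|N IH]; first by rewrite mul0n !big_ord0 mulr0.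
rewrite mulSn addnC big_split_ord /= IH big_ord_recr /= mulrDr; congr (_ + _).
rewrite (eq_bigr (fun=> F N)).
  by rewrite sumr_const card_ord mulr_natl.
by move=> i _; rewrite divnMDl// divn_small// addn0.
Qed.

(** The inner sums satisfy [Q n.+1 = t * Q n + b n]; adding these recurrences gives the bound. *)
Lemma geo_conv_le (t : R) (b : nat -> R) p : 0 <= t < 1 -> (forall j, 0 <= b j) ->
  \sum_(n < p) \sum_(j < n.+1) t ^+ (n - j) * b j <= (1 - t)^-1 * \sum_(j < p) b j.
Proof.
move=> /andP[t0 t1] b0.
pose Q p := \sum_(j < p) t ^+ (p - j.+1) * b j.
have Q0 n : 0 <= Q n by apply: sumr_ge0 => j _; rewrite mulr_ge0// exprn_ge0.
have QS n : Q n.+1 = t * Q n + b n.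
  rewrite /Q big_ord_recr /= subnn mul1r mulr_sumr; congr (_ + _).
  apply: eq_bigr => j _; rewrite mulrA -exprS; congr (t ^+ _ * _).
  by rewrite subSS -subSn// ltn_ord.
have E n : (1 - t) * \sum_(i < n) Q i.+1 + t * Q n = \sum_(j < n) b j.
  elim: n => [|n IH]; first by rewrite /Q !big_ord0 !mulr0 addr0.
  rewrite !big_ord_recr /= -IH mulrDr QS; ring.
rewrite ler_pdivlMl ?subr_gt0//.
apply: (@le_trans _ _ ((1 - t) * \sum_(i < p) Q i.+1)); last first.
  by rewrite -E lerDl mulr_ge0.
by rewrite ler_wpM2l ?subr_ge0 ?(ltW t1)//; apply: ler_sum.
Qed.

(** A node of level [j] is the ancestor of [2^(n-j)] nodes of level [n]. After exchanging the sums,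
    its contributions to deeper levels form a geometric series. *)
Lemma cover_sum nu beta (s : R) M (gam : nat -> nat -> R) (B : R) :
  normal_exponent_I nu beta -> beta + 1 < s -> (forall n k, 0 <= gam n k) ->
  (forall m, \sum_(n < m) qn n ^+ M.+2 / wl nu n * \sum_(k < Nn n) gam n k <= B) ->
  exists B' : R, forall p, \sum_(n < p) \sum_(k < Nn n) (qn n `^ s / wl nu n *
     \sum_(j < n.+1) qn j ^+ M.+2 / qn j `^ s * gam j (k %/ 2 ^ (n - j))%N) <= B'.
Proof.
move=> bI bs g0 HB; have [K K0 HK] := wl_I bI.
pose h : R := 2^-1 `^ s; pose lam : R := 2 `^ beta.
have h0 : 0 < h by rewrite powR_gt0.
have l0 : 0 < lam by rewrite powR_gt0.
(* Going one level deeper, the reciprocal weight costs [2^beta], the number of descendants doubles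
   and [qn n] to the power [s] gains [2^-s]; [beta + 1 < s] makes the product less than 1. *)
pose t := lam * 2 * h.
have t0 : 0 < t by rewrite !mulr_gt0.
have t1 : t < 1.
  have E : 2 `^ s * h = 1 by rewrite /h -powRM// divff// powR1.
  have lE : lam * 2 = 2 `^ (beta + 1) by rewrite powRD ?powRr1// (_ : (2 : R) != 0)// implybT.
  by rewrite -E /t ltr_pM2r// lE /powR pnatr_eq0 /= ltr_expR ltr_pM2r// ln_gt0// ltr1n.
have tt : 0 <= t < 1 by rewrite ltW.
pose G n := \sum_(k < Nn n) gam n k.
have G0 n : 0 <= G n by exact: sumr_ge0.
pose b n := qn n ^+ M.+2 / wl nu n * G n.
have qE n : qn n `^ s = h ^+ n by rewrite /qn powR_natX.
have b0 n : 0 <= b n by rewrite mulr_ge0// divr_ge0 ?exprn_ge0 ?ltW ?qn_gt0 ?wl_gt0.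
exists (K * ((1 - t)^-1 * B)) => p.
apply: (@le_trans _ _ (K * ((1 - t)^-1 * \sum_(j < p) b j))); last first.
  by rewrite ler_pM2l// ler_pM2l ?invr_gt0 ?subr_gt0.
apply: (@le_trans _ _ (K * (\sum_(n < p) \sum_(j < n.+1) t ^+ (n - j) * b j))); last first.
  by rewrite ler_pM2l// geo_conv_le.
rewrite mulr_sumr; apply: ler_sum => n _.
rewrite -mulr_sumr exchange_big /= mulr_sumr mulr_sumr; apply: ler_sum => j _.
have jn : (j <= n)%N by rewrite -ltnS ltn_ord.
rewrite -mulr_sumr.
have NE : Nn n = (Nn j * 2 ^ (n - j))%N by rewrite /Nn -expnD; congr (2 ^ _)%N; move: jn; clear; lia.
have sE : \sum_(i < Nn n) gam j (i %/ 2 ^ (n - j))%N = 2 ^+ (n - j) * G j.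
  by rewrite NE sum_divn ?expn_gt0// natrX.
rewrite sE !qE.
have hE : h ^+ n = h ^+ (n - j) * h ^+ j by rewrite -exprD subnK.
have hj : h ^+ j != 0 by rewrite expf_neq0// gt_eqF.
rewrite (_ : _ / _ * _ = (qn j ^+ M.+2 * G j) * ((2 * h) ^+ (n - j) / wl nu n)); last first.
  rewrite hE exprMn; field; by rewrite hj gt_eqF ?wl_gt0.
rewrite (_ : K * _ = (qn j ^+ M.+2 * G j) * ((2 * h) ^+ (n - j) * (K * lam ^+ (n - j) / wl nu j))); last first.
  by rewrite /t /b -mulrA exprMn; ring.
have qM : 0 <= qn j ^+ M.+2 by apply: exprn_ge0; exact/ltW/qn_gt0.
have h2 : 0 <= 2 * h by rewrite mulr_ge0// ltW.
apply: ler_wpM2l; first exact: mulr_ge0.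
apply: ler_wpM2l; first exact: exprn_ge0.
rewrite ler_pdivlMr ?wl_gt0// mulrC ler_pdivrMr ?wl_gt0//.
exact: HK.
Qed.

(** The boxes of half-side [qn n] around the nodes cover the disk, and on each the integrand is
    bounded through [kernel_ancestors] and [weight_ratio]; [cover_sum] bounds the total. *)
Lemma area_finite nu (alpha beta : R) M (gam : nat -> nat -> R) (B : R)
    (a : C -> R) (phi : C -> C) :
  normal nu -> normal_exponent_I nu beta -> beta - 1 < alpha ->
  (forall z, disk z -> 0 <= a z) -> self_map phi ->
  (forall n k, 0 <= gam n k) ->
  (forall n k z, disk z ->
     a z * normc (1 - (node R n k)^* * phi z) ^- M.+2 <= gam n k) ->
  (forall m, \sum_(n < m) qn n ^+ M.+2 / wl nu n * \sum_(k < Nn n) gam n k <= B) ->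
  (area_integral (fun zeta : C =>
     ereal_sup [set (a z / normc (1 - zeta^* * phi z) `^ (alpha + 2))%:E | z in @disk R]
     * ((1 - normc zeta ^+ 2) `^ alpha / nu zeta)%:E) < +oo)%E.
Proof.
move=> nun bI ba a0 ps g0 ag HB; set s := alpha + 2.
have beta0 : 0 < beta by case: bI.
have bs : beta + 1 < s by rewrite /s; lra.
have s0 : 0 <= s by rewrite ltW// (lt_trans _ bs)// ltr_wpDr// ltW.
have [B' HB'] := cover_sum bI bs g0 HB.
have [K K0 HK] := weight_ratio alpha nun.
pose A n k := \sum_(j < n.+1) qn j ^+ M.+2 / qn j `^ s * gam j (k %/ 2 ^ (n - j))%N.
have e0 j : 0 <= qn j ^+ M.+2 / qn j `^ s.
  by rewrite divr_ge0 ?powR_ge0// exprn_ge0// ltW// qn_gt0.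
have A0 n k : 0 <= A n k by apply: sumr_ge0 => j _; exact: mulr_ge0.
pose L : R := 2 `^ s * 3 ^+ M.+2.
have L0 : 0 < L by rewrite mulr_gt0 ?powR_gt0// exprn_gt0.
pose W n k := L * A n k * (K * (qn n `^ alpha / wl nu n)).
have kn n : 0 <= K * (qn n `^ alpha / wl nu n).
  by rewrite mulr_ge0 ?(ltW K0)// divr_ge0 ?powR_ge0// ltW// wl_gt0.
have W0 n k : 0 <= W n k by apply: mulr_ge0; [apply: mulr_ge0; [exact: ltW|]|].
set F := (X in area_integral X); rewrite /area_integral.
have sup0 zeta : disk zeta -> (0 <= ereal_sup [set (a z / normc (1 - zeta^* * phi z) `^ s)%:E | z in @disk R])%E.
  move=> Dz; apply: (@le_trans _ _ (a 0 / normc (1 - zeta^* * phi 0) `^ s)%:E).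
    by rewrite lee_fin divr_ge0 ?powR_ge0// a0//; exact: disk0.
  by apply: ereal_sup_ubound; exists 0 => //; exact: disk0.
have w0 zeta : disk zeta -> 0 <= (1 - normc zeta ^+ 2) `^ alpha / nu zeta.
  by move=> Dz; rewrite divr_ge0 ?powR_ge0// ltW// weight_gt0.
have F0 (p : R * R) : disk (p.1 +i* p.2) -> (0 <= F (p.1 +i* p.2))%E.
  by move=> Dp; rewrite /F mule_ge0 ?sup0// lee_fin w0.
have q0 n := qn_gt0 R n.
have := @integral_upper _ _ R (lebesgue_measure \x lebesgue_measure)%E
  (fun n k => box (node R n k) (qn n)) Nn W
  [set p : R * R | disk (p.1 +i* p.2)] (fun p => F (p.1 +i* p.2))
  (L * K * 4 * B')%:E (fun n k => measurable_box _ _) W0 F0.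
have cov (x : R * R) : [set p : R * R | disk (p.1 +i* p.2)] x ->
  exists n, exists2 k, (k < Nn n)%N & box (node R n k) (qn n) x /\ (F (x.1 +i* x.2) <= (W n k)%:E)%E.
  case: x => x y /= Dz; set z := x +i* y in Dz *.
  have [n [n1 n2]] := level Dz; have [k kN Hk] := cell_node Dz n2.
  exists n; exists k => //; split.
    by apply: box_near; have := Hk n (leqnn n); rewrite subnn divn1.
  suff h : (ereal_sup [set (a w / normc (1 - z^* * phi w) `^ s)%:E | w in @disk R] <= (L * A n k)%:E)%E.
    rewrite [leRHS](_ : _ = ((L * A n k)%:E * (K * (qn n `^ alpha / wl nu n))%:E)%E)//.
    apply: lee_pmul => //; first exact: sup0.
      by rewrite lee_fin w0.
    by rewrite lee_fin HK.
  apply: ge_ereal_sup => _ [w Dw <-]; rewrite lee_fin.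
  apply: (@le_trans _ _ (a w * (L * \sum_(j < n.+1) qn j ^+ M.+2 / qn j `^ s *
       normc (1 - (node R j (k %/ 2 ^ (n - j)))^* * phi w) ^- M.+2))).
    rewrite ler_wpM2l ?a0//.
    exact: (@kernel_ancestors R s M z (phi w) n (fun j => (k %/ 2 ^ (n - j))%N) s0 Dz (ps _ Dw) n1 Hk).
  rewrite mulrCA ler_pM2l// mulr_sumr; apply: ler_sum => j _.
  by rewrite mulrCA ler_wpM2l// ag.
move=> /(_ cov) H.
apply: (@le_lt_trans _ _ ((pi^-1)%:E * (L * K * 4 * B')%:E)%E); last exact: ltry.
apply: lee_wpmul2l; first by rewrite lee_fin invr_ge0 pi_ge0.
apply: H => p.
have E n : (\sum_(k < Nn n) (W n k)%:E * (lebesgue_measure \x lebesgue_measure)%E (box (node R n k) (qn n)) =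
   (\sum_(k < Nn n) L * K * 4 * (qn n `^ s / wl nu n * A n k))%:E)%E.
  rewrite -sumEFin; apply: eq_bigr => k _.
  apply: (etrans (congr1 (mule _) (box_measure (node R n k) (q0 n)))).
  rewrite -EFinM; congr EFin; rewrite /W.
  (* The area [4 qn^2] of the box turns the exponent [alpha] into [s = alpha + 2]. *)
  have -> : qn n `^ s = qn n `^ alpha * qn n ^+ 2.
    rewrite /s powRD; last by rewrite (gt_eqF (q0 n)) implybT.
    by congr (_ * _); rewrite powR_mulrn// ltW.
  by ring.
under eq_bigr do rewrite E.
rewrite sumEFin lee_fin big_mkord.
apply: (@le_trans _ _ (L * K * 4 * \sum_(n < p) \sum_(k < Nn n) (qn n `^ s / wl nu n * A n k))).
  by rewrite mulr_sumr; apply: ler_sum => n _; rewrite mulr_sumr.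
have LK : 0 <= L * K * 4 by apply: mulr_ge0 => //; apply: mulr_ge0; exact: ltW.
exact: ler_wpM2l LK _ _ (HB' p).
Qed.

End CoverSums.

(** * From the integral to sums over nodes *)

Section NodeSums.
Variable R : realType.
Local Notation C := R[i].
Local Notation qn := (qn R).
Implicit Types (nu mu : radial_weight R).

Lemma rt_node_dist n k l : (k < Nn n)%N -> (l < Nn n)%N -> k <> l ->
  qn n / 16 * (3 / 4) <= normc (node R n k - node R n l).
Proof.
move=> kN lN kl; rewrite /node -mulrBr ncM nc_real gtr0_norm ?Rn_gt0// mulrC.
have q0 := qn_gt0 R n.
apply: ler_pM; rewrite ?divr_ge0 ?(ltW q0)//; first exact: Rn_ge.
apply: le_trans (rt_dist R kN lN kl).
by rewrite -/(Nn n) NnE invf_div; lra.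
Qed.

(** With half-side [qn n / 128] two meeting boxes have centres within [qn n / 64 + qn n' / 64].
    Different levels are at least [1 / 8] of the larger scale apart; nodes of one circle are at
    least [3 / 64] of it apart. *)
Lemma node_boxes_disjoint n k n' k' p : (k < Nn n)%N -> (k' < Nn n')%N ->
  box (node R n k) (qn n / 128) p -> box (node R n' k') (qn n' / 128) p ->
  (n, k) = (n', k').
Proof.
case: p => x y kN kN' /near_box h1 /near_box h2.
have q0 m := qn_gt0 R m.
have d : normc (node R n k - node R n' k') <= qn n / 64 + qn n' / 64.
  have := nc_dist (node R n k) (node R n' k') (x +i* y).
  by move: h1 h2; rewrite (ncB _ (x +i* y)); lra.
have aux i j ki kj : (i < j)%N -> normc (node R i ki - node R j kj) <= qn i / 64 + qn j / 64 -> False.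
  move=> ij h; have := nc_ge (node R j kj) (node R i ki).
  rewrite ncB !nc_node /Rn; have := qn_le R ij; have := qnS R i; have := q0 i; have := q0 j.
  move: h; clear; lra.
case: (ltngtP n n') => [nn|nn|nn].
- by case: (aux _ _ _ _ nn d).
- by case: (aux _ _ k' k nn); rewrite ncB [leRHS]addrC.
subst n'; congr (_, _); apply/eqP; case: eqP => // kk.
have := rt_node_dist kN kN' kk; move: d; have := q0 n; clear; lra.
Qed.

(** The kernel at a node is at least [qn n / 4], while a move inside the box changes it by at most
    [qn n / 64]. *)
Lemma node_box_near n k x y : box (node R n k) (qn n / 128) (x, y) ->
  [/\ disk (x +i* y), rho R n <= normc (x +i* y),
   1 - normc (x +i* y) ^+ 2 <= 8 * qn n, qn n <= 8 * (1 - normc (x +i* y) ^+ 2) &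
   forall w, disk w -> normc (1 - (x +i* y)^* * w) <= 2 * normc (1 - (node R n k)^* * w)].
Proof.
move=> /near_box h; set z := x +i* y in h *; have q0 := qn_gt0 R n; have q1 := qn_le1 R n.
have h1 : normc (z - node R n k) <= qn n / 64 by move: h; clear; lra.
have h2 := nc_ge (node R n k) z; have h3 := nc_ge z (node R n k).
rewrite ncB nc_node in h2; rewrite nc_node in h3.
have r1 : normc z <= 1 - qn n * (15 / 64) by move: h3 h1; rewrite /Rn; clear; lra.
have r2 : 1 - qn n * (17 / 64) <= normc z by move: h2 h1; rewrite /Rn; clear; lra.
have n0 := normc_ge0 z.
split.
- by rewrite /disk /mkset; move: r1 q0; clear; lra.
- by rewrite /rho; move: r2 q0; clear; lra.
- by move: r2 q0 q1 n0; clear; nra.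
- have r3 : normc z ^+ 2 <= normc z by rewrite ler_piMr//; move: r1 q0; clear; lra.
  by move: r1 r3 q0; clear; lra.
move=> w Dw.
have -> : 1 - z^* * w = (1 - (node R n k)^* * w) - (z - node R n k)^* * w.
  by rewrite rmorphB /= mulrBl; ring.
apply: le_trans (nc_sub _ _) _; rewrite ncM nc_conj.
have b1 : normc (z - node R n k) * normc w <= qn n / 64.
  by apply: le_trans h1; rewrite ler_piMr ?normc_ge0// ltW.
have b2 : qn n / 4 <= normc (1 - (node R n k)^* * w).
  apply: le_trans (nc_ge _ _); rewrite nc1 ncM nc_conj nc_node.
  have : Rn R n * normc w <= Rn R n by rewrite ler_piMr ?ltW// Rn_gt0.
  by rewrite /Rn; clear; lra.
by move: b1 b2 q0; clear; lra.
Qed.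

Lemma node_kern_ge n k w : disk w -> qn n / 4 <= normc (1 - (node R n k)^* * w).
Proof.
move=> Dw; apply: le_trans (nc_ge _ _); rewrite nc1 ncM nc_conj nc_node.
have : Rn R n * normc w <= Rn R n by rewrite ler_piMr ?ltW// Rn_gt0.
by rewrite /Rn; clear; lra.
Qed.

(** A real supremum, unlike the extended one in the integrand; it is meaningful at nodes by
    [Gs_has_ub]. *)
Definition Gs (a : C -> R) (phi : C -> C) (s : R) (c : C) : R :=
  sup [set a z / normc (1 - c^* * phi z) `^ s | z in @disk R].

Section Gs.
Variables (nu : radial_weight R) (alpha A0 : R) (a : C -> R) (phi : C -> C).
Hypotheses (alpha_gt : -1 < alpha) (ps : self_map phi).
Hypotheses (a0 : forall z, disk z -> 0 <= a z) (aA : forall z, disk z -> a z <= A0).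
Let s := alpha + 2.
Let s0 : 0 <= s. Proof. by rewrite /s -lerBlDr; apply: ltW; apply: le_lt_trans alpha_gt; rewrite -subr_ge0 (_ : _ - _ = 1)//; ring. Qed.

Lemma Gs_has_ub n k : has_ubound [set a z / normc (1 - (node R n k)^* * phi z) `^ s | z in @disk R].
Proof.
exists (A0 / (qn n / 4) `^ s) => _ [z Dz <-].
have q4 : 0 < qn n / 4 by rewrite divr_gt0// qn_gt0.
apply: ler_pM; rewrite ?a0 ?aA ?invr_ge0 ?powR_ge0//.
have kp := kern_neq0 n k (ps Dz).
rewrite lef_pV2 ?posrE ?powR_gt0//.
apply: ge0_ler_powR; rewrite ?nnegrE ?(ltW q4) ?normc_ge0//.
exact: node_kern_ge (ps Dz).
Qed.

Lemma Gs_ge n k z : disk z ->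
  a z / normc (1 - (node R n k)^* * phi z) `^ s <= Gs a phi s (node R n k).
Proof. by move=> Dz; apply: ub_le_sup; [exact: Gs_has_ub|exists z]. Qed.

Lemma Gs_ge0 n k : 0 <= Gs a phi s (node R n k).
Proof.
by apply: le_trans (Gs_ge n k (@disk0 R)); rewrite divr_ge0 ?powR_ge0// a0//; exact: disk0.
Qed.

(** On the small box of a node the integrand stays above a fixed multiple of its value at the node;
    the boxes are disjoint, so the integral dominates the sum. *)
Lemma Gs_sum :
  (area_integral (fun zeta : C =>
     ereal_sup [set (a z / normc (1 - zeta^* * phi z) `^ s)%:E | z in @disk R]
     * ((1 - normc zeta ^+ 2) `^ alpha / nu zeta)%:E) < +oo)%E ->
  exists B : R, forall m, \sum_(n < m) (qn n `^ s / wl nu n *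
     \sum_(k < Nn n) Gs a phi s (node R n k)) <= B.
Proof.
set F := (X in area_integral X); rewrite /area_integral => fin.
set I := (\int[_]_(p in _) _)%E in fin.
have c1 : 1 <= 8 :> R by rewrite ler1n.
have [K K0 HK] := @powR_ratio R alpha 8 c1.
have p0 := @pi_gt0 R.
have q0 n := qn_gt0 R n.
have sup0 zeta : disk zeta -> (0 <= ereal_sup [set (a z / normc (1 - zeta^* * phi z) `^ s)%:E | z in @disk R])%E.
  move=> Dz; apply: (@le_trans _ _ (a 0 / normc (1 - zeta^* * phi 0) `^ s)%:E).
    by rewrite lee_fin divr_ge0 ?powR_ge0// a0//; exact: disk0.
  by apply: ereal_sup_ubound; exists 0 => //; exact: disk0.
have w0 zeta : disk zeta -> 0 < (1 - normc zeta ^+ 2) `^ alpha / nu zeta.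
  move=> Dz; rewrite divr_gt0 ?weight_gt0// powR_gt0// subr_gt0.
  by rewrite expr_lt1// normc_ge0.
have F0 (p : R * R) : disk (p.1 +i* p.2) -> (0 <= F (p.1 +i* p.2))%E.
  by move=> Dp; rewrite /F mule_ge0 ?sup0// lee_fin ltW// w0.
have I0 : (0 <= I)%E by apply: integral_ge0.
have Ifin : (I < +oo)%E.
  rewrite ltNge leye_eq; apply/eqP => IE; move: fin.
  by rewrite IE gt0_muley ?ltxx// lte_fin invr_gt0.
have [J JE] : exists J : R, I = J%:E.
  by exists (fine I); rewrite fineK// ge0_fin_numE.
pose W (p : nat * nat) := (2 `^ s)^-1 * Gs a phi s (node R p.1 p.2) * (K^-1 * (qn p.1 `^ alpha / wl nu p.1)).
have W0 p : 0 <= W p.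
  apply: mulr_ge0; first by rewrite mulr_ge0 ?invr_ge0 ?powR_ge0// Gs_ge0.
  by rewrite mulr_ge0 ?invr_ge0 ?(ltW K0)// divr_ge0 ?powR_ge0// ltW// wl_gt0.
exists (2 `^ s * K * 64 ^+ 2 * J) => m.
pose sq := [seq (n, k) | n <- iota 0 m, k <- iota 0 (Nn n)].
have sqE p : p \in sq -> (p.2 < Nn p.1)%N.
  by move=> /allpairsPdep[n [k [_ + ->]]]; rewrite mem_iota /= add0n.
have us : uniq sq.
  apply: allpairs_uniq_dep; first exact: iota_uniq.
    by move=> n _; exact: iota_uniq.
  by move=> [n k] [n' k'] _ _ [-> ->].
have sumE (V : nmodType) (G : nat * nat -> V) : \sum_(p <- sq) G p = \sum_(n < m) \sum_(k < Nn n) G ((n : nat), (k : nat)).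
  rewrite big_allpairs_dep /=.
  have -> : iota 0 m = index_iota 0 m by rewrite /index_iota subn0.
  rewrite big_mkord; apply: eq_bigr => n _.
  have -> : iota 0 (Nn n) = index_iota 0 (Nn n) by rewrite /index_iota subn0.
  by rewrite big_mkord.
have := @integral_lower _ _ R (lebesgue_measure \x lebesgue_measure)%E _ sq
  (fun p => box (node R p.1 p.2) (qn p.1 / 128)) W [set p : R * R | disk (p.1 +i* p.2)]
  (fun p => F (p.1 +i* p.2)) us (fun p => measurable_box _ _) W0.
have disj : forall (i j : nat * nat) (x : R * R), i \in sq -> j \in sq ->
   box (node R i.1 i.2) (qn i.1 / 128) x -> box (node R j.1 j.2) (qn j.1 / 128) x -> i = j.
  move=> [n k] [n' k'] x /sqE /= kN /sqE /= kN'; exact: node_boxes_disjoint.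
move=> /(_ disj).
have sub : forall i, i \in sq -> box (node R i.1 i.2) (qn i.1 / 128) `<=` [set p : R * R | disk (p.1 +i* p.2)].
  by move=> [n k] _ [x y] /= /node_box_near[].
move=> /(_ sub F0).
have low : forall (i : nat * nat) (x : R * R), i \in sq -> box (node R i.1 i.2) (qn i.1 / 128) x -> ((W i)%:E <= F (x.1 +i* x.2))%E.
  move=> [n k] [x y] _ /= /node_box_near[]; set z := x +i* y => Dz rz z1 z2 zw.
  have wz : K^-1 * (qn n `^ alpha / wl nu n) <= (1 - normc z ^+ 2) `^ alpha / nu z.
    have zp : 0 < 1 - normc z ^+ 2 by rewrite subr_gt0 expr_lt1// normc_ge0.
    rewrite mulrA; apply: ler_pM.
    - by rewrite mulr_ge0 ?powR_ge0// invr_ge0 ltW.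
    - by rewrite invr_ge0 ltW// wl_gt0.
    - by rewrite ler_pdivrMl// HK.
    - by rewrite lef_pV2 ?posrE ?wl_gt0 ?weight_gt0//; exact: wl_ge.
  apply: (@le_trans _ _ (((2 `^ s)^-1 * Gs a phi s (node R n k)) * ((1 - normc z ^+ 2) `^ alpha / nu z))%:E).
    rewrite lee_fin /W /=; apply: ler_wpM2l wz.
    by rewrite mulr_ge0 ?Gs_ge0// invr_ge0 powR_ge0.
  rewrite EFinM /F; apply: lee_wpmul2r; first by rewrite lee_fin ltW// w0.
  set X := ereal_sup _.
  have HX w : disk w -> (((2 `^ s)^-1 * (a w / normc (1 - (node R n k)^* * phi w) `^ s))%:E <= X)%E.
    move=> Dw; apply: (@le_trans _ _ (a w / normc (1 - z^* * phi w) `^ s)%:E); last first.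
      by apply: ereal_sup_ubound; exists w.
    have zk : 0 < normc (1 - z^* * phi w).
      have Dpw := ps Dw; apply: lt_le_trans (nc_ge _ _); rewrite nc1 subr_gt0 ncM nc_conj.
      by rewrite mulr_ilt1// normc_ge0.
    rewrite lee_fin mulrCA ler_wpM2l ?a0// -invfM lef_pV2 ?posrE ?mulr_gt0 ?powR_gt0 ?kern_neq0//; try exact: ps.
    by apply: powR_le_mul; rewrite ?normc_ge0//; exact: zw (ps Dw).
  (* The extended supremum may be infinite at individual points, where the comparison is trivial. *)
  case: X HX => [x0 HX| |HX]; last 2 first.
  - by move=> _; rewrite leey.
  - by have := HX 0 (@disk0 R).
  rewrite lee_fin ler_pdivrMl ?powR_gt0//; apply: ge_sup.
    by exists (a 0 / normc (1 - (node R n k)^* * phi 0) `^ s), 0 => //; exact: disk0.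
  by move=> _ [w Dw <-]; have := HX w Dw; rewrite lee_fin ler_pdivrMl ?powR_gt0.
move=> /(_ low); rewrite -/I JE.
have E p : ((W p)%:E * (lebesgue_measure \x lebesgue_measure)%E (box (node R p.1 p.2) (qn p.1 / 128)) =
   ((2 `^ s * K * 64 ^+ 2)^-1 * (qn p.1 `^ s / wl nu p.1 * Gs a phi s (node R p.1 p.2)))%:E)%E.
  have q128 : 0 < qn p.1 / 128 by apply: divr_gt0 (q0 _) _.
  apply: (etrans (congr1 (mule _) (box_measure (node R p.1 p.2) q128))).
  rewrite -EFinM; congr EFin; rewrite /W.
  have -> : qn p.1 `^ s = qn p.1 `^ alpha * qn p.1 ^+ 2.
    rewrite /s powRD; last by rewrite (gt_eqF (q0 p.1)) implybT.
    by congr (_ * _); rewrite powR_mulrn// ltW.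
  rewrite (_ : 2 * (qn p.1 / 128) = qn p.1 / 64); last by field.
  by field; rewrite !gt_eqF// ?wl_gt0// powR_gt0.
under eq_bigr do rewrite E.
rewrite sumEFin lee_fin sumE => h.
have L0 : 0 < 2 `^ s * K * 64 ^+ 2 by rewrite !mulr_gt0// ?powR_gt0// exprn_gt0.
rewrite -ler_pdivrMl//; apply: le_trans h.
rewrite mulr_sumr; apply: ler_sum => n _; rewrite mulr_sumr mulr_sumr.
by apply: ler_sum => k _.
Qed.

End Gs.

End NodeSums.

(** * Localised kernels *)

Section Kernels.
Variable R : realType.
Local Notation C := R[i].
Local Notation qn := (qn R).
Implicit Types (r s : R) (u w : C).

Definition vk r u : C := (1 - r%:C * u)^-1.
Definition xk r u : C := (1 - r)%:C * u * vk r u.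

(* [Pk M r u] = (1 - xk r u ^+ M) / (1 - u), by [Pk_1mu]: a regularisation of
   the Cauchy kernel, recovered as r tends to 1. *)
Fixpoint Pk M r u : C :=
  if M is M'.+1 then vk r u + xk r u * Pk M' r u else 0.

(** The quotient [(x^M - y^M) / (x - y)] with [x = xk r u] and [y = xk s u], written as a
    polynomial. *)
Fixpoint hk M r s u : C :=
  if M is M'.+1 then xk s u ^+ M' + xk r u * hk M' r s u else 0.

Lemma Pk_1mu M s u : 1 - s%:C * u != 0 -> (1 - u) * Pk M s u = 1 - xk s u ^+ M.
Proof.
move=> su; elim: M => [|M IH] /=; first by rewrite mulr0 expr0 subrr.
rewrite mulrDr mulrCA IH exprS mulrBr mulr1 addrA; congr (_ - _).
by rewrite /xk /vk rmorphB /=; field.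
Qed.

(** The difference [xk r u - xk s u] contains the factor [1 - u], which by [Pk_1mu] removes the
    singular denominator of [Pk]. The two factors [vk] and the powers of [xk] in [hk] produce the
    localisation. *)
Lemma Pk_sub M r s u : 1 - r%:C * u != 0 -> 1 - s%:C * u != 0 ->
  Pk M r u - Pk M s u = (r - s)%:C * u * vk r u * vk s u * hk M r s u.
Proof.
move=> ru su; elim: M => [|M IH] /=; first by rewrite subrr mulr0.
have -> : vk r u + xk r u * Pk M r u - (vk s u + xk s u * Pk M s u) =
   (vk r u - vk s u) + xk r u * (Pk M r u - Pk M s u) + (xk r u - xk s u) * Pk M s u by ring.
have -> : vk r u - vk s u = (r - s)%:C * u * vk r u * vk s u.
  by rewrite /vk rmorphB /=; field; rewrite ?ru ?su.
have -> : xk r u - xk s u = - ((r - s)%:C * u * vk r u * vk s u) * (1 - u).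
  by rewrite /xk /vk !rmorphB /=; field; rewrite ?ru ?su.
by rewrite IH -[_ * (1 - u) * _]mulrA (Pk_1mu _ su); ring.
Qed.

(* The j-th Taylor coefficient of [Pk M r]. *)
Fixpoint pk r (j : nat) : nat -> R :=
  if j is j'.+1 then
    fun M => if M is M'.+1 then r * pk r j' M + (1 - r) * pk r j' M' else 0
  else fun M => (0 < M)%:R.

Lemma pk0 r j : pk r j 0 = 0.
Proof. by case: j. Qed.

Lemma pk01 r j M : 0 <= r <= 1 -> 0 <= pk r j M <= 1.
Proof.
move=> /andP[r0 r1]; elim: j M => [|j IH] [|M] //=; rewrite ?ler01 ?lexx//.
have /andP[a0 a1] := IH M.+1; have /andP[b0 b1] := IH M.
have s0 : 0 <= 1 - r by rewrite subr_ge0.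
rewrite addr_ge0 ?mulr_ge0//=.
rewrite [leRHS](_ : 1 = r * 1 + (1 - r) * 1); last by ring.
by rewrite lerD// ler_wpM2l.
Qed.

Lemma pk_ge r j M : 0 <= r <= 1 -> r ^+ j <= pk r j M.+1.
Proof.
move=> r01; have /andP[r0 r1] := r01; elim: j => [|j IH] //=.
rewrite exprS -[X in X <= _]addr0 lerD// ?ler_wpM2l// mulr_ge0 ?subr_ge0//.
by have /andP[] := pk01 j M r01.
Qed.

Lemma pk_le r s M : 0 <= r <= 1 -> r < s -> exists2 K : R, 0 <= K &
  forall j, pk r j M <= K * s ^+ j.
Proof.
move=> r01 rs; have /andP[r0 r1] := r01; elim: M => [|M [K K0 IH]].
  by exists 0 => // j; rewrite pk0 mul0r.
have s0 : 0 < s by apply: le_lt_trans rs.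
have sr : 0 < s - r by rewrite subr_gt0.
exists (1 + (1 - r) * K / (s - r)).
  by rewrite addr_ge0// divr_ge0 ?(ltW sr)// mulr_ge0// subr_ge0.
set L := 1 + _; have L1 : 1 <= L.
  by rewrite lerDl divr_ge0 ?(ltW sr)// mulr_ge0// subr_ge0.
have LE : (1 - r) * K <= L * (s - r).
  by rewrite /L [leRHS]mulrDl divfK ?gt_eqF// lerDr mul1r ltW.
elim=> [|j IHj] /=; first by rewrite expr0 mulr1.
apply: (@le_trans _ _ (r * (L * s ^+ j) + (1 - r) * (K * s ^+ j))).
  by rewrite lerD// ler_wpM2l// subr_ge0.
have sj : 0 <= s ^+ j by rewrite exprn_ge0// ltW.
have := ler_wpM2r sj LE; rewrite exprS; clear; lra.
Qed.

(** The series converges beyond the unit disk, up to radius [1 / r]. This leaves room for [argk],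
    whose modulus may exceed 1. *)
Lemma Pk_csum M r s u : 0 <= r <= 1 -> r < s -> normc u * s < 1 ->
  csum (fun j => (pk r j M)%:C * u ^+ j) (Pk M r u).
Proof.
move=> r01 rs us; have /andP[r0 r1] := r01.
have s0 : 0 < s by apply: le_lt_trans rs.
have ru : 1 - r%:C * u != 0.
  rewrite -nc_gt0; apply: lt_le_trans (nc_ge _ _); rewrite nc1 subr_gt0 ncM nc_real ger0_norm//.
  by apply: le_lt_trans us; rewrite mulrC ler_wpM2l ?normc_ge0// ltW.
elim: M => [|M IH].
  apply: (eq_ccvg (u := fun=> 0)); last exact: ccvg_cst.
  by move=> n; rewrite big1// => i _; rewrite pk0 mul0r.
have [K K0 HK] := pk_le M.+1 r01 rs.
have [L HL] : exists L, csum (fun j => (pk r j M.+1)%:C * u ^+ j) L.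
  apply: (@abs_csum _ _ (K * (1 - normc u * s)^-1)) => n.
  have us0 : 0 <= normc u * s < 1 by rewrite us andbT mulr_ge0 ?normc_ge0// ltW.
  apply: le_trans (ler_wpM2l K0 (geo_sum_le n us0)); rewrite mulr_sumr.
  apply: ler_sum => j _; have /andP[p0 _] := pk01 j M.+1 r01.
  rewrite ncM nc_real ger0_norm// ncX exprMn mulrCA mulrC.
  by apply: ler_wpM2l => //; rewrite exprn_ge0// normc_ge0.
suff -> : Pk M.+1 r u = L by [].
(* The recursion of the coefficients becomes a linear equation for the sum, solved by the closed
   form of [Pk]. *)
have E : L = 1 + u * (r%:C * L + (1 - r)%:C * Pk M r u).
  apply: (ccvg_uniq HL).
  have c1 : csum (fun j => (pk r j.+1 M.+1)%:C * u ^+ j.+1) (u * (r%:C * L + (1 - r)%:C * Pk M r u)).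
    apply: (eq_ccvg _ (ccvgZ u (ccvgD (ccvgZ r%:C HL) (ccvgZ (1 - r)%:C IH)))) => n.
    rewrite !mulr_sumr -big_split /= mulr_sumr; apply: eq_bigr => j _.
    rewrite exprS [X in X * (u * _)](_ : _ =
      r%:C * (pk r j M.+1)%:C + (1 - r)%:C * (pk r j M)%:C); first by ring.
    by rewrite -!rmorphM -rmorphD.
  apply: (@ccvg_shift _ _ _ 1%N).
  apply: (eq_ccvg _ (ccvgD (ccvg_cst 1) c1)) => n.
  by rewrite addn1 big_ord_recl /= expr0 mulr1.
rewrite /= /xk /vk.
have L1 : (1 - r%:C * u) * L = 1 + (1 - r)%:C * u * Pk M r u.
  by rewrite mulrBl mul1r {1}E; ring.
apply: (mulfI ru); rewrite L1 mulrDr mulfV//; congr (_ + _).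
by field.
Qed.

(* Values of a factor at two neighbouring points, bounded by B with relative
   variation d; relative variations add up under products. *)
Definition near2 (B d : R) (p0 p1 : C) :=
  [/\ normc p0 <= B, normc p1 <= B & normc (p1 - p0) <= B * d].

Lemma near2_ge0 B d p0 p1 : near2 B d p0 p1 -> 0 <= B.
Proof. by case=> + _ _; apply: le_trans; exact: normc_ge0. Qed.

Lemma near2W B d B' d' p0 p1 : B <= B' -> d <= d' -> 0 <= d ->
  near2 B d p0 p1 -> near2 B' d' p0 p1.
Proof.
move=> BB dd d0 h; have B0 := near2_ge0 h; case: h => h0 h1 h2.
split; try exact: le_trans BB.
by apply: le_trans h2 _; apply: ler_pM.
Qed.

Lemma near2_cst (c : C) (d : R) : 0 <= d -> near2 (normc c) d c c.
Proof. by move=> d0; split=> //; rewrite subrr nc0 mulr_ge0// normc_ge0. Qed.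

Lemma near2D B B' d p0 p1 p0' p1' : near2 B d p0 p1 -> near2 B' d p0' p1' ->
  near2 (B + B') d (p0 + p0') (p1 + p1').
Proof.
case=> a0 a1 a2 [b0 b1 b2]; split.
- by apply: le_trans (normc_triangle _ _) _; exact: lerD.
- by apply: le_trans (normc_triangle _ _) _; exact: lerD.
rewrite opprD addrACA mulrDl; apply: le_trans (normc_triangle _ _) _; exact: lerD.
Qed.

Lemma near2M B B' d d' p0 p1 p0' p1' : near2 B d p0 p1 -> near2 B' d' p0' p1' ->
  near2 (B * B') (d + d') (p0 * p0') (p1 * p1').
Proof.
move=> h h'; have B0 := near2_ge0 h; have B0' := near2_ge0 h'.
case: h => a0 a1 a2; case: h' => b0 b1 b2; split.
- by rewrite ncM; apply: ler_pM; rewrite ?normc_ge0.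
- by rewrite ncM; apply: ler_pM; rewrite ?normc_ge0.
have -> : p1 * p1' - p0 * p0' = (p1 - p0) * p1' + p0 * (p1' - p0') by ring.
apply: le_trans (normc_triangle _ _) _; rewrite !ncM.
have -> : B * B' * (d + d') = B * d * B' + B * (B' * d') by ring.
by apply: lerD; apply: ler_pM; rewrite ?normc_ge0.
Qed.

Lemma near2X B d p0 p1 n : near2 B d p0 p1 -> near2 (B ^+ n) (n%:R * d) (p0 ^+ n) (p1 ^+ n).
Proof.
move=> h; elim: n => [|n IH].
  by rewrite !expr0 mul0r; split; rewrite ?nc1// subrr nc0 mulr0.
by rewrite !exprS -natr1 mulrDl mul1r [_ + d]addrC; exact: near2M.
Qed.

Lemma near2_vk r u0 u1 (B d D : R) : 0 <= r <= 1 ->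
  1 - r%:C * u0 != 0 -> 1 - r%:C * u1 != 0 ->
  (normc (1 - r%:C * u0))^-1 <= B -> (normc (1 - r%:C * u1))^-1 <= B ->
  normc (u1 - u0) <= D -> B * D <= d -> near2 B d (vk r u0) (vk r u1).
Proof.
move=> /andP[r0 r1] n0 n1 b0 b1 uD BD.
have B0 : 0 <= B by apply: le_trans b0; rewrite invr_ge0 normc_ge0.
have D0 : 0 <= D by apply: le_trans uD; exact: normc_ge0.
split; rewrite ?/vk ?ncV//.
have -> : (1 - r%:C * u1)^-1 - (1 - r%:C * u0)^-1 =
   (1 - r%:C * u0)^-1 * (1 - r%:C * u1)^-1 * (r%:C * (u1 - u0)).
  by field; rewrite n0 n1.
rewrite !ncM !ncV nc_real ger0_norm// -mulrA.
apply: ler_pM; rewrite ?invr_ge0 ?normc_ge0 ?mulr_ge0 ?invr_ge0 ?normc_ge0//.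
apply: le_trans BD; apply: ler_pM; rewrite ?invr_ge0 ?normc_ge0 ?mulr_ge0 ?normc_ge0//.
by apply: le_trans uD; rewrite ler_piMl ?normc_ge0.
Qed.

Lemma near2_hk M r s u0 u1 (B d : R) : 0 <= d ->
  near2 B d (xk r u0) (xk r u1) -> near2 B d (xk s u0) (xk s u1) ->
  near2 (M.+1%:R * B ^+ M) (M%:R * d) (hk M.+1 r s u0) (hk M.+1 r s u1).
Proof.
move=> d0 hr hs; have B0 := near2_ge0 hr.
elim: M => [|M IH].
  rewrite /= !expr0 !mulr0 !addr0 mul0r mulr1.
  by split; rewrite ?nc1// subrr nc0 mulr0.
have -> : M.+2%:R * B ^+ M.+1 = B ^+ M.+1 + B * (M.+1%:R * B ^+ M).
  by rewrite -[in LHS]natr1 exprS; ring.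
have h1 := near2X M.+1 hs.
have h2 := near2M hr IH.
apply: near2D => //.
by rewrite -[X in near2 _ X _ _](_ : d + M%:R * d = _)// -natr1; ring.
Qed.

(** For [r = 0] the kernel is the polynomial [1 + u + ... + u^(M-1)]. *)
Lemma near2_Pk0 M u0 u1 (d : R) : 0 <= d -> near2 2 d u0 u1 ->
  near2 (3 ^+ M) (M%:R * d) (Pk M 0 u0) (Pk M 0 u1).
Proof.
move=> d0 hu; elim: M => [|M IH] /=.
  by rewrite expr0 mul0r; split; rewrite ?subrr ?nc0 ?mulr0.
rewrite /xk /vk subr0 !mul0r !subr0 !invr1 !mulr1 !mul1r.
have h1 := near2_cst 1 (mulr_ge0 (ler0n R M.+1) d0); rewrite nc1 in h1.
have h2 := near2M hu IH.
have E : d + M%:R * d = M.+1%:R * d by rewrite -natr1; ring.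
rewrite E in h2.
have [h3 h4 h5] := near2D h1 h2.
apply: near2W (near2D h1 h2) => //; last exact: mulr_ge0.
rewrite exprS; have : 1 <= 3 ^+ M :> R by rewrite exprn_ege1// ler1n.
by clear; lra.
Qed.

End Kernels.

(** * Size and variation of the dyadic kernel differences *)

Section KernelBounds.
Variable R : realType.
Local Notation C := R[i].
Local Notation qn := (qn R).
Local Notation rho := (rho R).
Implicit Types (r s : R) (u w e : C).

Definition kap M n u : C :=
  if n is n'.+1 then Pk M (rho n) u - Pk M (rho n') u else Pk M 0 u.

(** [f] will be sampled at [(Rn R n)%:C * e], which multiplies its j-th coefficient by the j-th
    power of the radius; the division undoes this. *)
Definition argk n e w : C := e^* * w / (Rn R n)%:C.

Lemma RnC_neq0 n : (Rn R n)%:C != 0 :> C.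
Proof. by rewrite -nc_gt0 nc_real gtr0_norm ?Rn_gt0. Qed.

Lemma nc_argk n e w : normc e = 1 -> normc (argk n e w) = normc w / Rn R n.
Proof.
by move=> e1; rewrite /argk !ncM nc_conj e1 mul1r ncV nc_real gtr0_norm// Rn_gt0.
Qed.

Lemma argk_sub n e0 e1 w : disk w ->
  normc (argk n e1 w - argk n e0 w) <= 2 * normc (e1 - e0).
Proof.
move=> Dw; have R0 := Rn_gt0 R n; have R1 := Rn_ge R n.
rewrite /argk -!mulrBl -rmorphB /= !ncM nc_conj ncV nc_real gtr0_norm//.
rewrite ler_pdivrMr//; apply: (@le_trans _ _ (normc (e1 - e0) * 1)).
  by rewrite ler_wpM2l ?normc_ge0// ltW.
have := normc_ge0 (e1 - e0); move: R1; set x := normc _; clear; nra.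
Qed.

(** The range of [r] covers both [rho n] and the preceding radius. The two denominators differ by at
    most [3 qn n], and the one on the left is at least [3 / 4] of [qn n], so they are comparable. *)
Lemma kern_arg n k e w r : disk w -> normc e = 1 ->
  normc (e - rt R (Nn n) k) <= qn n / 4 -> 0 <= r ->
  1 - 2 * qn n <= r -> r <= 1 - qn n ->
  1 - r%:C * argk n e w != 0 /\
  (normc (1 - r%:C * argk n e w))^-1 <= 6 / normc (1 - (node R n k)^* * w).
Proof.
move=> Dw e1 ee r0 r1 r2; set X := normc _; set t := normc _.
have R0 := Rn_gt0 R n; have R1 := Rn_ge R n; have Rl := @Rn_lt1 R n.
have q0 := qn_gt0 R n; have q1 := qn_le1 R n.
have RE : Rn R n = 1 - qn n / 4 by [].
have X0 : 3 / 4 * qn n <= X.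
  apply: le_trans (nc_ge _ _); rewrite nc1 ncM nc_real ger0_norm// nc_argk//.
  have h : r * (normc w / Rn R n) <= r / Rn R n.
    by rewrite ler_wpM2l// ler_piMl ?invr_ge0 ?(ltW R0)// ltW.
  have h2 : r / Rn R n <= 1 - 3 / 4 * qn n.
    rewrite ler_pdivrMr// RE; move: r2 q0 q1; clear; nra.
  by move: h h2; clear; lra.
have tX : t <= X + 3 * qn n.
  have E : 1 - (node R n k)^* * w = (1 - r%:C * argk n e w) +
     w * ((r / Rn R n - Rn R n)%:C * e^* + (Rn R n)%:C * (e - rt R (Nn n) k)^*).
    have cE := node_conj R n k; have R3 := RnC_neq0 n.
    have E1 : (e - rt R (Nn n) k)^* = e^* - (rt R (Nn n) k)^* by exact: rmorphB.
    have E2 : (r / Rn R n - Rn R n)%:C = r%:C / (Rn R n)%:C - (Rn R n)%:C :> C.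
      by rewrite rmorphB rmorphM /= fmorphV.
    apply: etrans (congr1 (fun c => 1 - c * w) cE) _.
    apply: etrans (esym (congr1 (fun c => 1 - r%:C * argk n e w +
      w * ((r / Rn R n - Rn R n)%:C * e^* + (Rn R n)%:C * c)) E1)).
    by rewrite E2 /argk; field.
  rewrite /t E; apply: le_trans (normc_triangle _ _) _; rewrite lerD2l ncM.
  apply: (@le_trans _ _ (normc ((r / Rn R n - Rn R n)%:C * e^* + (Rn R n)%:C * (e - rt R (Nn n) k)^*))).
    by rewrite ler_piMl ?normc_ge0// ltW.
  apply: le_trans (normc_triangle _ _) _; rewrite !ncM !nc_conj e1 mulr1 !nc_real.
  rewrite (gtr0_norm R0).
  have h1 : Rn R n * normc (e - rt R (Nn n) k) <= qn n / 4.
    by apply: le_trans ee; rewrite ler_piMl ?normc_ge0// ltW.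
  have h2 : `|r / Rn R n - Rn R n| <= 11 / 4 * qn n.
    have f1 : r / Rn R n <= Rn R n.
      by rewrite ler_pdivrMr//; move: r2 q0 q1; rewrite RE; clear; nra.
    rewrite distrC ger0_norm ?subr_ge0// lerBlDr.
    have f2 : (Rn R n - 11 / 4 * qn n) <= r / Rn R n.
      by rewrite ler_pdivlMr//; move: r1 q0 q1; rewrite RE; clear; nra.
    by move: f2; clear; lra.
  by move: h1 h2; clear; lra.
have Xp : 0 < X by apply: lt_le_trans X0; rewrite mulr_gt0.
split; first by rewrite -nc_gt0.
have t0 : 0 < t by exact: kern_neq0.
rewrite ler_pdivlMr// ler_pdivrMl//; move: tX X0 q0; clear; lra.
Qed.

Lemma kap_near M : exists2 K : R, 0 < K & forall n k e0 e1 w (d : R),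
  disk w -> normc e0 = 1 -> normc e1 = 1 ->
  normc (e0 - rt R (Nn n) k) <= qn n / 4 ->
  normc (e1 - rt R (Nn n) k) <= qn n / 4 ->
  0 <= d -> normc (e1 - e0) <= d * qn n ->
  near2 (K * (qn n ^+ M.+1 / normc (1 - (node R n k)^* * w) ^+ M.+2)) (K * d)
    (kap M.+1 n (argk n e0 w)) (kap M.+1 n (argk n e1 w)).
Proof.
(* [a] collects a factor 2 for [u], [6^2] for the two [vk] and the bound of [hk]; [b] serves level
   0. *)
pose a : R := 72 * M.+1%:R * 24 ^+ M.
pose b : R := 3 ^+ M.+1 * 2 ^+ M.+2.
have a0 : 0 < a by rewrite !mulr_gt0// exprn_gt0.
have b0 : 0 < b by rewrite mulr_gt0// exprn_gt0.
have [m [mE m0]] : exists m : R, M%:R = m /\ 0 <= m by exists M%:R.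
have m1 : M.+1%:R = m + 1 :> R by rewrite -natr1 mE.
have [K [Ka Kb Kd1 Kd2]] : exists K, [/\ a <= K, b <= K, 97 + m * 49 <= K & m + 1 <= K].
  by exists (a + b + (98 + m * 50)); split; move: a0 b0 m0; clear; lra.
exists K; first exact: lt_le_trans Ka.
move=> n k e0 e1 w d Dw n0 n1 h0 h1 d0 hd.
have q0 := qn_gt0 R n; have q1 := qn_le1 R n.
have R0 := Rn_gt0 R n; have R1 := Rn_ge R n.
set u0 := argk n e0 w; set u1 := argk n e1 w.
set t := normc _; have t0 : 0 < t by exact: kern_neq0.
have tq : qn n <= 4 * t.
  by have := node_kern_ge n k Dw; rewrite -/t; clear; lra.
have t2 : t <= 2.
  apply: le_trans (nc_sub _ _) _; rewrite nc1 ncM nc_conj nc_node.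
  by rewrite (_ : 2 = 1 + 1)// lerD2l mulr_ile1 ?normc_ge0 ?ltW ?Rn_lt1.
have ub e : normc e = 1 -> normc (argk n e w) <= 2.
  move=> ne; rewrite nc_argk// ler_pdivrMr//; have w1 : normc w < 1 := Dw.
  by move: w1 R1; clear; lra.
have du : normc (u1 - u0) <= 2 * (d * qn n).
  by apply: le_trans (argk_sub n e0 e1 Dw) _; rewrite ler_pM2l.
have nu : near2 2 d u0 u1.
  split; rewrite ?ub//; apply: le_trans du _; by rewrite ler_pM2l// ler_piMr.
have K0 : 0 < K by apply: lt_le_trans Ka.
case: n q0 q1 R0 R1 @u0 @u1 @t t0 tq t2 h0 h1 hd ub du nu => [|n].
  (* At level 0 there is no difference to exploit, but there the kernel is bounded and [t <= 2]
     makes the right side bounded below. *)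
  move=> _ _ _ _ u0 u1 t t0 _ t2 _ _ _ _ _ nu.
  have := near2_Pk0 M.+1 d0 nu; apply: near2W.
  - rewrite qn0 expr1n mul1r ler_pdivlMr ?exprn_gt0//.
    apply: le_trans Kb; rewrite ler_pM2l ?exprn_gt0//.
    by rewrite lerXn2r ?nnegrE// ltW.
  - by rewrite ler_wpM2r// m1.
  - by rewrite mulr_ge0.
set N := n.+1 => q0 q1 R0 R1 u0 u1 t t0 tq t2 h0 h1 hd ub du nu.
have vnear r : 0 <= r -> 1 - 2 * qn N <= r -> r <= 1 - qn N ->
   near2 (6 / t) (48 * d) (vk r u0) (vk r u1).
  move=> r0 r1 r2.
  have [v0 b00] := kern_arg Dw n0 h0 r0 r1 r2.
  have [v1 b11] := kern_arg Dw n1 h1 r0 r1 r2.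
  have r01 : 0 <= r <= 1 by rewrite r0; move: r2 q0; clear; lra.
  apply: (near2_vk r01 v0 v1 b00 b11 du).
  rewrite mulrAC ler_pdivrMr//.
  by have := ler_wpM2l d0 tq; rewrite -/t; clear; lra.
have rN : 0 <= rho N by exact: rho_ge0.
have rn : 0 <= rho n by exact: rho_ge0.
have qE : qn n = 2 * qn N by exact: qnS.
have a1 : 1 - 2 * qn N <= rho N by rewrite /rho; move: q0; clear; lra.
have a2 : rho N <= 1 - qn N by [].
have a3 : 1 - 2 * qn N <= rho n by rewrite /rho qE.
have a4 : rho n <= 1 - qn N by rewrite /rho qE; move: q0; clear; lra.
have v1 := vnear _ rN a1 a2; have v2 := vnear _ rn a3 a4.
have xnear r : 0 <= r -> 1 - 2 * qn N <= r -> r <= 1 - qn N ->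
   near2 (24 * qn N / t) (49 * d) (xk r u0) (xk r u1).
  move=> r0 r1 r2; have v := vnear r r0 r1 r2.
  have c := near2_cst (1 - r)%:C (lexx (0 : R)).
  apply: near2W (near2M (near2M c nu) v).
  - rewrite nc_real ger0_norm; last by move: r2 q0; clear; lra.
    rewrite mulrA ler_pM2r ?invr_gt0//; move: r1; clear; lra.
  - by move: d0; clear; lra.
  - by move: d0; clear; lra.
have d49 : 0 <= 49 * d by rewrite mulr_ge0.
have hn := near2_hk M d49 (xnear _ rN a1 a2) (xnear _ rn a3 a4).
have c := near2_cst (rho N - rho n)%:C (lexx (0 : R)).
have fin := near2M (near2M (near2M (near2M c nu) v1) v2) hn.
have [n10 _] := kern_arg Dw n0 h0 rN a1 a2.
have [n20 _] := kern_arg Dw n0 h0 rn a3 a4.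
have [n11 _] := kern_arg Dw n1 h1 rN a1 a2.
have [n21 _] := kern_arg Dw n1 h1 rn a3 a4.
rewrite /kap -/u0 -/u1 /N Pk_sub// Pk_sub//.
have cE : normc (rho N - rho n)%:C = qn N.
  rewrite nc_real (_ : rho N - rho n = qn N) ?gtr0_norm//.
  by rewrite /rho qE; ring.
apply: near2W fin.
- rewrite cE -/N (_ : _ * _ = a * (qn N ^+ M.+1 / t ^+ M.+2)).
    by rewrite ler_pM2r// divr_gt0 ?exprn_gt0.
  have tn : t != 0 by rewrite gt_eqF.
  have tM : t ^+ M != 0 by rewrite expf_neq0.
  rewrite /a expr_div_n exprMn (exprSr t M.+1) (exprSr t M) (exprSr (qn N) M).
  by field; rewrite tn tM.
- rewrite (_ : _ + _ = (97 + m * 49) * d).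
    by rewrite ler_wpM2r.
  by rewrite mE; ring.
- by rewrite mE !addr_ge0 ?mulr_ge0.
Qed.

End KernelBounds.

(** * Reproduction of a function from means over roots of unity *)

Section Reproduction.
Variable R : realType.
Local Notation C := R[i].
Local Notation qn := (qn R).
Local Notation rho := (rho R).
Implicit Types (w e : C) (a : nat -> C).

Definition dk M n j : R :=
  if n is n'.+1 then pk (rho n) j M - pk (rho n') j M else pk 0 j M.

Lemma rho01 n : 0 <= rho n <= 1.
Proof. by rewrite rho_ge0 ltW// rho_lt1. Qed.

Lemma rho_Rn n : rho n < Rn R n.
Proof. by rewrite /rho /Rn ler_ltB// ltr_pdivrMr// ltr_pMr ?qn_gt0// ltr1n. Qed.

Lemma dk_sum M m j : \sum_(n < m.+1) dk M n j = pk (rho m) j M.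
Proof.
elim: m => [|m IH].
  by rewrite big_ord_recl big_ord0 addr0 /= /rho qn0 subrr.
by rewrite big_ord_recr /= IH addrC subrK.
Qed.

Lemma dk_le M n : exists2 K : R, 0 <= K & forall j, `|dk M n j| <= K * Rn R n ^+ j.
Proof.
case: n => [|n].
  have z01 : 0 <= (0 : R) <= 1 by rewrite lexx ler01.
  have [K K0 HK] := pk_le M z01 (Rn_gt0 R 0).
  exists K => // j; rewrite ger0_norm ?HK//.
  by have /andP[] := pk01 j M z01.
have r2 : rho n < Rn R n.+1.
  by apply: le_lt_trans (rho_Rn n.+1); exact: rho_le.
have [K K0 HK] := pk_le M (rho01 n.+1) (rho_Rn n.+1).
have [L L0 HL] := pk_le M (rho01 n) r2.
exists (K + L) => [|j]; first exact: addr_ge0.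
apply: le_trans (ler_normB _ _) _; rewrite mulrDl lerD//.
- by rewrite ger0_norm ?HK//; have /andP[] := pk01 j M (rho01 n.+1).
- by rewrite ger0_norm ?HL//; have /andP[] := pk01 j M (rho01 n).
Qed.

Lemma kap_csum M n e w : disk w -> normc e = 1 ->
  csum (fun j => (dk M n j)%:C * argk n e w ^+ j) (kap M n (argk n e w)).
Proof.
move=> Dw e1; have R0 := Rn_gt0 R n.
have uR : normc (argk n e w) * Rn R n < 1 by rewrite nc_argk// divfK ?gt_eqF.
case: n R0 uR => [|n] R0 uR.
  by apply: (Pk_csum _ _ R0 uR); rewrite lexx ler01.
have r2 : rho n < Rn R n.+1.
  by apply: le_lt_trans (rho_Rn n.+1); exact: rho_le.
have c1 := Pk_csum M (rho01 n.+1) (rho_Rn n.+1) uR.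
have c2 := Pk_csum M (rho01 n) r2 uR.
apply: (eq_ccvg _ (ccvgB c1 c2)) => m /=.
by rewrite -sumrB; apply: eq_bigr => j _; rewrite -mulrBl -rmorphB.
Qed.

Lemma csum_sum (I : finType) (u : I -> nat -> C) (l : I -> C) :
  (forall i, csum (u i) (l i)) -> csum (fun j => \sum_i u i j) (\sum_i l i).
Proof.
move=> H; suff h (s : seq I) : csum (fun j => \sum_(i <- s) u i j) (\sum_(i <- s) l i) by exact: h.
elim: s => [|i s IH].
  rewrite big_nil; apply: (eq_ccvg (u := fun=> 0)); last exact: ccvg_cst.
  by move=> n; rewrite big1// => j _; rewrite big_nil.
rewrite big_cons; apply: (eq_ccvg _ (ccvgD (H i) IH)) => n.
by rewrite -big_split /=; apply: eq_bigr => j _; rewrite big_cons.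
Qed.

Lemma geo_tail_le (q : R) N m : 0 <= q < 1 ->
  \sum_(j < m) (N <= j)%N%:R * q ^+ j <= q ^+ N * (1 - q)^-1.
Proof.
move=> /andP[q0 q1]; have s0 : 0 < 1 - q by rewrite subr_gt0.
have E : (1 - q) * \sum_(j < m) (N <= j)%N%:R * q ^+ j = if (N <= m)%N then q ^+ N - q ^+ m else 0.
  elim: m => [|m IH].
    rewrite big_ord0 mulr0 leqn0; case: eqP => [->|//]; first by rewrite subrr.
  rewrite big_ord_recr /= mulrDr IH.
  have [Nm|mN] := leqP N m.
    by rewrite (leqW Nm) mul1r (exprS q m); ring.
  rewrite mul0r mulr0 addr0; have [Nm|//] := leqP N m.+1.
  have -> : N = m.+1 by apply/eqP; rewrite eqn_leq Nm.
  by rewrite subrr.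
rewrite mulrC ler_pdivlMl// E; case: ifP => _; last exact: exprn_ge0.
by rewrite gerBl exprn_ge0.
Qed.

Section Alias.
Variables (f : C -> C) (a : nat -> C) (n M : nat) (w : C).
Hypotheses (ta : tame a) (Dw : disk w).
Hypothesis fa : forall w, normc w < 1 -> csum (fun j => a j * w ^+ j) (f w).

Definition rmean (g : C -> C) p : C :=
  ((2 ^ p)%:R)^-1 * \sum_(k < 2 ^ p) g (rt R (2 ^ p) k).

Lemma nc_rmean (g : C -> C) p (B : R) : (forall e, normc e = 1 -> normc (g e) <= B) ->
  normc (rmean g p) <= B.
Proof.
move=> H; rewrite /rmean ncM ncV nc_natr ler_pdivrMl ?ltr0n ?expn_gt0//.
apply: le_trans (nc_sum _ _ _) _.
apply: (@le_trans _ _ (\sum_(k < 2 ^ p) B)).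
  by apply: ler_sum => k _; apply: H; exact: nc_rt.
by rewrite sumr_const card_ord mulr_natl.
Qed.

Lemma rmean_orth p i j : (i < 2 ^ p)%N -> (j < 2 ^ p)%N ->
  rmean (fun e => e ^+ i * e^* ^+ j) p = (i == j)%:R.
Proof.
move=> ip jp; have N0 : ((2 ^ p)%:R : C) != 0 by rewrite pnatr_eq0 expn_eq0.
have ee k : rt R (2 ^ p) k * (rt R (2 ^ p) k)^* = 1.
  by apply: etrans (congr1 ( *%R _) (rt_conj R (2 ^ p) k)) _; rewrite mulfV// rt_neq0.
have [->|ij] := eqVneq i j.
  rewrite /rmean (eq_bigr (fun=> 1)); last by move=> k _; rewrite -exprMn ee expr1n.
  by rewrite sumr_const card_ord mulVf.
have nd d : (0 < d < 2 ^ p)%N -> (2 ^ p %| d)%N = false.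
  by move=> /andP[d0 d1]; apply/negbTE; rewrite gtnNdvd.
rewrite /rmean; have [lt|le] := ltnP i j.
  have ijE : (j = i + (j - i))%N by rewrite subnKC// ltnW.
  have jd : (0 < j - i < 2 ^ p)%N by rewrite subn_gt0 lt (leq_ltn_trans _ jp)// leq_subr.
  rewrite [X in _ * X](_ : _ = 0) ?mulr0//.
  have h := rt_conj_orth R p (j - i); rewrite nd// in h.
  apply: etrans h; apply: eq_bigr => k _.
  by rewrite {1}ijE exprD mulrA -exprMn ee expr1n mul1r.
have lt : (j < i)%N by rewrite ltn_neqAle eq_sym ij.
have ijE : (i = (i - j) + j)%N by rewrite subnK.
have jd : (0 < i - j < 2 ^ p)%N by rewrite subn_gt0 lt (leq_ltn_trans _ ip)// leq_subr.
rewrite [X in _ * X](_ : _ = 0) ?mulr0//.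
have h := rt_orth R p (i - j); rewrite nd// in h.
apply: etrans h; apply: eq_bigr => k _.
by rewrite {1}ijE exprD -mulrA -exprMn ee expr1n mulr1 rtX.
Qed.

Lemma rmean_csum (u : nat -> C -> C) (g : C -> C) p :
  (forall e, normc e = 1 -> csum (fun j => u j e) (g e)) ->
  csum (fun j => rmean (u j) p) (rmean g p).
Proof.
move=> H.
have h := csum_sum (fun k : 'I_(2 ^ p) => H (rt R (2 ^ p) k) (nc_rt _ _ _)).
apply: (eq_ccvg _ (ccvgZ ((2 ^ p)%:R)^-1 h)) => m.
by rewrite mulr_sumr.
Qed.

(** In the mean of the product of two power series only equal exponents survive, apart from aliased
    terms. As the mesh is refined these vanish and the diagonal sum, the convolution of [f] with
    [kap M n], remains. *)
Lemma alias : exists2 L : C, csum (fun j => a j * (dk M n j)%:C * w ^+ j) L &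
  ccvg (rmean (fun e => f ((Rn R n)%:C * e) * kap M n (argk n e w))) L.
Proof.
have R0 := Rn_gt0 R n; have R1 := @Rn_lt1 R n; have RC := RnC_neq0 R n.
have R01 : 0 <= Rn R n < 1 by rewrite (ltW R0).
have [B [q [B0 q01 Hb]]] := tame_coef ta R01.
have /andP[q0 q1] := q01.
have [K K0 HK] := dk_le M n.
pose t := normc w; have t01 : 0 <= t < 1 by rewrite normc_ge0.
have /andP[t0 t1] := t01.
pose b j := a j * (Rn R n)%:C ^+ j.
pose c j := (dk M n j)%:C * (w / (Rn R n)%:C) ^+ j.
have nb j : normc (b j) <= B * q ^+ j.
  by rewrite ncM ncX nc_real gtr0_norm.
have nc j : normc (c j) <= K * t ^+ j.
  rewrite ncM nc_real ncX ncM ncV nc_real (gtr0_norm R0) expr_div_n mulrA.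
  by rewrite ler_pdivrMr ?exprn_gt0// mulrAC ler_wpM2r// exprn_ge0// normc_ge0.
have qj j : q ^+ j <= 1 by rewrite exprn_ile1// ltW.
pose F := B * (1 - q)^-1.
have F0 : 0 <= F by rewrite mulr_ge0// invr_ge0 subr_ge0 ltW.
have fe e : normc e = 1 -> csum (fun j => b j * e ^+ j) (f ((Rn R n)%:C * e)).
  move=> e1; have De : normc ((Rn R n)%:C * e) < 1 by rewrite ncM e1 mulr1 nc_real gtr0_norm.
  apply: (eq_ccvg _ (fa De)) => m; apply: eq_bigr => j _.
  by rewrite /b exprMn mulrA.
have fF e : normc e = 1 -> normc (f ((Rn R n)%:C * e)) <= F.
  move=> e1; apply: (csum_norm_le _ (fe e e1)) => m.
  apply: le_trans (ler_wpM2l B0 (geo_sum_le m q01)); rewrite mulr_sumr.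
  by apply: ler_sum => j _; rewrite ncM ncX e1 expr1n mulr1.
(* A discrete Fourier coefficient of [f] on the circle; it differs from [b j] only through
   coefficients of index at least [2 ^ p]. *)
pose A j p := rmean (fun e => f ((Rn R n)%:C * e) * e^* ^+ j) p.
have AF j p : normc (A j p) <= F.
  apply: nc_rmean => e e1; rewrite ncM ncX nc_conj e1 expr1n mulr1; exact: fF.
have Ab j p : (j < 2 ^ p)%N -> normc (A j p - b j) <= F * q ^+ (2 ^ p).
  move=> jp.
  have cA : csum (fun i => b i * rmean (fun e => e ^+ i * e^* ^+ j) p) (A j p).
    have := @rmean_csum (fun i e => b i * (e ^+ i * e^* ^+ j)) _ p _.
    move=> /(_ (fun e => f ((Rn R n)%:C * e) * e^* ^+ j)) h.
    have h1 : forall e, normc e = 1 -> csum (fun i => b i * (e ^+ i * e^* ^+ j)) (f ((Rn R n)%:C * e) * e^* ^+ j).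
      move=> e e1; rewrite mulrC; apply: (eq_ccvg _ (ccvgZ (e^* ^+ j) (fe e e1))) => m.
      by rewrite mulr_sumr; apply: eq_bigr => i _; ring.
    apply: (eq_ccvg _ (h h1)) => m; apply: eq_bigr => i _.
    by rewrite /rmean -mulr_sumr mulrCA.
  apply: (ccvg_bound _ (ccvgB cA (ccvg_cst (b j)))); exists j.+1 => m jm.
  have -> : b j = \sum_(i < m) b i * (nat_of_ord i == j)%:R.
    rewrite (bigD1 (Ordinal jm))//= eqxx mulr1 big1 ?addr0// => i.
    by rewrite -val_eqE /= => /negPf ->; rewrite mulr0.
  rewrite -sumrB; apply: le_trans (nc_sum _ _ _) _.
  rewrite /F mulrAC -mulrA; apply: le_trans (ler_wpM2l B0 (@geo_tail_le q (2 ^ p) m q01)).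
  rewrite mulr_sumr; apply: ler_sum => i _; rewrite -mulrBr ncM.
  have [ip|ip] := leqP (2 ^ p) i.
    rewrite mul1r (_ : (nat_of_ord i == j) = false) ?subr0; last first.
      by apply/eqP => ij; move: jp; rewrite -ij ltnNge ip.
    rewrite -[leRHS]mulr1; apply: ler_pM; rewrite ?normc_ge0//.
    by apply: nc_rmean => e e1; rewrite ncM !ncX nc_conj e1 !expr1n mulr1.
  by rewrite rmean_orth// subrr nc0 mulr0 mul0r mulr0.
have [L HL] : exists L, csum (fun j => c j * b j) L.
  apply: (@abs_csum _ _ (K * B * (1 - t)^-1)) => m.
  apply: le_trans (ler_wpM2l (mulr_ge0 K0 B0) (geo_sum_le m t01)); rewrite mulr_sumr.
  apply: ler_sum => j _; rewrite ncM -mulrA [B * _]mulrC mulrA.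
  apply: ler_pM; rewrite ?normc_ge0//.
  by apply: le_trans (nb j) _; rewrite ler_piMr.
exists L.
  apply: (eq_ccvg _ HL) => m; apply: eq_bigr => j _.
  by rewrite /c /b expr_div_n; field; rewrite expf_neq0.
have mE p : csum (fun j => c j * A j p)
    (rmean (fun e => f ((Rn R n)%:C * e) * kap M n (argk n e w)) p).
  have h := @rmean_csum (fun j e => c j * (f ((Rn R n)%:C * e) * e^* ^+ j))
    (fun e => f ((Rn R n)%:C * e) * kap M n (argk n e w)) p.
  have h1 : forall e, normc e = 1 -> csum (fun j => c j * (f ((Rn R n)%:C * e) * e^* ^+ j))
     (f ((Rn R n)%:C * e) * kap M n (argk n e w)).
    move=> e e1; apply: (eq_ccvg _ (ccvgZ (f ((Rn R n)%:C * e)) (kap_csum M n Dw e1))) => m.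
    rewrite mulr_sumr; apply: eq_bigr => j _.
    by rewrite /c /argk -[e^* * w / _]mulrA [(e^* * _) ^+ j]exprMn; ring.
  apply: (eq_ccvg _ (h h1)) => m; apply: eq_bigr => j _.
  by rewrite /A /rmean -mulr_sumr mulrCA.
(* The first term is the aliasing error of the indices below [2 ^ p], the second the whole
   contribution of the others; [p <= 2 ^ p] makes both geometric in [p]. *)
pose E p := K * F * (1 - t)^-1 * q ^+ p + K * (F + B) * (1 - t)^-1 * t ^+ p.
apply: (@ccvg_le _ _ _ E).
  move=> p; apply: (csum_norm_le _ (u := fun j => c j * (A j p - b j))); last first.
    apply: (eq_ccvg _ (ccvgB (mE p) HL)) => m.
    by rewrite -sumrB; apply: eq_bigr => j _; rewrite mulrBr.
  move=> m; pose N := (2 ^ p)%N; have pN : (p <= N)%N by rewrite ltnW// ltn_expl.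
  have mono (x : R) : 0 <= x < 1 -> x ^+ N <= x ^+ p.
    by move=> /andP[x0 x1]; exact: (ler_wiXn2l x0 (ltW x1)).
  apply: (@le_trans _ _ (K * F * q ^+ N * (\sum_(j < m) t ^+ j) +
     K * (F + B) * (\sum_(j < m) (N <= j)%N%:R * t ^+ j))).
    rewrite !mulr_sumr -big_split /=; apply: ler_sum => j _; rewrite ncM.
    have tj : 0 <= t ^+ j by rewrite exprn_ge0.
    have [jN|jN] := leqP N j.
      apply: ler_wpDl; first by apply: mulr_ge0 => //; apply: mulr_ge0; [exact: mulr_ge0|exact: exprn_ge0].
      rewrite mul1r mulrAC; apply: ler_pM; rewrite ?normc_ge0//.
      apply: le_trans (nc_sub _ _) _; rewrite lerD//.
      by apply: le_trans (nb j) _; rewrite ler_piMr.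
    rewrite mul0r mulr0 addr0 (_ : _ * t ^+ j = (K * t ^+ j) * (F * q ^+ N)); last by ring.
    by apply: ler_pM; rewrite ?normc_ge0//; exact: Ab.
  have s0 : 0 <= (1 - t)^-1 by rewrite invr_ge0 subr_ge0 ltW.
  rewrite /E; apply: lerD.
    have KF : 0 <= K * F by exact: mulr_ge0.
    rewrite [leRHS]mulrAC; apply: ler_pM.
    - by apply: mulr_ge0 => //; exact: exprn_ge0.
    - by apply: sumr_ge0 => j _; exact: exprn_ge0.
    - by apply: ler_wpM2l => //; exact: mono.
    - exact: geo_sum_le.
  rewrite -[leRHS]mulrA; apply: ler_wpM2l; first by apply: mulr_ge0 => //; exact: addr_ge0.
  apply: le_trans (geo_tail_le N m t01) _; by rewrite mulrC; apply: ler_wpM2l => //; exact: mono.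
rewrite -[X in _ --> X]addr0; apply: cvgD; exact: geo_cvg0.
Qed.

End Alias.

Lemma exp_1m_le (r : R) j : 0 <= r <= 1 -> 1 - r ^+ j <= j%:R * (1 - r).
Proof.
move=> /andP[r0 r1]; elim: j => [|j IH]; first by rewrite expr0 mul0r subrr.
have -> : 1 - r ^+ j.+1 = r * (1 - r ^+ j) + (1 - r) by rewrite exprS; ring.
rewrite -natr1 mulrDl mul1r lerD2r; apply: le_trans IH; rewrite ler_piMl//.
by rewrite subr_ge0 exprn_ile1.
Qed.

(** The partial sums telescope to a series with coefficients multiplied by [pk (rho m)], which lies
    between [1 - j 2^-m] and 1; the tame coefficients absorb the factor [j]. *)
Lemma pieces_sum (f : C -> C) a (M : nat) w (L : nat -> C) : tame a -> disk w ->
  (forall w, normc w < 1 -> csum (fun j => a j * w ^+ j) (f w)) ->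
  (forall n, csum (fun j => a j * (dk M.+1 n j)%:C * w ^+ j) (L n)) ->
  csum L (f w).
Proof.
move=> ta Dw fa HL.
have w01 : 0 <= normc w < 1 by rewrite normc_ge0.
have [B [q [B0 q01 Hb]]] := tame_coef ta w01.
have /andP[q0 q1] := q01.
have LE m : csum (fun j => a j * (pk (rho m) j M.+1)%:C * w ^+ j) (\sum_(n < m.+1) L n).
  have h := csum_sum (fun n : 'I_m.+1 => HL n).
  apply: (eq_ccvg _ h) => k; apply: eq_bigr => j _.
  by rewrite -mulr_suml -mulr_sumr -rmorph_sum /= dk_sum.
apply: (@ccvg_shift _ _ _ 1%N).
apply: (@ccvg_le _ _ _ (fun m => B * (1 - q) ^- 2 * 2^-1 ^+ m)); last first.
  by apply: geo_cvg0; rewrite invr_ge0 ler0n invf_lt1// ltr1n.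
move=> m; rewrite addn1.
apply: (csum_norm_le _ (u := fun j => a j * (pk (rho m) j M.+1 - 1)%:C * w ^+ j)); last first.
  apply: (eq_ccvg _ (ccvgB (LE m) (fa w Dw))) => k.
  rewrite -sumrB; apply: eq_bigr => j _.
  by rewrite rmorphB /=; ring.
move=> k; rewrite -mulrA [_ * _ ^+ m]mulrC mulrA.
apply: (@le_trans _ _ (B * 2^-1 ^+ m * \sum_(j < k) (j.+1%:R * q ^+ j))); last first.
  rewrite ler_wpM2l ?mulr_ge0 ?exprn_ge0 ?invr_ge0//; exact: geo_sum1_le.
rewrite mulr_sumr; apply: ler_sum => j _.
rewrite !ncM nc_real ncX mulrAC.
have /andP[p0 p1] := pk01 j M.+1 (rho01 m).
rewrite ler0_norm ?subr_le0// opprB.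
rewrite (_ : B * _ * _ = (B * q ^+ j) * (j.+1%:R * 2^-1 ^+ m)); last by ring.
apply: ler_pM; rewrite ?mulr_ge0 ?exprn_ge0 ?normc_ge0 ?subr_ge0//.
apply: (@le_trans _ _ (1 - rho m ^+ j)).
  by rewrite lerD2l lerN2 pk_ge// rho01.
apply: le_trans (exp_1m_le j (rho01 m)) _; rewrite /rho /qn opprB addrC subrK.
by rewrite ler_wpM2r ?exprn_ge0 ?invr_ge0// ler_nat.
Qed.

End Reproduction.

(** * The atomic expansion *)

Section UnorderedSums.
Variables (R : realType) (Q : countType).
Local Notation C := R[i].
Implicit Types (t : Q -> C) (s A : seq Q).

Definition uconv t (F : C) := forall e : R, 0 < e -> exists2 s0, uniq s0 &
  forall A, uniq A -> {subset s0 <= A} -> normc (\sum_(q <- A) t q - F) <= e.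

Lemma sub_sum_split (V : nmodType) (t : Q -> V) s A : uniq s -> uniq A -> {subset s <= A} ->
  \sum_(q <- A) t q = \sum_(q <- s) t q + \sum_(q <- [seq q <- A | q \notin s]) t q.
Proof.
move=> us uA sA; rewrite big_filter (bigID (mem s)) /=; congr (_ + _).
rewrite -big_filter; apply: perm_big; apply: uniq_perm => //; first exact: filter_uniq.
by move=> q; rewrite mem_filter; case: (boolP (q \in s)) => // /sA ->.
Qed.

Lemma abs_small t (B : R) :
  (forall s, uniq s -> \sum_(q <- s) normc (t q) <= B) ->
  forall e : R, 0 < e -> exists2 s0, uniq s0 & forall A, uniq A -> {subset s0 <= A} ->
    normc (\sum_(q <- A) t q - \sum_(q <- s0) t q) <= e.
Proof.
move=> HB e e0; pose S := [set \sum_(q <- s) normc (t q) | s in [set s | uniq s]].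
have hS : has_sup S.
  split; first by exists (\sum_(q <- [::]) normc (t q)), [::].
  by exists B => _ [s us <-]; exact: HB.
have [_ [s0 us0 <-] hs] := sup_adherent e0 hS; have {}us0 : uniq s0 := us0.
exists s0 => // A uA sA; rewrite (sub_sum_split t us0 uA sA) addrC addKr.
apply: le_trans (nc_sum _ _ _) _; set A' := [seq _ <- _ | _].
have uc : uniq (s0 ++ A').
  rewrite cat_uniq us0 filter_uniq// andbT /=; apply/hasPn => q.
  by rewrite mem_filter => /andP[].
have : \sum_(q <- s0 ++ A') normc (t q) <= sup S.
  by apply: ub_le_sup; [case: hS|exists (s0 ++ A')].
by rewrite big_cat /=; move: hs; clear; lra.
Qed.

(** An absolutely summable family has only one possible sum, so it may be computed as an iterated
    limit over finite sets that exhaust its support. *)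
Lemma uconv_iter t (B : R) (E : nat -> nat -> seq Q) (S : nat -> C) (F : C) :
  (forall s, uniq s -> \sum_(q <- s) normc (t q) <= B) ->
  (forall m l, uniq (E m l)) ->
  (forall s, (forall q, q \in s -> t q != 0) -> exists N, forall m l, (N <= m)%N -> (N <= l)%N -> {subset s <= E m l}) ->
  (forall m, ccvg (fun l => \sum_(q <- E m l) t q) (S m)) -> ccvg S F -> uconv t F.
Proof.
move=> HB uE Eex HS HF e e0; have e2 : 0 < e / 2 by rewrite divr_gt0.
have [s1 us1 Hs1] := abs_small HB e2.
exists s1 => // A uA sA.
suff : normc (\sum_(q <- s1) t q - F) <= e / 2.
  have := Hs1 A uA sA; have := nc_dist (\sum_(q <- A) t q) F (\sum_(q <- s1) t q).
  by clear; lra.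
(* Zero terms are dropped, as the sets [E m l] are only known to exhaust the support. *)
pose s2 := [seq q <- s1 | t q != 0].
have s2E : \sum_(q <- s1) t q = \sum_(q <- s2) t q.
  rewrite /s2 big_filter [RHS]big_mkcond /=; apply: eq_bigr => q _.
  by case: eqP => //= ->.
have [N HN] : exists N, forall m l, (N <= m)%N -> (N <= l)%N -> {subset s2 <= E m l}.
  by apply: Eex => q; rewrite mem_filter => /andP[].
have Hs2 A' : uniq A' -> {subset s2 <= A'} -> normc (\sum_(q <- A') t q - \sum_(q <- s1) t q) <= e / 2.
  move=> uA' sA'; pose A2 := A' ++ [seq q <- s1 | q \notin A'].
  have uA2 : uniq A2.
    rewrite cat_uniq uA' filter_uniq// andbT /=; apply/hasPn => q.
    by rewrite mem_filter => /andP[].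
  have sA2 : {subset s1 <= A2}.
    by move=> q qs; rewrite mem_cat mem_filter qs andbT; case: (q \in A').
  have := Hs1 A2 uA2 sA2; rewrite big_cat /= [X in _ + X - _]big1_seq ?addr0// => q.
  rewrite mem_filter => /andP[_ /andP[qA qs]]; apply/eqP; apply/negP => /negP tq.
  by move: qA; rewrite sA'// mem_filter tq.
have SE m : (N <= m)%N -> normc (S m - \sum_(q <- s1) t q) <= e / 2.
  move=> Nm; apply: (ccvg_bound _ (ccvgB (HS m) (ccvg_cst _))).
  by exists N => l Nl; apply: Hs2 => //; exact: HN.
by rewrite ncB; apply: (ccvg_bound _ (ccvgB HF (ccvg_cst _))); exists N.
Qed.

(** Turns a family over [Q] into an ordinary sequence, the shape that [nuclear] demands; the zeros
    do not affect sums. *)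
Definition pick0 (V : nmodType) (t : Q -> V) (i : nat) : V :=
  if pickle_inv i is Some q then t q else 0.

Definition penum n : seq Q := pmap (@pickle_inv Q) (iota 0 n).

Lemma penum_uniq n : uniq (penum n).
Proof.
apply: (@map_uniq _ _ pickle); rewrite pmap_filter; last exact: pickle_invK.
by rewrite filter_uniq// iota_uniq.
Qed.

Lemma penum_sum (V : nmodType) (t : Q -> V) n : \sum_(i < n) pick0 t i = \sum_(q <- penum n) t q.
Proof.
elim: n => [|n IH]; first by rewrite big_ord0 big_nil.
rewrite big_ord_recr /= IH /penum -addn1 iotaD pmap_cat big_cat /=; congr (_ + _).
rewrite add0n /pick0; case: pickle_inv => [q|]; first by rewrite big_seq1.
by rewrite big_nil.
Qed.

Lemma uconv_csum t F : uconv t F -> csum (pick0 t) F.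
Proof.
move=> H e e0; have [s0 us0 Hs0] := H e e0.
exists (\max_(q <- s0) (pickle q).+1)%N => n Hn; rewrite penum_sum; apply: Hs0.
  exact: penum_uniq.
move=> q qs; rewrite /penum mem_pmap; apply/mapP; exists (pickle q); last by rewrite pickleK_inv.
rewrite mem_iota /= add0n; apply: leq_trans Hn.
exact: (@leq_bigmax_seq _ s0 xpredT (fun q => (pickle q).+1)).
Qed.

End UnorderedSums.

(** * From a pointwise expansion to a nuclear representation *)

Section NuclearExpansion.
Variable R : realType.
Local Notation C := R[i].
Variables (nu mu : radial_weight R).
Hypothesis (mun : normal mu).
Variables (g phi : C -> C).
Hypotheses (ga : analytic g) (pa : analytic phi) (ps : self_map phi).
Variable T : {linear Hinf nu -> Hinf mu}.
Hypothesis TE : forall (f : Hinf nu) z, disk z -> T f z = int_op g phi f z.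

Let a (z : C) : R := (1 - normc z ^+ 2) * mu z * normc (derive1 g z).

Lemma op_weight_ge0 z : disk z -> 0 <= a z.
Proof.
move=> Dz; rewrite /a !mulr_ge0 ?normc_ge0// ?(ltW (weight_gt0 _ Dz))//.
by rewrite subr_ge0 exprn_ile1 ?normc_ge0// ltW.
Qed.

(** The converse of [T_deriv_le]: [T f] vanishes at 0 and has derivative [f(phi) g'], so
    [Hinf_primitive_le] applies. *)
Lemma T_norm_le : exists2 K : R, 0 < K & forall (f : Hinf nu) (B : R),
  (forall z, disk z -> a z * normc (f (phi z)) <= B) -> wnorm mu (T f) <= K * B.
Proof.
have [K K0 HK] := Hinf_primitive_le mun.
exists K => // f B HB; have [fa _ _] := HinfP f.
have [H HH HE] := T_primitive ga pa ps TE f.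
apply: wnorm_le => z Dz; rewrite HE//.
apply: (HK H _ B (comp_analytic ga pa ps fa) HH) => // w Dw.
by rewrite ncM [normc (f _) * _]mulrC mulrA; exact: HB.
Qed.

Lemma Hinf_eval_sum (n : nat) (c : nat -> C) (h : nat -> Hinf nu) z :
  hinf_fun (\sum_(i < n) c i *: h i) z = \sum_(i < n) c i * h i z.
Proof. by elim: n => [|n IH]; rewrite ?big_ord0// !big_ord_recr /= -IH. Qed.

(** The expansion of [f] is only pointwise. Its remainder at [phi z], weighted by [a z], is at most
    the norm of [f] times a tail of the sum of [b i * c i]; [T_norm_le] makes this a bound in norm
    after applying [T]. *)
Lemma nuclear_of_csum (xs : nat -> {linear Hinf nu -> C}) (kp : nat -> Hinf nu)
    (b c : nat -> R) (B : R) :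
  (forall i, 0 <= b i) -> (forall i, 0 <= c i) ->
  (forall i f, normc (xs i f) <= b i * wnorm nu f) ->
  (forall i z, disk z -> a z * normc (kp i (phi z)) <= c i) ->
  (forall n, \sum_(i < n) b i * c i <= B) ->
  (forall f w, disk w -> csum (fun i => xs i f * kp i w) (f w)) ->
  nuclear T.
Proof.
move=> b0 c0 Hx Hk HB Hs; have [K K0 HK] := T_norm_le.
pose s n := \sum_(i < n) b i * c i.
have bc0 i : 0 <= b i * c i by exact: mulr_ge0.
have sS n : s n <= s n.+1 by rewrite /s big_ord_recr /= lerDl.
have [l sl sle] := real_nondec_cvg sS HB.
have normE (f : Hinf nu) : `|f| = (wnorm nu f)%:C by [].
have normE' (f : Hinf mu) : `|f| = (wnorm mu f)%:C by [].
exists xs, (fun i => T (kp i)); split.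
- move=> i; exists (b i) => f; rewrite normE -rmorphM normcNE lecR; exact: Hx.
- have tb i : dual_norm (xs i) * complex.Re `|T (kp i)| <= b i * (K * c i).
    apply: ler_pM.
    + apply: dual_norm_ge0; exists (b i) => f; rewrite normE -rmorphM normcNE lecR; exact: Hx.
    + exact: Re_norm_ge0.
    + apply: ge_sup.
        by exists (normc (xs i 0)), 0 => //=; rewrite normr0 ler01.
      move=> _ [f /= f1 <-]; apply: le_trans (Hx i f) _.
      rewrite ler_piMr//; move: f1; rewrite normE.
      by rewrite -[1]/(1%:C) lecR.
    + rewrite normE' /=; apply: HK; exact: Hk.
  have t0 i : 0 <= dual_norm (xs i) * complex.Re `|T (kp i)|.
    apply: mulr_ge0; last exact: Re_norm_ge0.
    apply: dual_norm_ge0; exists (b i) => f; rewrite normE -rmorphM normcNE lecR; exact: Hx.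
  apply: (@le_lt_trans _ _ (K * B)%:E); last exact: ltry.
  apply: lime_le.
    by apply: is_cvg_nneseries => i _ _; rewrite lee_fin.
  apply: nearW => n; rewrite sumEFin lee_fin big_mkord.
  apply: (@le_trans _ _ (K * s n)); last by rewrite ler_pM2l//; exact: HB.
  rewrite mulr_sumr; apply: ler_sum => i _; rewrite [leRHS]mulrCA; exact: tb.
move=> f; apply/cvgrPdist_le => /= e e0.
have eE : e = (complex.Re e)%:C by rewrite RRe_real// gtr0_real.
have e0' : 0 < complex.Re e by rewrite -ltcR -eE.
have L0 : 0 < K * (wnorm nu f + 1).
  by rewrite mulr_gt0// ltr_wpDl// wnorm_ge0.
have eL : 0 < complex.Re e / (K * (wnorm nu f + 1)) by rewrite divr_gt0.
have /cvgrPdist_le/(_ _ eL)[N _ HN] := sl.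
exists N => // n /= Nn.
pose h : Hinf nu := f - \sum_(i < n) xs i f *: kp i.
have -> : T f - series (fun i => xs i f *: T (kp i)) n = T h.
  have -> : T h = T f - T (\sum_(i < n) xs i f *: kp i) by rewrite -linearB.
  congr (_ - _); rewrite linear_sum /series /= big_mkord.
  by apply: eq_bigr => i _; rewrite linearZ.
rewrite normE' eE lecR.
apply: (@le_trans _ _ (K * (wnorm nu f * (l - s n)))); last first.
  have := HN n Nn; rewrite ger0_norm ?subr_ge0//.
  rewrite ler_pdivlMr// => h1; apply: le_trans h1.
  rewrite mulrCA mulrA mulrC ler_wpM2l ?subr_ge0//.
  by rewrite mulrC ler_wpM2l ?(ltW K0)// lerDl.
apply: HK => z Dz.
have Dw := ps Dz; set w := phi z in Dw *.
have hE : hinf_fun h w = f w - \sum_(i < n) xs i f * kp i w.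
  rewrite -(Hinf_eval_sum n (fun i => xs i f) kp w) //.
have az := op_weight_ge0 Dz.
have -> : a z * normc (h w) = normc ((a z)%:C * (f w - \sum_(i < n) xs i f * kp i w)).
  by rewrite ncM nc_real ger0_norm// hE.
(* The remainder is the pointwise limit of finite blocks starting at [n], and a bound on every block
   passes to the limit. *)
apply: (ccvg_bound _ (ccvgZ (a z)%:C (ccvgB (Hs f w Dw) (ccvg_cst (\sum_(i < n) xs i f * kp i w))))).
exists n => m nm.
have [d mE] : exists d, m = (n + d)%N by exists (m - n)%N; rewrite subnKC.
rewrite {}mE {m nm} big_split_ord /= addrAC subrr add0r ncM nc_real (ger0_norm az).
apply: (@le_trans _ _ (wnorm nu f * (s (n + d)%N - s n))); last first.
  by rewrite ler_wpM2l ?wnorm_ge0// lerD2r.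
have -> : s (n + d)%N - s n = \sum_(i < d) b (n + i)%N * c (n + i)%N.
  by rewrite /s big_split_ord /= addrAC subrr add0r.
rewrite mulr_sumr; apply: le_trans (ler_wpM2l az (nc_sum _ _ _)) _.
rewrite mulr_sumr; apply: ler_sum => i _; rewrite ncM mulrCA.
rewrite mulrA; apply: (@le_trans _ _ ((b (n + i)%N * wnorm nu f) * c (n + i)%N)).
  rewrite -mulrA; apply: ler_pM; [exact: normc_ge0| |exact: Hx|exact: Hk].
  by apply: mulr_ge0 => //; exact: normc_ge0.
by rewrite [b _ * _]mulrC mulrA.
Qed.

End NuclearExpansion.

(** * Halving the mesh *)

Section Refinement.
Variable R : realType.
Local Notation C := R[i].
Local Notation qn := (qn R).

Definition NN n l : nat := (2 ^ (n + 6 + l))%N.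
Definition pt1 n l k : C := rt R (NN n l) k.
(** Rounding [k] down to an even index gives, for [l > 0], a neighbour that already belongs to the
    coarser mesh. *)
Definition pt0 n l k : C := rt R (NN n l) (k %/ 2 * 2).

Lemma NN_gt0 n l : (0 < NN n l)%N.
Proof. by rewrite expn_gt0. Qed.

Lemma NN_Nn n l : NN n l = (Nn n * 2 ^ l)%N.
Proof. by rewrite /NN /Nn -expnD. Qed.

Lemma NNE n l : (NN n l)%:R = 64 / qn n * 2 ^+ l :> R.
Proof. by rewrite NN_Nn natrM NnE natrX. Qed.

Lemma rt_lip N i j (d : R) : (0 < N)%N -> `|i%:R - j%:R| <= d ->
  normc (rt R N i - rt R N j) <= 16 * d / N%:R.
Proof.
move=> N0 ij; have N0' : 0 < N%:R :> R by rewrite ltr0n.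
apply: le_trans (expi_lip _ _) _.
rewrite -mulrBl -mulrBr !normrM normfV [`|N%:R|]gtr0_norm// mulrA ler_pM2r ?invr_gt0//.
have p0 := @pi2_ge0 R; rewrite (ger0_norm p0).
have p8 : pi *+ 2 <= 8 :> R by have := pihalf_lt2 R; lra.
have -> : 16 * d = 2 * (8 * d) by ring.
by rewrite ler_pM2l//; apply: ler_pM.
Qed.

Lemma rt_near n l i k : (i <= k * 2 ^ l + 2 ^ l)%N -> (k * 2 ^ l <= i + 2 ^ l)%N ->
  normc (rt R (NN n l) i - rt R (Nn n) k) <= qn n / 4.
Proof.
move=> h1 h2; rewrite -(@rt_mul R (Nn n) k (2 ^ l)) ?expn_gt0// -NN_Nn.
have q0 := qn_gt0 R n.
have d : `|i%:R - (k * 2 ^ l)%:R| <= 2 ^+ l :> R.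
  by rewrite ler_distlC -natrX lerBlDr -!natrD !ler_nat h1 h2.
apply: le_trans (rt_lip (NN_gt0 n l) d) _.
rewrite NNE ler_pdivrMr; last by rewrite mulr_gt0 ?divr_gt0 ?exprn_gt0.
by rewrite [leRHS](_ : _ = 16 * 2 ^+ l)//; field; rewrite gt_eqF.
Qed.

Lemma pt1_near n l k : normc (pt1 n l k - rt R (Nn n) (k %/ 2 ^ l)) <= qn n / 4.
Proof.
have p0 : (0 < 2 ^ l)%N by rewrite expn_gt0.
apply: rt_near; last by apply: leq_trans (leq_addr _ _); exact: leq_trunc_div.
by rewrite -mulSnr ltnW// ltn_ceil.
Qed.

Lemma pt0_near n l k : normc (pt0 n l k - rt R (Nn n) (k %/ 2 ^ l)) <= qn n / 4.
Proof.
have p0 : (0 < 2 ^ l)%N by rewrite expn_gt0.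
have k2 : (k %/ 2 * 2 <= k)%N by exact: leq_trunc_div.
apply: rt_near.
  by apply: leq_trans k2 _; rewrite -mulSnr ltnW// ltn_ceil.
apply: leq_trans (leq_trunc_div k (2 ^ l)) _.
apply: (@leq_trans (k %/ 2 * 2 + 1)); last by rewrite leq_add2l.
by rewrite {1}(divn_eq k 2) leq_add2l -ltnS ltn_mod.
Qed.

Lemma pt_dist n l k : normc (pt1 n l k - pt0 n l k) <= 2^-1 ^+ l / 4 * qn n.
Proof.
have d : `|k%:R - (k %/ 2 * 2)%:R| <= 1 :> R.
  rewrite {1}(divn_eq k 2) natrD addrAC subrr add0r ger0_norm//.
  by rewrite (ler_nat _ _ 1) -ltnS ltn_mod.
apply: le_trans (rt_lip (NN_gt0 n l) d) _; rewrite NNE exprVn.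
rewrite le_eqVlt; apply/orP; left; apply/eqP.
by field; rewrite gt_eqF ?qn_gt0//= expf_neq0.
Qed.

Lemma nc_pt1 n l k : normc (pt1 n l k) = 1. Proof. exact: nc_rt. Qed.
Lemma nc_pt0 n l k : normc (pt0 n l k) = 1. Proof. exact: nc_rt. Qed.

Lemma pt0S n l k : pt0 n l.+1 k = pt1 n l (k %/ 2).
Proof.
rewrite /pt0 /pt1 (_ : NN n l.+1 = NN n l * 2)%N ?rt_mul//.
by rewrite /NN addnS expnSr.
Qed.

(* Increment, at the k-th point of generation l, of the mean over the roots of
   unity when the mesh is halved; generation 0 is the initial mesh. *)
Definition incr (g : C -> C) n l k : C :=
  ((NN n l)%:R)^-1 * (g (pt1 n l k) - (if l is 0 then 0 else g (pt0 n l k))).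

(** Each point of the coarser mesh is subtracted twice with half its former weight, so the sum
    telescopes. *)
Lemma incr_sum g n L : \sum_(l < L.+1) \sum_(k < NN n l) incr g n l k = rmean g (n + 6 + L).
Proof.
elim: L => [|L IH].
  rewrite big_ord_recl big_ord0 addr0 /rmean -/(NN n 0) mulr_sumr.
  by apply: eq_bigr => k _; rewrite /incr subr0.
rewrite big_ord_recr /= IH /incr -mulr_sumr sumrB mulrBr.
have NS : NN n L.+1 = (NN n L * 2)%N by rewrite /NN addnS expnSr.
have -> : \sum_(k < NN n L.+1) g (pt0 n L.+1 k) = 2 * \sum_(k < NN n L) g (pt1 n L k).
  under eq_bigr do rewrite pt0S.
  by rewrite NS (sum_divn _ (fun k => g (pt1 n L k))).
have NI : ((NN n L.+1)%:R)^-1 * 2 = ((NN n L)%:R)^-1 :> C.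
  by rewrite NS natrM invfM -mulrA mulVf ?mulr1// pnatr_eq0.
rewrite [_ * (2 * _)]mulrA NI [LHS]addrC subrK /rmean.
by [].
Qed.

End Refinement.

(* A cell ((n, l), (k, b)) stands for the k-th of the 2^(n+6+l) roots of unity on
   the n-th circle, at the l-th refinement of the mesh. *)
Definition cell : countType := ((nat * nat) * (nat * bool))%type.

Section Atoms.
Variable R : realType.
Local Notation C := R[i].
Local Notation qn := (qn R).
Implicit Types (nu : radial_weight R) (q : cell) (w : C).

Definition fnl nu q (f : Hinf nu) : C :=
  let: ((n, l), (k, b)) := q in
  f ((Rn R n)%:C * pt1 R n l k) -
  (if b then f ((Rn R n)%:C * pt0 R n l k) else 0).

Lemma fnl_linear nu q : linear (@fnl nu q).
Proof.
case: q => [[n l] [k b]] c f h; rewrite /fnl.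
set z1 := _ * pt1 _ _ _ _; set z0 := _ * pt0 _ _ _ _.
change ((c * f z1 + h z1) - (if b then c * f z0 + h z0 else 0) =
  c * (f z1 - (if b then f z0 else 0)) + (h z1 - (if b then h z0 else 0))).
by case: b; ring.
Qed.

HB.instance Definition _ nu q := GRing.isLinear.Build C (Hinf nu) C _
  (@fnl nu q) (@fnl_linear nu q).

(* The increment of a product f * kap is split by the Leibniz rule, b selecting
   the term; see [fnl_krn]. *)
Definition krn M q w : C :=
  let: ((n, l), (k, b)) := q in
  if (k < NN n l)%N then
    let k1 := kap M n (argk n (pt1 R n l k) w) in
    let k0 := if l is 0 then 0 else kap M n (argk n (pt0 R n l k) w) in
    ((NN n l)%:R)^-1 * (if b then k0 else k1 - k0)
  else 0.

Lemma fnl_krn M nu (f : Hinf nu) n l k w : (k < NN n l)%N ->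
  fnl (((n, l), (k, false)) : cell) f * krn M ((n, l), (k, false)) w +
  fnl (((n, l), (k, true)) : cell) f * krn M ((n, l), (k, true)) w =
  incr (fun e => f ((Rn R n)%:C * e) * kap M n (argk n e w)) n l k.
Proof. by move=> kN; rewrite /krn /fnl /incr kN; case: l kN => [|l] kN /=; ring. Qed.

Local Notation par l k := (k %/ 2 ^ l)%N.

(** One factor [2^-l] and one [qn n] come from the normalisation of the mean; for [b = false] a
    second [2^-l] comes from the variation of the kernel. For [b = true] that gain is left to
    [fnl_le]. *)
Lemma krn_le M : exists2 K : R, 0 < K & forall n l k b w, disk w -> (k < NN n l)%N ->
  normc (krn M.+1 ((n, l), (k, b)) w) <=
    K * (if b then 1 else 2^-1 ^+ l) * 2^-1 ^+ l *
    (qn n ^+ M.+2 / normc (1 - (node R n (par l k))^* * w) ^+ M.+2).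
Proof.
have [K K0 HK] := kap_near R M.
exists (K * (1 + K)) => [|n l k b w Dw kN]; first by rewrite mulr_gt0// addr_gt0.
have d0 : 0 <= 2^-1 ^+ l / 4 :> R by rewrite divr_ge0// exprn_ge0// invr_ge0.
have [h1 h2 h3] := HK n (par l k) (pt0 R n l k) (pt1 R n l k) w _ Dw (nc_pt0 _ _ _ _)
  (nc_pt1 _ _ _ _) (pt0_near _ _ _ _) (pt1_near _ _ _ _) d0 (pt_dist _ _ _ _).
rewrite /krn kN; set D := normc (1 - _ * w) ^+ M.+2 in h1 h2 h3 *.
have D0 : 0 < D by rewrite exprn_gt0// kern_neq0.
have q0 := qn_gt0 R n.
have [p [p0 p1 pE]] : exists p : R, [/\ 0 < p, p <= 1 & 2^-1 ^+ l = p].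
  by exists (qn l); split; [exact: qn_gt0|exact: qn_le1|].
have NI : normc ((NN n l)%:R : C)^-1 = qn n / 64 * p.
  rewrite ncV nc_natr NNE -pE exprVn; field.
  by rewrite gt_eqF//= expf_neq0.
rewrite ncM NI pE.
have X0 : 0 <= K * (qn n ^+ M.+1 / D).
  by rewrite mulr_ge0 ?(ltW K0)// divr_ge0 ?(ltW D0)// exprn_ge0// ltW.
have XE : (qn n ^+ M.+2 / D) * K = qn n * (K * (qn n ^+ M.+1 / D)).
  by rewrite (exprS (qn n) M.+1); ring.
set X := K * (qn n ^+ M.+1 / D) in h1 h2 h3 X0 XE.
have c0 : normc (if l is 0 then 0 else kap M.+1 n (argk n (pt0 R n l k) w)) <= X.
  by case: (l) h1 => [|l'] h1; rewrite ?nc0.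
have YE B : K * (1 + K) * B * p * (qn n ^+ M.+2 / D) = (1 + K) * B * p * (qn n * X).
  by rewrite -XE; ring.
clearbody X; case: b; rewrite YE.
  apply: (@le_trans _ _ (qn n / 64 * p * X)).
    by rewrite ler_wpM2l// mulr_ge0 ?(ltW p0)// divr_ge0// ltW.
  rewrite mulr1; have : 0 <= p * (qn n * X) by rewrite !mulr_ge0// ltW.
  have : 0 <= K * (p * (qn n * X)) by rewrite mulr_ge0 ?(ltW K0)// !mulr_ge0// ltW.
  by clear; lra.
suff c1 : normc (kap M.+1 n (argk n (pt1 R n l k) w) -
    (if l is 0 then 0 else kap M.+1 n (argk n (pt0 R n l k) w))) <= (1 + K) * p * X.
  apply: (@le_trans _ _ (qn n / 64 * p * ((1 + K) * p * X))).
    by rewrite ler_wpM2l// mulr_ge0 ?(ltW p0)// divr_ge0// ltW.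
  have : 0 <= (1 + K) * p * p * (qn n * X).
    by rewrite !mulr_ge0 ?(ltW p0) ?(ltW q0)// addr_ge0// ltW.
  by clear; lra.
have KX : 0 <= K * X by rewrite mulr_ge0// ltW.
clear -pE h2 h3 KX X0 p0 p1; case: l pE h2 h3 => [|l] pE h2 h3.
  rewrite subr0; apply: le_trans h2 _; rewrite -pE expr0 mulr1.
  by move: KX; clear; lra.
rewrite pE in h3; apply: le_trans h3 _.
have := mulr_ge0 (ltW p0) X0; have := mulr_ge0 (ltW p0) KX; clear; lra.
Qed.

(** Near the circle of radius [Rn R n] the function is bounded by its norm over the weight three
    levels down, comparable to [wl nu n]; for [b = true] the Schwarz bound at scale [qn n] supplies
    the gain. *)
Lemma fnl_le nu : normal nu -> exists2 K : R, 0 < K & forall n l k b (f : Hinf nu),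
  normc (fnl ((n, l), (k, b)) f) <=
    K * (if b then 2^-1 ^+ l else 1) / wl nu n * wnorm nu f.
Proof.
move=> [[beta bI] _]; have [K1 K10 HK] := wl_I bI.
pose K := K1 * (2 `^ beta) ^+ 3.
have K0 : 0 < K by rewrite mulr_gt0// exprn_gt0// powR_gt0.
exists (16 * K) => [|n l k b f]; first by rewrite mulr_gt0.
have q0 := qn_gt0 R n; have R0 := Rn_gt0 R n; have R1 := @Rn_lt1 R n.
have RE : Rn R n = 1 - qn n / 4 by [].
have q8 : qn n = 8 * qn n.+3 by rewrite (qnS R n) (qnS R n.+1) (qnS R n.+2); ring.
have w0 := wl_gt0 nu n; have w3 := wl_gt0 nu n.+3; have nf := wnorm_ge0 f.
have [B BE] : exists B, B = K / wl nu n * wnorm nu f by eexists.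
have B0 : 0 <= B by rewrite BE mulr_ge0// divr_ge0 ?ltW.
have fB z : normc z <= 1 - qn n / 8 -> normc (f z) <= B.
  move=> zz; have z3 : normc z <= rho R n.+3 by rewrite /rho; move: zz; rewrite q8; clear; lra.
  apply: le_trans (Hinf_le f z3) _; rewrite BE mulrC ler_wpM2r//.
  have n3 : (n <= n.+3)%N by rewrite ltnW// ltnW.
  rewrite ler_pdivlMr// ler_pdivrMl//; have := HK n n.+3 n3.
  by rewrite (_ : (n.+3 - n = 3)%N) 1?mulrC// -addn3 addKn.
have nR e : normc e = 1 -> normc ((Rn R n)%:C * e) = Rn R n.
  by move=> e1; rewrite ncM e1 mulr1 nc_real gtr0_norm.
have Rq : Rn R n <= 1 - qn n / 8 by rewrite RE; move: q0; clear; lra.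
have f1 := fB ((Rn R n)%:C * pt1 R n l k); rewrite nR ?nc_pt1// in f1.
have f0 := fB ((Rn R n)%:C * pt0 R n l k); rewrite nR ?nc_pt0// in f0.
have {}f1 := f1 Rq; have {}f0 := f0 Rq.
rewrite (_ : 16 * K * _ / _ * _ = 16 * (if b then 2^-1 ^+ l else 1) * B); last first.
  by rewrite BE; ring.
rewrite /fnl; case: b; last by rewrite subr0; apply: le_trans f1 _; move: B0; clear; lra.
have [p [p0 pE]] : exists p : R, 0 < p /\ 2^-1 ^+ l = p.
  by exists (qn l); split=> //; exact: qn_gt0.
rewrite pE; set z := _ * pt0 _ _ _ _ in f0 *.
pose v := (Rn R n)%:C * (pt1 R n l k - pt0 R n l k).
have vq : normc v <= p / 4 * qn n.
  rewrite ncM nc_real gtr0_norm//; have := pt_dist R n l k; rewrite pE => h.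
  by apply: le_trans h; rewrite ler_piMl ?normc_ge0// ltW.
have -> : (Rn R n)%:C * pt1 R n l k = z + v by rewrite /v /z; ring.
have {}f1 : normc (f (z + v)) <= B.
  by rewrite (_ : z + v = (Rn R n)%:C * pt1 R n l k)// /v /z; ring.
have d0 : 0 < qn n / 8 by rewrite divr_gt0.
(* The Lipschitz bound holds only for short steps. A longer step forces [2^-l >= 1 / 8], and then
   the trivial bound [2 B] is within [16 * 2^-l * B]. *)
have [vd|dv] := leP (normc v) (qn n / 8 / 4).
  have zd : normc z + qn n / 8 <= 1 by rewrite nR ?nc_pt0// RE; move: q0; clear; lra.
  have [fa _ _] := HinfP f.
  have fz w : normc (w - z) < qn n / 8 -> normc (f w) <= B.
    move=> wz; apply: fB; have := normc_triangle (w - z) z; rewrite subrK nR ?nc_pt0// RE.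
    by move: wz; clear; lra.
  apply: le_trans (Schwarz_lip fa d0 zd fz vd) _.
  rewrite ler_pdivrMr//; have := ler_wpM2l B0 vq.
  have : 0 <= B * (p * qn n) by rewrite !mulr_ge0// ltW.
  by clear; lra.
apply: le_trans (nc_sub _ _) _.
have p8 : 1 / 8 <= p.
  have h : qn n / 8 / 4 < p / 4 * qn n by apply: lt_le_trans dv vq.
  have : qn n * (1 / 8) < qn n * p by move: h; clear; lra.
  by rewrite ltr_pM2l// => /ltW.
have := ler_wpM2l B0 p8; move: f0 f1; clear; lra.
Qed.

Lemma Pk_cdiff M (r : R) (u : C -> C) w A : 1 - r%:C * u w != 0 -> cdiff u w A ->
  exists A', cdiff (fun w => Pk M r (u w)) w A'.
Proof.
move=> n0 cu; elim: M => [|M [B IH]] /=; first by exists 0; exact: cdiff_cst.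
have cv : exists B', cdiff (fun w => vk r (u w)) w B'.
  eexists; apply: (@cdiffV _ (fun w => 1 - r%:C * u w) w) => //.
  by apply: cdiffB; [exact: cdiff_cst|apply: cdiffM; [exact: cdiff_cst|exact: cu]].
have [B' cv'] := cv; eexists; apply: cdiffD; first exact: cv'.
apply: cdiffM; last exact: IH.
by apply: cdiffM; [apply: cdiffM; [exact: cdiff_cst|exact: cu]|exact: cv'].
Qed.

Lemma kap_cdiff M n k e w : disk w -> normc e = 1 ->
  normc (e - rt R (Nn n) k) <= qn n / 4 ->
  exists A, cdiff (fun w => kap M n (argk n e w)) w A.
Proof.
move=> Dw e1 he; have cu : cdiff (argk n e) w ((0 * w + e^* * 1) * (Rn R n)%:C^-1 + (e^* * w) * 0).
  by apply: cdiffM; [apply: cdiffM; [exact: cdiff_cst|exact: cdiff_id]|exact: cdiff_cst].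
case: n he cu => [|n] he cu.
  by apply: (Pk_cdiff _ _ cu); rewrite mul0r subr0 oner_eq0.
have q0 := qn_gt0 R n.+1; have qE := qnS R n.
have r1 : 1 - 2 * qn n.+1 <= rho R n.+1 by rewrite /rho; move: q0; clear; lra.
have r2 : 1 - 2 * qn n.+1 <= rho R n by rewrite /rho qE.
have r3 : rho R n <= 1 - qn n.+1 by rewrite /rho qE; move: q0; clear; lra.
have [n1 _] := kern_arg Dw e1 he (rho_ge0 R n.+1) r1 (lexx _).
have [n2 _] := kern_arg Dw e1 he (rho_ge0 R n) r2 r3.
have [A1 c1] := Pk_cdiff M n1 cu; have [A2 c2] := Pk_cdiff M n2 cu.
by exists (A1 - A2); exact: cdiffB.
Qed.

Lemma krn_Hinf nu M q : normal nu -> Hinf_set nu (dext (krn M.+1 q)).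
Proof.
move=> nun; apply: Hzero_sub_Hinf; have [_ nuII] := nun.
have [K K0 HK] := krn_le M; case: q => [[n l] [k b]].
apply: (@dext_Hzero R nu _ (K * 4 ^+ M.+2) nuII) => z Dz.
  have [A1 c1] := @kap_cdiff M.+1 n _ _ z Dz (nc_pt1 R n l k) (pt1_near R n l k).
  have [A0 c0] := @kap_cdiff M.+1 n _ _ z Dz (nc_pt0 R n l k) (pt0_near R n l k).
  have [A2 c2] : exists A, cdiff (fun w => if l is 0 then 0 else kap M.+1 n (argk n (pt0 R n l k) w)) z A.
    by case: (l) c0 => [|l'] c0; [exists 0; exact: cdiff_cst|exists A0].
  rewrite /krn; case: (k < NN n l)%N; last by exists 0; exact: cdiff_cst.
  case: b; first by eexists; apply: cdiffM; [exact: cdiff_cst|exact: c2].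
  by eexists; apply: cdiffM; [exact: cdiff_cst|apply: cdiffB; [exact: c1|exact: c2]].
have [kN|kN] := ltnP k (NN n l); last first.
  by rewrite /krn ltnNge kN nc0 mulr_ge0 ?exprn_ge0// ltW.
apply: le_trans (HK n l k b z Dz kN) _.
have t0 : 0 < normc (1 - (node R n (k %/ 2 ^ l))^* * z) by exact: kern_neq0.
have pl0 := ltW (qn_gt0 R l); have pl1 := qn_le1 R l.
have B0 : 0 <= (if b then 1 else 2^-1 ^+ l) :> R by case: (b).
have B1 : (if b then 1 else 2^-1 ^+ l) <= 1 :> R by case: (b).
have X0 : 0 <= qn n ^+ M.+2 / normc (1 - (node R n (k %/ 2 ^ l))^* * z) ^+ M.+2.
  by rewrite divr_ge0 ?exprn_ge0// ltW// qn_gt0.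
rewrite -[_ * _ * _ * _]mulrA; apply: ler_pM.
- by apply: mulr_ge0 => //; exact: ltW.
- exact: mulr_ge0.
- by rewrite ler_piMr ?(ltW K0).
rewrite -expr_div_n -[leRHS]mul1r; apply: ler_pM => //.
  by rewrite exprn_ge0// divr_ge0 ?ltW// qn_gt0.
rewrite lerXn2r ?nnegrE//; first by rewrite divr_ge0 ?ltW// qn_gt0.
by rewrite ler_pdivrMr//; have := node_kern_ge n (k %/ 2 ^ l) Dz; clear; lra.
Qed.

End Atoms.

(** * Summation over cells *)

Section CellSums.
Variable R : realType.
Local Notation C := R[i].
Implicit Types (q : cell) (m L : nat).

Definition cells m L : seq cell :=
  [seq (p, x) | p <- [seq (n, l) | n <- iota 0 m, l <- iota 0 L],
                x <- [seq (k, b) | k <- iota 0 (NN p.1 p.2), b <- [:: false; true]]].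

Definition valid q : bool := (q.2.1 < NN q.1.1 q.1.2)%N.

Lemma cells_uniq m L : uniq (cells m L).
Proof.
apply: allpairs_uniq_dep.
- apply: allpairs_uniq_dep; first exact: iota_uniq.
    by move=> n _; exact: iota_uniq.
  by move=> [n k] [n' k'] _ _ [-> ->].
- move=> p _; apply: allpairs_uniq_dep; first exact: iota_uniq.
    by [].
  by move=> [n k] [n' k'] _ _ [-> ->].
by move=> [n k] [n' k'] _ _ [-> ->].
Qed.

Lemma mem_cells m L q :
  (q \in cells m L) = [&& (q.1.1 < m)%N, (q.1.2 < L)%N & valid q].
Proof.
case: q => [[n l] [k b]]; rewrite /valid /=; apply/idP/idP.
  move=> /allpairsPdep[[n' l'] [[k' b'] [/allpairsPdep[n2 [l2 [hn hl [-> ->]]]]]]].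
  move=> /allpairsPdep[k2 [b2 [hk _ [-> ->]]]] [-> -> -> _].
  by move: hn hl hk; rewrite !mem_iota /= !add0n => -> -> ->.
move=> /and3P[nm lL kN]; apply/allpairsPdep; exists (n, l), (k, b); split=> //.
  by apply/allpairsPdep; exists n, l; rewrite !mem_iota.
by apply/allpairsPdep; exists k, b; rewrite mem_iota; split=> //; case: (b).
Qed.

Lemma cells_sum (V : nmodType) (t : cell -> V) m L : \sum_(q <- cells m L) t q =
  \sum_(n < m) \sum_(l < L) \sum_(k < NN n l)
    (t (((n : nat), (l : nat)), ((k : nat), false)) + t (((n : nat), (l : nat)), ((k : nat), true))).
Proof.
have io N : iota 0 N = index_iota 0 N by rewrite /index_iota subn0.
rewrite /cells big_allpairs_dep /= big_allpairs_dep /= io big_mkord.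
apply: eq_bigr => n _; rewrite io big_mkord; apply: eq_bigr => l _.
rewrite big_flatten big_map io big_mkord; apply: eq_bigr => k _.
by rewrite !big_cons big_nil /= addr0.
Qed.

Lemma sub_cells (s : seq cell) : (forall q, q \in s -> valid q) ->
  exists N, forall m L, (N <= m)%N -> (N <= L)%N -> {subset s <= cells m L}.
Proof.
move=> sv; exists (\max_(q <- s) (maxn q.1.1.+1 q.1.2.+1))%N => m L Nm NL q qs.
have := @leq_bigmax_seq _ s xpredT (fun q : cell => maxn q.1.1.+1 q.1.2.+1) q qs isT.
rewrite geq_max => /andP[h1 h2]; rewrite mem_cells sv// andbT.
by rewrite (leq_trans h1 Nm) (leq_trans h2 NL).
Qed.

Definition psi (H : nat -> nat -> R) q : R :=
  if valid q then 2^-1 ^+ q.1.2 * 2^-1 ^+ q.1.2 * H q.1.1 (q.2.1 %/ 2 ^ q.1.2)%N else 0.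

Lemma psi_ge0 H q : (forall n k, 0 <= H n k) -> 0 <= psi H q.
Proof.
move=> H0; rewrite /psi; case: ifP => // _.
by rewrite !mulr_ge0// exprn_ge0// invr_ge0.
Qed.

(** Generation [l] has [2^l] points per node and two values of [b], so it contributes [2 * 2^-l]
    times the sum over nodes; over [l] this adds up to 4. *)
Lemma psi_sum (H : nat -> nat -> R) (B : R) : (forall n k, 0 <= H n k) ->
  (forall m, \sum_(n < m) \sum_(k < Nn n) H n k <= B) ->
  forall s : seq cell, uniq s -> \sum_(q <- s) psi H q <= 4 * B.
Proof.
move=> H0 HB s us.
have [N HN] : exists N, forall m L, (N <= m)%N -> (N <= L)%N -> {subset [seq q <- s | valid q] <= cells m L}.
  by apply: sub_cells => q; rewrite mem_filter => /andP[].
have sE : \sum_(q <- s) psi H q = \sum_(q <- [seq q <- s | valid q]) psi H q.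
  rewrite big_filter [RHS]big_mkcond /=; apply: eq_bigr => q _.
  by rewrite /psi; case: (valid q).
apply: (@le_trans _ _ (\sum_(q <- cells N N) psi H q)).
  rewrite sE (@sub_sum_split cell _ (psi H) _ _ (filter_uniq _ us) (cells_uniq N N) (HN N N (leqnn N) (leqnn N))).
  by rewrite lerDl sumr_ge0// => q _; exact: psi_ge0.
rewrite cells_sum; apply: (@le_trans _ _ (\sum_(n < N) 4 * \sum_(k < Nn n) H n k)); last first.
  by rewrite -mulr_sumr ler_pM2l.
apply: ler_sum => n _.
have G0 : 0 <= \sum_(k < Nn n) H n k by exact: sumr_ge0.
apply: (@le_trans _ _ (\sum_(l < N) (2 * \sum_(k < Nn n) H n k) * 2^-1 ^+ l)).
  apply: ler_sum => l _; rewrite le_eqVlt; apply/orP; left; apply/eqP.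
  rewrite (eq_bigr (fun k : 'I_(NN n l) => 2 * (2^-1 ^+ l * 2^-1 ^+ l) * H n (k %/ 2 ^ l)%N)).
    rewrite -mulr_sumr NN_Nn (sum_divn _ (H n)) ?expn_gt0// natrX.
    by rewrite exprVn; field; rewrite expf_neq0.
  by move=> k _; rewrite /psi /valid /= ltn_ord; ring.
rewrite -mulr_sumr; apply: (@le_trans _ _ (2 * (\sum_(k < Nn n) H n k) * 2)).
  rewrite ler_wpM2l ?mulr_ge0//.
  have h2 : 0 <= (2^-1 : R) < 1 by rewrite invr_ge0 ler0n invf_lt1// ltr1n.
  apply: le_trans (geo_sum_le N h2) _.
  by rewrite (_ : (1 - 2^-1)^-1 = 2 :> R)//; field.
by rewrite le_eqVlt; apply/orP; left; apply/eqP; ring.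
Qed.

Lemma ccvg_sum m (u : nat -> nat -> C) (l : nat -> C) :
  (forall n, ccvg (u n) (l n)) -> ccvg (fun L => \sum_(n < m) u n L) (\sum_(n < m) l n).
Proof.
move=> H; elim: m => [|m IH].
  rewrite big_ord0; apply: (eq_ccvg (u := fun=> 0)); last exact: ccvg_cst.
  by move=> L; rewrite big_ord0.
rewrite big_ord_recr /=; apply: (eq_ccvg _ (ccvgD IH (H m))) => L.
by rewrite big_ord_recr.
Qed.

End CellSums.

Section Expansion.
Variable R : realType.
Local Notation C := R[i].
Local Notation qn := (qn R).

Lemma atom_le nu M : normal nu -> exists2 K : R, 0 < K &
  forall (f : Hinf nu) q w, disk w ->
    normc (fnl q f * krn M.+1 q w) <= K * wnorm nu f *
      psi (fun n k => qn n ^+ M.+2 / wl nu n * normc (1 - (node R n k)^* * w) ^- M.+2) q.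
Proof.
move=> nun; have [K1 K10 H1] := fnl_le nun; have [K2 K20 H2] := krn_le R M.
exists (K1 * K2) => [|f [[n l] [k b]] w Dw]; first exact: mulr_gt0.
set H := (fun n k => _); have [kN|kN] := boolP (k < NN n l)%N; last first.
  by rewrite /krn (negPf kN) mulr0 nc0 /psi /valid /= (negPf kN) mulr0.
have -> : psi H ((n, l), (k, b)) = 2^-1 ^+ l * 2^-1 ^+ l * H n (k %/ 2 ^ l)%N.
  by rewrite /psi /valid /= kN.
rewrite ncM; apply: le_trans (ler_pM (normc_ge0 _) (normc_ge0 _) (H1 n l k b f) (H2 n l k b w Dw kN)) _.
rewrite le_eqVlt; apply/orP; left; apply/eqP.
by rewrite /H; case: b; ring.
Qed.

(** At a fixed [w] the atoms are absolutely summable by [discrete_FR]. Their sum is computed in the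
    order given by the proof: refinements of a level through [alias], then levels through
    [pieces_sum]. *)
Lemma expansion (nu : radial_weight R) beta M (f : Hinf nu) (w : C) : normal nu ->
  normal_exponent_I nu beta -> beta < M.+1%:R -> disk w ->
  csum (pick0 (fun q : cell => fnl q f * krn M.+1 q w)) (f w).
Proof.
move=> nun bI bM Dw; have [K K0 HK] := @atom_le nu M nun.
have [L L0 HL] := discrete_FR nun bI bM.
have [fa _ _] := HinfP f; have [a ta Ha] := Taylor_tame fa.
pose Hh n k := qn n ^+ M.+2 / wl nu n * normc (1 - (node R n k)^* * w) ^- M.+2.
have Hh0 n k : 0 <= Hh n k.
  rewrite /Hh mulr_ge0 ?invr_ge0 ?exprn_ge0 ?normc_ge0// divr_ge0 ?(ltW (wl_gt0 _ _))//.
  by rewrite exprn_ge0// ltW// qn_gt0.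
have Hhs m : \sum_(n < m) \sum_(k < Nn n) Hh n k <= L / nu w.
  rewrite ler_pdivlMr ?weight_gt0// mulrC; apply: le_trans (HL m w Dw).
  rewrite ler_pM2l ?weight_gt0//; apply: ler_sum => n _; by rewrite -mulr_sumr.
pose t q := fnl q f * krn M.+1 q w.
have tB (s : seq cell) : uniq s -> \sum_(q <- s) normc (t q) <= K * wnorm nu f * (4 * (L / nu w)).
  move=> us; apply: (@le_trans _ _ (\sum_(q <- s) K * wnorm nu f * psi Hh q)).
    by apply: ler_sum => q _; exact: HK.
  rewrite -mulr_sumr ler_wpM2l ?mulr_ge0 ?wnorm_ge0 ?(ltW K0)//.
  exact: psi_sum Hh0 Hhs s us.
have [Ln HLn] : exists Ln : nat -> C, forall n,
    csum (fun j => a j * (dk R M.+1 n j)%:C * w ^+ j) (Ln n) /\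
    ccvg (rmean (fun e => f ((Rn R n)%:C * e) * kap M.+1 n (argk n e w))) (Ln n).
  have ex n := @alias R f a n M.+1 w ta Dw Ha.
  exists (fun n => projT1 (cid2 (ex n))) => n; by case: (cid2 (ex n)).
apply: uconv_csum; apply: (@uconv_iter _ _ t _ cells (fun m => \sum_(n < m) Ln n) (f w) tB).
- exact: cells_uniq.
- move=> s st; apply: sub_cells => -[[n l] [k b]] /st; rewrite /t /valid /=.
  by case: (k < NN n l)%N => //; rewrite mulr0 eqxx.
- move=> m; apply: (@ccvg_shift _ _ _ 1%N).
  have h := @ccvg_sum R m (fun n L => rmean (fun e => f ((Rn R n)%:C * e) * kap M.+1 n (argk n e w)) (n + 6 + L)) Ln.
  apply: (eq_ccvg _ (h _)) => [l|n].
    rewrite addn1 cells_sum; apply: eq_bigr => n _; rewrite -incr_sum.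
    by apply: eq_bigr => l' _; apply: eq_bigr => k _; rewrite -fnl_krn.
  have [_ cv] := HLn n; move=> e e0; have [N HN] := cv e e0.
  by exists N => l Nl; apply: HN; apply: leq_trans Nl (leq_addl _ _).
exact: (@pieces_sum R f a M w Ln ta Dw Ha (fun n => (HLn n).1)).
Qed.

End Expansion.

(** * Assembly of the implications *)

Section Final.
Variable R : realType.
Local Notation C := R[i].
Local Notation qn := (qn R).

(** Since [q / t <= c], the surplus power [m - s] of the quotient is at most the same power of [c].
    This is where the integer exponent gives way to the real one. *)
Lemma pow_compare (q t s c : R) m : 0 < q -> 0 < t -> 0 <= c -> q <= c * t -> s <= m%:R ->
  q ^+ m / t ^+ m <= c `^ (m%:R - s) * (q `^ s / t `^ s).
Proof.
move=> q0 t0 c0 qt sm; have x0 : 0 < q / t by rewrite divr_gt0.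
have E p : q `^ p / t `^ p = (q / t) `^ p.
  by rewrite powRM ?invr_ge0 ?(ltW q0) ?(ltW t0)// -[t^-1]powR_inv1 ?(ltW t0)// powRAC powR_inv1// powR_ge0.
rewrite E -expr_div_n -powR_mulrn ?(ltW x0)//.
rewrite -{1}(subrK s m%:R) powRD ?(gt_eqF x0) ?implybT//.
rewrite ler_pM2r ?powR_gt0//; apply: ge0_ler_powR; rewrite ?nnegrE ?subr_ge0 ?(ltW x0)//.
by rewrite ler_pdivrMr.
Qed.

Lemma kernel_exponent (alpha beta : R) : -1 < alpha -> beta - 1 < alpha ->
  exists2 M : nat, beta < M.+1%:R & alpha + 2 <= M.+2%:R.
Proof.
move=> al ba; have a1 : 0 <= alpha + 1 by rewrite -lerBlDr sub0r ltW.
exists (Num.Def.archi_bound (alpha + 1)); have := archi_boundP a1.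
  by rewrite -natr1; move: ba; clear; lra.
by rewrite -natr1 -natr1; clear; lra.
Qed.

Section Op.
Variables (nu mu : radial_weight R).
Hypotheses (nun : normal nu) (mun : normal mu).
Variables (g phi : C -> C).
Hypotheses (ga : analytic g) (pa : analytic phi) (ps : self_map phi).
Variable T : {linear Hinf nu -> Hinf mu}.
Hypothesis TE : forall (f : Hinf nu) z, disk z -> T f z = int_op g phi f z.

Let a (z : C) : R := (1 - normc z ^+ 2) * mu z * normc (derive1 g z).

(** Testing [T] on the constant function 1 gives the bound; it makes the suprema [Gs] at the nodes
    finite. *)
Lemma op_weight_bounded : exists A : R, forall z, disk z -> a z <= A.
Proof.
have [_ nuII] := nun; have [K K0 HK] := T_deriv_le mun ga pa ps TE.
have h1 : Hinf_set nu (dext (fun=> 1)).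
  apply: Hzero_sub_Hinf; apply: (@dext_Hzero R nu _ 1 nuII) => z _.
    by exists 0; exact: cdiff_cst.
  by rewrite nc1.
pose f := MkHinf (introT (Hinf_predP nu _) h1).
exists (K * complex.Re `|T f|) => z Dz; have := HK f z Dz.
by rewrite /= dextE ?nc1 ?mulr1//; exact: ps.
Qed.

(** The bounds [b] and [c] share the gain in [l] differently for the two values of the boolean, but
    their product is always a constant times [psi H], whose sum the integral controls. *)
Lemma nuclear_of_area (alpha beta : R) : -1 < alpha ->
  normal_exponent_I nu beta -> beta - 1 < alpha ->
  (area_integral (fun zeta : C =>
     ereal_sup [set (a z / normc (1 - zeta^* * phi z) `^ (alpha + 2))%:E | z in @disk R]
     * ((1 - normc zeta ^+ 2) `^ alpha / nu zeta)%:E) < +oo)%E ->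
  nuclear T.
Proof.
move=> al bI ba fin; set s := alpha + 2 in fin.
have [M bM sM] := kernel_exponent al ba.
have a0 z : disk z -> 0 <= a z by exact: op_weight_ge0.
have [A aA] := op_weight_bounded.
have [B HB] := Gs_sum al ps a0 aA fin.
have [K1 K10 H1] := fnl_le nun; have [K2 K20 H2] := krn_le R M.
pose G n k := Gs a phi s (node R n k).
have G0 n k : 0 <= G n k by exact: (Gs_ge0 al ps a0 aA).
pose C4 : R := 4 `^ (M.+2%:R - s).
have C40 : 0 <= C4 by exact: powR_ge0.
pose H n k := qn n `^ s / wl nu n * G n k.
have H0 n k : 0 <= H n k.
  by rewrite /H mulr_ge0// divr_ge0 ?powR_ge0// ltW// wl_gt0.
have Hs m : \sum_(n < m) \sum_(k < Nn n) H n k <= B.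
  by apply: le_trans (HB m); apply: ler_sum => n _; rewrite -mulr_sumr.
pose p l : R := 2^-1 ^+ l.
have p0 l : 0 <= p l by rewrite exprn_ge0// invr_ge0.
pose b (q : cell) := K1 * (if q.2.2 then p q.1.2 else 1) / wl nu q.1.1.
pose c (q : cell) := if valid q then K2 * (if q.2.2 then 1 else p q.1.2) * p q.1.2 *
   (C4 * (qn q.1.1 `^ s * G q.1.1 (q.2.1 %/ 2 ^ q.1.2)%N)) else 0.
have b0 q : 0 <= b q.
  by rewrite /b divr_ge0 ?(ltW (wl_gt0 _ _))// mulr_ge0 ?(ltW K10)//; case: ifP.
have c0 q : 0 <= c q.
  rewrite /c; case: (valid q) => //; apply: mulr_ge0.
    by rewrite mulr_ge0// mulr_ge0 ?(ltW K20)//; case: ifP.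
  by apply: mulr_ge0 => //; apply: mulr_ge0 => //; exact: powR_ge0.
have bc q : b q * c q = K1 * K2 * C4 * psi H q.
  rewrite /b /c /psi; case: q => [[n l] [k bb]] /=; case: (valid _); last by rewrite !mulr0.
  by rewrite /H /p; case: bb; ring.
(* A default for integers that code no cell; [kp] is 0 there, so the functional attached to them
   does not affect the sum. *)
pose q0 : cell := ((0%N, 0%N), (0%N, false)).
pose kap0 (q : cell) : Hinf nu := MkHinf (introT (Hinf_predP nu _) (krn_Hinf M q nun)).
pose dec i : cell := odflt q0 (pickle_inv i).
pose xs i : {linear Hinf nu -> C} := @fnl R nu (dec i).
pose kp i : Hinf nu := pick0 kap0 i.
apply: (@nuclear_of_csum R nu mu mun g phi ga pa ps T TE xs kp
  (fun i => b (dec i)) (pick0 c) (K1 * K2 * C4 * (4 * B))) => //.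
- by move=> i; rewrite /pick0; case: pickle_inv.
- by move=> i f; rewrite /xs /b; case: (dec i) => [[n l] [k bb]]; exact: H1.
- move=> i z Dz; rewrite /kp /pick0; case: pickle_inv => [q|]; last by rewrite nc0 mulr0.
  have Dw := ps Dz; rewrite /= dextE//; case: q => [[n l] [k bb]].
  rewrite /c /valid /=; have [kN|kN] := boolP (k < NN n l)%N; last first.
    by rewrite nc0 mulr0.
  have := H2 n l k bb (phi z) Dw kN; rewrite /krn kN => h.
  apply: le_trans (ler_wpM2l (a0 z Dz) h) _.
  rewrite mulrCA; apply: ler_wpM2l.
    by rewrite mulr_ge0// mulr_ge0 ?(ltW K20)//; case: (bb).
  have tq := node_kern_ge n (k %/ 2 ^ l) Dw.
  have t0 := kern_neq0 n (k %/ 2 ^ l) Dw.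
  have qt : qn n <= 4 * normc (1 - (node R n (k %/ 2 ^ l))^* * phi z).
    by rewrite mulrC -ler_pdivrMr.
  (* Passing to the exponent [s] brings out the expression whose supremum over [z] is [Gs] at the
     node. *)
  have cmp := pow_compare (qn_gt0 R n) t0 (ler0n R 4) qt sM.
  apply: le_trans (ler_wpM2l (a0 z Dz) cmp) _.
  rewrite mulrCA; apply: ler_wpM2l => //; rewrite mulrCA; apply: ler_wpM2l; first exact: powR_ge0.
  exact: (Gs_ge al ps a0 aA).
- move=> n; apply: (@le_trans _ _ (\sum_(i < n) pick0 (fun q => b q * c q) i)).
    apply: ler_sum => i _; rewrite /dec /pick0; case: pickle_inv => //=.
    by rewrite mulr0.
  rewrite penum_sum; under eq_bigr do rewrite bc.
  rewrite -mulr_sumr; apply: ler_wpM2l; first by rewrite !mulr_ge0// ltW.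
  exact: psi_sum H0 Hs _ (penum_uniq _ _).
move=> f w Dw; apply: (eq_ccvg _ (expansion f nun bI bM Dw)) => n.
apply: eq_bigr => i _; rewrite /xs /kp /dec /pick0; case: pickle_inv => [q|] /=.
  by rewrite dextE.
by rewrite mulr0.
Qed.

End Op.

(** Restricting the functionals to the subspace does not increase their norms, because its norm is
    the induced one. *)
Lemma nuclear_restrict (nu : radial_weight R) (Y : normedModType C)
    (T : {linear Hinf nu -> Y}) : nuclear T ->
  nuclear (T \o @Hzero_incl R nu : {linear Hzero nu -> Y}).
Proof.
move=> [xs [ys [bx sx cx]]].
exists (fun k => xs k \o @Hzero_incl R nu : {linear Hzero nu -> C}), ys; split.
- by move=> k; have [M HM] := bx k; exists M => f; exact: HM.
- apply: le_lt_trans sx; apply: lee_nneseries => k _.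
    move=> _; rewrite lee_fin mulr_ge0 ?Re_norm_ge0// dual_norm_ge0//.
    by have [M HM] := bx k; exists M => f; exact: HM.
  rewrite lee_fin ler_wpM2r ?Re_norm_ge0//; apply: ge_sup.
    by exists (normc (xs k (Hzero_incl 0))), 0 => //=; rewrite normr0 ler01.
  move=> _ [f /= f1 <-]; have [_ ub] := dual_has_sup (bx k).
  by apply: ub_le_sup => //; exists (Hzero_incl f).
by move=> f; exact: cx.
Qed.

End Final.

Theorem theorem5 (R : realType) (nu mu : radial_weight R)
  (nu_normal : normal nu) (mu_normal : normal mu)
  (alpha : R) (alpha_gt : -1 < alpha)
  (om : R[i] -> R) (nu_om_pair : normal_pair nu om alpha)
  (g phi : R[i] -> R[i]) (g_analytic : analytic g)
  (phi_analytic : analytic phi) (phi_self : self_map phi)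
  (T : {linear Hinf nu -> Hinf mu})
  (TE : forall (f : Hinf nu) z, disk z -> T f z = int_op g phi f z)
  (T_bounded : bounded_operator T) :
  [<-> nuclear (T \o @Hzero_incl R nu : {linear Hzero nu -> Hinf mu});
       nuclear T;
       (area_integral (fun zeta : R[i] =>
          ereal_sup [set (((1 - normc z ^+ 2) * mu z * normc (derive1 g z)) /
                          normc (1 - zeta^* * phi z) `^ (alpha + 2))%:E
                    | z in @disk R]
          * ((1 - normc zeta ^+ 2) `^ alpha / nu zeta)%:E) < +oo)%E].
Proof.
have [_ _ _ [beta bI ba] _] := nu_om_pair.
have ac : nuclear (T \o @Hzero_incl R nu : {linear Hzero nu -> Hinf mu}) ->
   (area_integral (fun zeta : R[i] =>
          ereal_sup [set (((1 - normc z ^+ 2) * mu z * normc (derive1 g z)) /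
                          normc (1 - zeta^* * phi z) `^ (alpha + 2))%:E
                    | z in @disk R]
          * ((1 - normc zeta ^+ 2) `^ alpha / nu zeta)%:E) < +oo)%E.
  move=> nT; have [M bM _] := kernel_exponent alpha_gt ba.
  have [gam [B [g0 gle gs]]] :=
    test_sum nu_normal mu_normal g_analytic phi_analytic phi_self TE bI bM nT.
  exact: (area_finite nu_normal bI ba (fun z Dz => op_weight_ge0 mu g Dz) phi_self g0 gle gs).
have cb := nuclear_of_area nu_normal mu_normal g_analytic phi_analytic phi_self TE alpha_gt bI ba.
have ba' := @nuclear_restrict R nu (Hinf mu) T.
tfae.
- by move=> /ac /cb.
- by move=> /ba' /ac.
- by move=> /cb /ba'.
Qed.
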